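(* For each conjugacy class $\mathcal O$ of $\tilde W$ fix a minimal length element $\tilde w_{\mathcal O}\in\mathcal O$. Then for every $\tilde w\in\tilde W$ there exist polynomials $f_{\tilde w,\mathcal O}\in\mathbb Z[v-v^{-1}]$ with nonnegative coefficients, nonzero for only finitely many $\mathcal O$, such that $$T_{\tilde w}\equiv\sum_{\mathcal O}f_{\tilde w,\mathcal O}\,T_{\tilde w_{\mathcal O}}\mod[\tilde H,\tilde H].$$
   Context: Setting: $W=Q\rtimes W_0$ affine Weyl group (Coxeter group with simple reflections $S$), $\tilde W=P\rtimes(W_0\rtimes\Omega')=W\rtimes\Omega$ for a connected complex reductive group with coweight lattice $P$ and finite group $\Omega'$ of diagram automorphisms, $\ell$ the length on $\tilde W$ (number of affine root hyperplanes separating fundamental alcove from its image), $\Omega=\{\ell=0\}$. Let $\mathcal A=\mathbb Z[v,v^{-1}]$. The Hecke algebra $\tilde H$ is the $\mathcal A$-algebra with $\mathcal A$-basis $\{T_w\}_{w\in\tilde W}$ and multiplication determined by $T_xT_y=T_{xy}$ if $\ell(xy)=\ell(x)+\ell(y)$, and $(T_s-v)(T_s+v^{-1})=0$ for $s\in S$. $[\tilde H,\tilde H]$ is the $\mathcal A$-submodule spanned by all commutators $hh'-h'h$. Conjugacy classes are those of the group $\tilde W$. *)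

(* Defs.v *)
From HB Require Import structures.
From mathcomp Require Import all_boot all_order all_algebra.
Set Implicit Arguments. Unset Strict Implicit. Unset Printing Implicit Defensive.
Import Order.TTheory GRing.Theory Num.Theory.
Local Open Scope ring_scope.

(* Root datum.  The cocharacter ( = coweight) lattice P is Z^n, realised as  *)
(* integer row vectors 'rV[int]_n; the character lattice X is also Z^n,      *)
(* paired with P by the standard dot product.  Roots Phi live in X, the      *)
(* coroot map cor : X -> P sends a root a to its coroot a^v.                 *)

Definition ipair n (a y : 'rV[int]_n) : int := \sum_(i < n) a 0 i * y 0 i.
Definition qpair n (a : 'rV[int]_n) (x : 'rV[rat]_n) : rat :=
  \sum_(i < n) (a 0 i)%:~R * x 0 i.

(* The reflection s_a acting on P (on the right of row vectors):
   y *m refl cor a = y - <a,y> a^v *)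
Definition refl n (cor : 'rV[int]_n -> 'rV[int]_n) (a : 'rV[int]_n) : 'M[int]_n :=
  1%:M - (a^T *m cor a).

Definition root_datum n (Phi : seq 'rV[int]_n) (cor : 'rV[int]_n -> 'rV[int]_n)
  : Prop :=
  uniq Phi /\
  [/\ {in Phi, forall a, ipair a (cor a) = 2},
      {in Phi &, injective cor},
      (forall a b, a \in Phi -> b \in Phi -> b - (ipair b (cor a)) *: a \in Phi),
      (forall a b, a \in Phi -> b \in Phi -> exists2 c, c \in Phi &
                   cor c = cor b - (ipair a (cor b)) *: cor a)
    & {in Phi, forall a, a *+ 2 \notin Phi}].

(* positive system: the roots positive on a regular element xi *)
Definition regular n (Phi : seq 'rV[int]_n) (xi : 'rV[int]_n) : Prop :=
  {in Phi, forall a, ipair a xi != 0}.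
Definition posr n (xi a : 'rV[int]_n) : bool := 0 < ipair a xi.

(* a diagram automorphism: an automorphism w of P (y |-> y *m w) preserving
   the based root datum (coroots, roots via the contragredient, positivity) *)
Definition diagram_aut n (Phi : seq 'rV[int]_n) (cor : 'rV[int]_n -> 'rV[int]_n)
  (xi : 'rV[int]_n) (w : 'M[int]_n) : Prop :=
  w \in unitmx /\
  {in Phi, forall a, (exists2 b, b \in Phi &
     [/\ cor a *m w = cor b, b *m w^T = a & posr xi a = posr xi b])}.

Definition diagram_group n Phi cor xi (Om : seq 'M[int]_n) : Prop :=
  [/\ 1%:M \in Om,
      (forall w1 w2, w1 \in Om -> w2 \in Om -> w1 *m w2 \in Om)
    & {in Om, forall w, diagram_aut Phi cor xi w}].

Definition prodmx n (s : seq 'M[int]_n) : 'M[int]_n :=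
  foldr (fun A B => A *m B) 1%:M s.

Section AffineWeyl.
Variables (n : nat) (Phi : seq 'rV[int]_n) (cor : 'rV[int]_n -> 'rV[int]_n)
          (xi : 'rV[int]_n) (Om : seq 'M[int]_n) (x0 : 'rV[rat]_n).

Definition inW0 (A : 'M[int]_n) : Prop :=
  exists s : seq 'M[int]_n, all (fun M => M \in map (refl cor) Phi) s /\ A = prodmx s.
Definition inW0ext (A : 'M[int]_n) : Prop :=
  exists s : seq 'M[int]_n,
    all (fun M => (M \in map (refl cor) Phi) || (M \in Om)) s /\ A = prodmx s.

Definition inQ (t : 'rV[int]_n) : Prop :=
  exists c : seq (int * 'rV[int]_n),
    all (fun p => p.2 \in Phi) c /\ t = \sum_(p <- c) p.1 *: cor p.2.

Definition aff := ('M[int]_n * 'rV[int]_n)%type.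
Definition amul (g h : aff) : aff := (h.1 *m g.1, h.2 *m g.1 + g.2). (* g o h *)
Definition act (g : aff) (x : 'rV[rat]_n) : 'rV[rat]_n :=
  x *m map_mx (fun z : int => z%:~R) g.1 + map_mx (fun z : int => z%:~R) g.2.

(* extended affine Weyl group  W~ = P ⋊ (W_0 ⋊ Om') *)
Definition inWt (g : aff) : Prop := inW0ext g.1.
Definition inW (g : aff) : Prop := inW0 g.1 /\ inQ g.2.

Definition in_fund_alcove (x : 'rV[rat]_n) : Prop :=
  {in Phi, forall a, posr xi a -> 0 < qpair a x < 1}.

(* length: number of affine root hyperplanes H_{a,k} = {<a,.> = k}
   (a positive root, k integer) separating x0 and g(x0); since
   0 < <a,x0> < 1 these are exactly |floor <a, g x0>| many for each a. *)
Definition len (g : aff) : nat :=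
  \sum_(a <- Phi | posr xi a) `|Num.floor (qpair a (act g x0))|%N.

(* simple reflections S of the Coxeter group W: its length-one elements *)
Definition inS (s : aff) : Prop := inW s /\ len s = 1%N.

Definition conjW (g h : aff) : Prop := exists2 k, inWt k & amul k g = amul h k.

(* Hecke algebra.  A = Z[v,v^-1] is realised inside K = Frac(Z[v]).  We     *)
(* take a K-algebra H with K-basis (T_w)_{w in W~} satisfying the Hecke      *)
(* relations; the A-span of the T_w is then the A-algebra H~.               *)
Definition K := {fraction {poly int}}.
Definition v : K := FracField.tofrac ('X : {poly int}).
Definition isA (a : K) : Prop :=
  exists (p : {poly int}) (k : nat), a = FracField.tofrac p / v ^+ k.

Definition evvv (q : {poly int}) : K :=
  (map_poly (fun z : int => (z%:~R : K)) q).[v - v^-1].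

Variables (H : algType K) (T : aff -> H).

Definition lincomb (s : seq (K * aff)) : H := \sum_(p <- s) p.1 *: T p.2.

Definition is_basis : Prop :=
  (forall h : H, exists s : seq (K * aff),
      (forall p, p \in s -> inWt p.2) /\ h = lincomb s) /\
  (forall s : seq (K * aff), uniq (map snd s) ->
      (forall p, p \in s -> inWt p.2) -> lincomb s = 0 ->
      forall p, p \in s -> p.1 = 0).

Definition hecke_rel : Prop :=
  (forall x y, inWt x -> inWt y -> len (amul x y) = (len x + len y)%N ->
      T (amul x y) = T x * T y) /\
  (forall s, inS s -> (T s - v%:A) * (T s + v^-1%:A) = 0).

Definition inHt (h : H) : Prop :=
  exists s : seq (K * aff),
    (forall p, p \in s -> isA p.1 /\ inWt p.2) /\ h = lincomb s.

Definition inComm (h : H) : Prop :=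
  exists s : seq (K * H * H),
    (forall p, p \in s -> [/\ isA p.1.1, inHt p.1.2 & inHt p.2]) /\
    h = \sum_(p <- s) p.1.1 *: (p.1.2 * p.2 - p.2 * p.1.2).

End AffineWeyl.

(* Main.v *)
(** Fix [w] and conjugate it by [g]: [g^-1 w g] is described by the pair of
    alcoves [(g C0, w g C0)], and its length counts the hyperplanes separating
    them.  Crossing a wall [H] of [g C0] is conjugation by a simple reflection;
    it does not increase the length as soon as [H] separates [g C0] from
    [w g C0] or from [w^-1 g C0], and it either keeps the class of [T] in the
    cocenter or yields [T_u = T_{u1} + (v - v^-1) T_{u2}] with [u1], [u2]
    shorter.  So, by induction on the length, it suffices that an element from
    which no sequence of such moves decreases the length has the same class as
    a minimal length element of its conjugacy class.

    For this, follow (in the manner of He and Nie) the gradient flow of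
    [x |-> |w x - x|^2]: every wall it crosses is an allowed move, so one may
    assume that the closed alcove contains a regular point [p] of the affine
    subspace on which [w] acts as a translation.  Two such points are joined
    through a strong conjugation along the translation axis.  What remains is
    the finite residue of alcoves at [p], treated by induction on the dimension:
    flow to the eigenspace of [w + w^-1] for its largest eigenvalue [lam] on the
    orthogonal of the part already used.  There [w] is a rotation, every generic
    wall crossing is allowed in both directions, and [p] may be moved freely.
    If [lam = -2] then [w] acts as [-1] and all crossings at [p] are allowed. *)

Require Import Defs.
From HB Require Import structures.
From mathcomp Require Import all_boot all_order all_algebra.
From mathcomp Require Import fingroup perm.
From mathcomp Require Import ring lra zify.
From mathcomp Require Import boolp classical_sets reals topology normedtype derive.
From mathcomp Require Import Rstruct.
From Stdlib Require Rdefinitions.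
Set Implicit Arguments. Unset Strict Implicit. Unset Printing Implicit Defensive.
Import Order.TTheory GRing.Theory Num.Theory.
Import numFieldNormedType.Exports.
Local Open Scope ring_scope.

(** * The integral pairing and the group of affine maps *)

Section Pairing.
Variable n : nat.
Implicit Types (a b y : 'rV[int]_n) (A B : 'M[int]_n).

(** Why the flows cross only allowed walls: let a flow with direction [d] pass through a point [x]
    of the hyperplane where the root [a] has value [k]. In both flows the values of [a] at [w x] and
    [w^-1 x] add up to [2 k + a(d)]. For the flow to the axis, [d = u (symA - 2)] and the
    translation parts cancel; inside a residue, [d = u (symA - lam)] and the eigenvector part drops
    out because [a] vanishes on the offset. A wall that blocks the flow has [a(d) < 0], so [w x] or
    [w^-1 x] lies strictly beyond it. On the eigenspace itself the sum is exactly [2 k]: generically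
    the two points lie on opposite sides, so the crossing is allowed in both directions and cannot
    change the length. No flow is ever integrated. The reachable point closest to the target exists
    by compactness, and a further small move shows that it is the target. This, and eigenvalues that
    are irrational in general, is why points are real although alcoves are recorded by the integral
    floors of the roots. *)

Lemma ipairE a y : ipair a y = (y *m a^T) 0 0.
Proof. by rewrite mxE; apply: eq_bigr => i _; rewrite mxE mulrC. Qed.

Lemma ipairC a y : ipair a y = ipair y a.
Proof. by apply: eq_bigr => i _; rewrite mulrC. Qed.

Lemma ipairDr a y z : ipair a (y + z) = ipair a y + ipair a z.
Proof. by rewrite !ipairE mulmxDl mxE. Qed.

Lemma ipairZr a k y : ipair a (k *: y) = k * ipair a y.
Proof. by rewrite !ipairE -scalemxAl mxE. Qed.

Lemma ipairNr a y : ipair a (- y) = - ipair a y.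
Proof. by rewrite -scaleN1r ipairZr mulN1r. Qed.

Lemma ipairBr a y z : ipair a (y - z) = ipair a y - ipair a z.
Proof. by rewrite ipairDr ipairNr. Qed.

Lemma ipairZl a k y : ipair (k *: a) y = k * ipair a y.
Proof. by rewrite !(ipairC _ y) ipairZr. Qed.

Lemma ipairNl a y : ipair (- a) y = - ipair a y.
Proof. by rewrite !(ipairC _ y) ipairNr. Qed.

Lemma ipairBl a b y : ipair (a - b) y = ipair a y - ipair b y.
Proof. by rewrite !(ipairC _ y) ipairBr. Qed.

Lemma ipair_mulmx a y A : ipair a (y *m A) = ipair (a *m A^T) y.
Proof. by rewrite !ipairE trmx_mul trmxK mulmxA. Qed.

Lemma ipair_sumr (I : Type) (r : seq I) a (F : I -> 'rV[int]_n) :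
  ipair a (\sum_(i <- r) F i) = \sum_(i <- r) ipair a (F i).
Proof.
by elim/big_rec2: _ => [|i x y _ <-]; rewrite ?ipairDr // ipairE mul0mx mxE.
Qed.

Lemma ipair_suml (I : Type) (r : seq I) y (F : I -> 'rV[int]_n) :
  ipair (\sum_(i <- r) F i) y = \sum_(i <- r) ipair (F i) y.
Proof. by rewrite ipairC ipair_sumr; apply: eq_bigr => i _; rewrite ipairC. Qed.

Lemma mulmx_tr_ipair y a : y *m a^T = (ipair a y)%:M.
Proof. by rewrite ipairE; apply: mx11_scalar. Qed.

Lemma prodmx_cat (s t : seq 'M[int]_n) : prodmx (s ++ t) = prodmx s *m prodmx t.
Proof. by elim: s => [|A s IH] /=; rewrite ?mul1mx // IH mulmxA. Qed.

End Pairing.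

Section AffineGroup.
Variable n : nat.
Implicit Types g h k : aff n.

Definition aid : aff n := (1%:M, 0).
Definition ainv g : aff n := (invmx g.1, - (g.2 *m invmx g.1)).

Lemma amulA g h k : amul g (amul h k) = amul (amul g h) k.
Proof. by rewrite /amul /= !mulmxA mulmxDl addrA. Qed.

Lemma amul1g g : amul aid g = g.
Proof. by case: g => A t; rewrite /amul /= !mulmx1 addr0. Qed.

Lemma amulg1 g : amul g aid = g.
Proof. by case: g => A t; rewrite /amul /= mul1mx mul0mx add0r. Qed.

Lemma amulgV g : g.1 \in unitmx -> amul g (ainv g) = aid.
Proof.
move=> u; rewrite /amul /ainv /= mulVmx // mulNmx -mulmxA mulVmx // mulmx1.
by rewrite addNr.
Qed.

Lemma amulVg g : g.1 \in unitmx -> amul (ainv g) g = aid.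
Proof. by move=> u; rewrite /amul /ainv /= mulmxV // subrr. Qed.

End AffineGroup.
Arguments aid {n}.

(** * Root data and finiteness of the linear part *)

Lemma pigeonhole (T : eqType) (s : seq T) (P : nat -> T -> Prop) :
  (forall j, exists2 x, x \in s & P j x) ->
  exists i j x, [/\ (i < j)%N, P i x & P j x].
Proof.
move=> h.
have [t st ht] : exists2 t, size t = (size s).+1 &
    forall i d, (i < (size s).+1)%N -> nth d t i \in s /\ P i (nth d t i).
  elim: (size s).+1 => [|m [t st ht]]; first by exists [::].
  have [x xs Px] := h m; exists (rcons t x); first by rewrite size_rcons st.
  move=> i d; rewrite ltnS leq_eqVlt => /orP[/eqP ->|im].
    by rewrite nth_rcons st ltnn eqxx.
  by rewrite nth_rcons st im; apply: ht.
have [x0 _ _] := h 0.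
have : ~~ uniq t.
  apply/negP => ut; suff : (size t <= size s)%N by rewrite st ltnn.
  apply: uniq_leq_size => // x /(nthP x0)[i]; rewrite st => /ht h1 <-.
  by case: (h1 x0).
move=> /(uniqPn x0)[i [j [ij]]]; rewrite st => js e.
exists i, j, (nth x0 t j); split=> //; last by case: (ht j x0 js).
by rewrite -e; case: (ht i x0 (ltn_trans ij js)).
Qed.

Section RootDatum.
Variables (n : nat) (Phi : seq 'rV[int]_n) (cor : 'rV[int]_n -> 'rV[int]_n)
          (xi : 'rV[int]_n) (Om : seq 'M[int]_n).
Hypothesis hRD : root_datum Phi cor.
Hypothesis hOm : diagram_group Phi cor xi Om.
Implicit Types (a b : 'rV[int]_n) (A B u : 'M[int]_n).

Lemma Phi_uniq : uniq Phi. Proof. by case: hRD. Qed.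

Lemma root_cor a : a \in Phi -> ipair a (cor a) = 2.
Proof. by case: hRD => _ [h _ _ _ _]; apply: h. Qed.

Lemma mulmx_refl y a : y *m refl cor a = y - ipair a y *: cor a.
Proof. by rewrite mulmxBr mulmx1 mulmxA mulmx_tr_ipair mul_scalar_mx. Qed.

Lemma mulmx_reflT b a : b *m (refl cor a)^T = b - ipair b (cor a) *: a.
Proof.
rewrite linearB /= trmx1 mulmxBr mulmx1 trmx_mul trmxK mulmxA mulmx_tr_ipair.
by rewrite mul_scalar_mx ipairC.
Qed.

Lemma reflK a : a \in Phi -> refl cor a *m refl cor a = 1%:M.
Proof.
move=> aP; apply/row_matrixP => i; rewrite row_mul row1 rowE !mulmx_refl.
rewrite ipairBr ipairZr root_cor //.
by apply/rowP => j; rewrite !mxE; ring.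
Qed.

Lemma root_refl a b : a \in Phi -> b \in Phi -> b *m (refl cor a)^T \in Phi.
Proof. by move=> aP bP; rewrite mulmx_reflT; case: hRD => _ [_ _ h _ _]; apply: h. Qed.

Lemma root_opp a : a \in Phi -> - a \in Phi.
Proof.
move=> aP; have := root_refl aP aP; rewrite mulmx_reflT root_cor //.
by congr (_ \in Phi); rewrite scaler_nat mulr2n opprD addrA subrr add0r.
Qed.

Lemma root_neq_opp a : a \in Phi -> a != - a.
Proof.
move=> aP; apply/eqP => e; have := root_cor aP.
have : ipair a (cor a) = - ipair a (cor a) by rewrite {1}e ipairNl.
lia.
Qed.

Definition gen A := (A \in map (refl cor) Phi) || (A \in Om).

Lemma refl_unit a : a \in Phi -> refl cor a \in unitmx.
Proof. by move=> /reflK h; case: (mulmx1_unit h). Qed.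

Lemma gen_unit A : gen A -> A \in unitmx.
Proof.
case/orP => [/mapP[a aP ->]|AO]; first exact: refl_unit.
by case: hOm => _ _ /(_ A AO) [].
Qed.

Lemma gen_root A a : gen A -> a \in Phi -> a *m A^T \in Phi.
Proof.
case/orP => [/mapP[b bP ->]|AO aP]; first exact: root_refl.
have [_ _ /(_ A AO) [uA hA]] := hOm.
have sub : {subset Phi <= map (fun b => b *m A^T) Phi}.
  by move=> b /hA[c cP [_ <- _]]; apply: map_f.
have [_ ei] := uniq_min_size Phi_uniq sub (eq_leq (size_map _ _)).
by rewrite ei; apply: map_f.
Qed.

Lemma W0ext1 : inW0ext Phi cor Om 1%:M.
Proof. by exists [::]. Qed.

Lemma W0ext_mul A B : inW0ext Phi cor Om A -> inW0ext Phi cor Om B ->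
  inW0ext Phi cor Om (A *m B).
Proof.
case=> s [hs ->] [t [ht ->]]; exists (s ++ t).
by rewrite all_cat hs ht prodmx_cat.
Qed.

Lemma W0ext_unit A : inW0ext Phi cor Om A -> A \in unitmx.
Proof.
case=> s [hs ->]; elim: s hs => [|B s IH] /=; first by rewrite unitmx1.
by case/andP => /gen_unit uB /IH us; rewrite unitmx_mul uB us.
Qed.

Lemma W0ext_root A a : inW0ext Phi cor Om A -> a \in Phi -> a *m A^T \in Phi.
Proof.
case=> s [hs ->]; elim: s hs a => [|B s IH] /=.
  by move=> _ a; rewrite trmx1 mulmx1.
case/andP => gB hs a aP; rewrite trmx_mul mulmxA.
by apply: gen_root => //; apply: IH.
Qed.

Lemma W0_W0ext A : inW0 Phi cor A -> inW0ext Phi cor Om A.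
Proof.
case=> s [hs ->]; exists s; split=> //; apply: sub_all hs => B ->.
by [].
Qed.

Lemma W0_mul A B : inW0 Phi cor A -> inW0 Phi cor B -> inW0 Phi cor (A *m B).
Proof.
case=> s [hs ->] [t [ht ->]]; exists (s ++ t).
by rewrite all_cat hs ht prodmx_cat.
Qed.

Lemma W0_refl a : a \in Phi -> inW0 Phi cor (refl cor a).
Proof.
by move=> aP; exists [:: refl cor a]; rewrite /= mulmx1 andbT; split=> //; apply: map_f.
Qed.

Lemma W0_inv A : inW0 Phi cor A -> exists2 B, inW0 Phi cor B & B *m A = 1%:M.
Proof.
case=> s [hs ->]; elim: s hs => [|C s IH] /=.
  by exists 1%:M; [exists [::] | rewrite mulmx1].
case/andP => /mapP[a aP ->] /IH[B BW e].
exists (B *m refl cor a); first by apply: W0_mul => //; apply: W0_refl.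
by rewrite -mulmxA (mulmxA (refl cor a)) reflK // mul1mx.
Qed.

Lemma W0ext_decomp A : inW0ext Phi cor Om A ->
  exists om u, [/\ om \in Om, inW0 Phi cor u & A = om *m u].
Proof.
case=> s [hs ->]; elim: s hs => [|C s IH] /=.
  by exists 1%:M, 1%:M; split; [case: hOm | exists [::] | rewrite mulmx1].
case/andP => hC /IH[om [u [oP uW ->]]].
case/orP: hC => [/mapP[a aP ->]|CO]; last first.
  exists (C *m om), u; split=> //; last by rewrite mulmxA.
  by case: hOm => _ h _; apply: h.
have [_ _ /(_ om oP) [uo /(_ a aP) [b bP [e1 e2 _]]]] := hOm.
exists om, (refl cor b *m u); split=> //.
  by apply: W0_mul => //; apply: W0_refl.
rewrite !mulmxA; congr (_ *m u).
rewrite mulmxBl mulmxBr mul1mx mulmx1; congr (_ - _).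
by rewrite -mulmxA e1 -e2 trmx_mul trmxK mulmxA.
Qed.

(** A form on the character lattice invariant under [W_0]. It is positive on each root but may be
    degenerate, since the coroots need not span. *)
Definition coform (f g : 'rV[int]_n) : int :=
  \sum_(b <- Phi) ipair f (cor b) * ipair g (cor b).

(** The dual reflection [sg] permutes the coroots, so it only reorders the sum. *)
Lemma coform_refl f g a : a \in Phi ->
  coform (f - ipair f (cor a) *: a) (g - ipair g (cor a) *: a) = coform f g.
Proof.
move=> aP; pose sg (y : 'rV[int]_n) := y - ipair a y *: cor a.
have cu : uniq (map cor Phi).
  by rewrite map_inj_in_uniq ?Phi_uniq //; case: hRD => _ [].
have sgi : injective sg.
  apply: (can_inj (g := sg)) => y; rewrite /sg ipairBr ipairZr root_cor //.
  by apply/rowP => j; rewrite !mxE; ring.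
have sub : {subset map sg (map cor Phi) <= map cor Phi}.
  move=> _ /mapP[_ /mapP[b bP ->] ->].
  have [_ [_ _ _ h _]] := hRD; have [c cP e] := h a b aP bP.
  by rewrite /sg -e map_f.
have p : perm_eq (map sg (map cor Phi)) (map cor Phi).
  have us : uniq (map sg (map cor Phi)) by rewrite map_inj_uniq.
  apply: uniq_perm => //.
  by case: (uniq_min_size us sub (eq_leq (esym (size_map _ _)))) => _ e y; rewrite e.
rewrite /coform -[RHS](big_map cor xpredT (fun y => ipair f y * ipair g y)).
rewrite -(perm_big _ p) !big_map; apply: eq_bigr => b _.
by rewrite /sg !ipairBl !ipairBr !ipairZl !ipairZr; ring.
Qed.

(* Invariance under the reflection in [a], which maps [a] to [- a]. *)
Lemma coform_root a f : a \in Phi ->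
  2 * coform a f = ipair f (cor a) * coform a a.
Proof.
move=> aP; have h := coform_refl a f aP.
suff : coform a f = - coform a f + ipair f (cor a) * coform a a by lia.
rewrite -{1}h root_cor // /coform mulr_sumr -sumrN -big_split /=.
by apply: eq_bigr => b _; rewrite !ipairBl !ipairZl; ring.
Qed.

Lemma coform_root_gt0 a : a \in Phi -> 0 < coform a a.
Proof.
move=> aP; rewrite /coform (big_rem a aP) /= root_cor //.
apply: ltr_wpDr => //; rewrite big_seq; apply: sumr_ge0 => b _.
by rewrite -expr2 sqr_ge0.
Qed.

(* The combination [chi] of roots satisfies [K0 * f(x) = coform chi f] for all [f], so
   [coform chi chi = K0 * chi(x) = 0] and hence [coform chi f = 0]. *)
Lemma cospan_eq0 (c : 'rV[int]_n -> int) :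
  let x := \sum_(b <- Phi) c b *: cor b in
  {in Phi, forall a, ipair a x = 0} -> x = 0.
Proof.
move=> x hx.
pose K0 := \prod_(b <- Phi) coform b b.
pose k b := \prod_(d <- rem b Phi) coform d d.
have K0E b : b \in Phi -> K0 = k b * coform b b.
  by move=> bP; rewrite /K0 (big_rem b bP) /= mulrC.
have K0gt0 : 0 < K0 by rewrite /K0 big_seq; apply: prodr_gt0 => b /coform_root_gt0.
pose chi := \sum_(b <- Phi) (2 * c b * k b) *: b.
have key f : K0 * ipair f x = coform chi f.
  rewrite /x ipair_sumr mulr_sumr [RHS](_ : _ = \sum_(b <- Phi) (2 * c b * k b) * coform b f).
    rewrite big_seq [RHS]big_seq; apply: eq_bigr => b bP.
    rewrite ipairZr (K0E b bP).
    rewrite [LHS](_ : _ = k b * c b * (ipair f (cor b) * coform b b)); last by ring.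
    by rewrite -coform_root //; ring.
  rewrite /coform /chi.
  under eq_bigr do rewrite ipair_suml mulr_suml.
  rewrite exchange_big /=; apply: eq_bigr => b _; rewrite mulr_sumr.
  by apply: eq_bigr => d _; rewrite ipairZl; ring.
have chi0 : coform chi chi = 0.
  rewrite -key /chi ipair_suml big_seq big1 ?mulr0 // => b bP.
  by rewrite ipairZl hx // mulr0.
have chib : {in Phi, forall b, ipair chi (cor b) = 0}.
  move=> b bP; move: chi0; rewrite /coform (big_rem b bP) /= => e.
  move/eqP: e; rewrite paddr_eq0 -?expr2 ?sqr_ge0 //; last first.
    by apply: sumr_ge0 => d _; rewrite -expr2 sqr_ge0.
  by rewrite sqrf_eq0 => /andP[/eqP].
apply/rowP => j; rewrite [RHS]mxE.
have : K0 * ipair (delta_mx 0 j) x = 0.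
  rewrite key /coform big_seq big1 // => b bP; by rewrite chib // mul0r.
move/eqP; rewrite mulf_eq0 gt_eqF //= => /eqP.
rewrite /ipair (bigD1 j) //= big1 ?addr0.
  by rewrite mxE !eqxx mul1r.
by move=> i /negPf ij; rewrite mxE eqxx ij mul0r.
Qed.

Lemma W0_cospan u y : inW0 Phi cor u ->
  exists c : 'rV[int]_n -> int, y *m u - y = \sum_(b <- Phi) c b *: cor b.
Proof.
case=> s [hs ->]; elim: s hs y => [|C s IH] /=.
  move=> _ y; exists (fun=> 0); rewrite mulmx1 subrr big1 // => b _.
  by rewrite scale0r.
case/andP => /mapP[a aP ->] /IH{}IH y.
have [c e] := IH (y *m refl cor a).
exists (fun b => c b - (b == a)%:R * ipair a y).
rewrite mulmxA -[_ *m prodmx s](subrK (y *m refl cor a)) e mulmx_refl.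
under [RHS]eq_bigr do rewrite scalerBl.
rewrite sumrB -addrA [X in _ + X](_ : _ = - (ipair a y *: cor a)); last first.
  by rewrite addrAC subrr add0r.
congr (_ - _); rewrite (bigD1_seq a) ?Phi_uniq //= eqxx mul1r big1 ?addr0 //.
by move=> b /negPf ->; rewrite mul0r scale0r.
Qed.

(** The difference [y u - y] is a combination of coroots; if [u] fixes the roots, every root
    vanishes on it, so it is zero. *)
Lemma W0_fix_roots u : inW0 Phi cor u ->
  {in Phi, forall a, a *m u^T = a} -> u = 1%:M.
Proof.
move=> uW hu; apply/row_matrixP => i; rewrite rowE [RHS]rowE mulmx1.
have [c e] := W0_cospan (delta_mx 0 i) uW.
apply/eqP; rewrite -subr_eq0 e; apply/eqP; apply: cospan_eq0 => a aP.
by rewrite -e ipairBr ipair_mulmx hu // subrr.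
Qed.

Lemma W0ext_pow A k : inW0ext Phi cor Om A -> inW0ext Phi cor Om (A ^+ k).
Proof.
move=> hA; elim: k => [|k IH]; first by rewrite expr0; apply: W0ext1.
by rewrite exprS; apply: W0ext_mul.
Qed.

Lemma W0ext_pow_fix A : inW0ext Phi cor Om A ->
  exists2 N, (0 < N)%N & {in Phi, forall a, a *m (A ^+ N)^T = a}.
Proof.
move=> hA; pose I := seq_sub Phi.
pose f (a : I) : I := SeqSub (W0ext_root hA (valP a)).
have fi : injective f.
  move=> a b /(congr1 val) /= e; apply: val_inj => /=.
  by apply: (can_inj (mulmxK _) e); rewrite unitmx_tr W0ext_unit.
pose p := perm fi; exists #[p]%g; first exact: order_gt0.
suff h k (a : I) : val a *m (A ^+ k)^T = val ((p ^+ k)%g a).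
  move=> a aP; rewrite (h _ (SeqSub aP)) expg_order perm1.
  by [].
elim: k => [|k IH]; first by rewrite expr0 expg0 perm1 trmx1 mulmx1.
rewrite exprS expgSr permM permE /= -IH -mulmxE trmx_mul mulmxA.
by [].
Qed.

(** Fixing all roots forces the identity only inside [W_0]: a diagram automorphism may fix them and
    still move the lattice. Hence the pigeonhole argument on the finite list [Om], which yields a
    power in [W_0]. *)
Lemma W0ext_order A : inW0ext Phi cor Om A ->
  exists2 N, (0 < N)%N & A ^+ N = 1%:M.
Proof.
move=> hA.
have [M M0 MW] : exists2 M, (0 < M)%N & inW0 Phi cor (A ^+ M).
  have [|i [j [om [ij [ui uiW ei] [uj ujW ej]]]]] := @pigeonhole _ Om
    (fun j om => exists2 u, inW0 Phi cor u & A ^+ j = om *m u).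
    move=> j; have [om [u [? ? ?]]] := W0ext_decomp (W0ext_pow j hA).
    by exists om => //; exists u.
  exists (j - i)%N; first by rewrite subn_gt0.
  have [B BW eB] := W0_inv uiW.
  have -> : A ^+ (j - i) = B *m uj; last by apply: W0_mul.
  have uAi : A ^+ i \in unitmx by apply/W0ext_unit/W0ext_pow.
  have uo : om \in unitmx.
    by move: uAi; rewrite ei unitmx_mul => /andP[].
  apply: (can_inj (mulKmx uAi)).
  have -> : A ^+ i *m A ^+ (j - i) = A ^+ j.
    by rewrite -[in RHS](subnKC (ltnW ij)) exprD.
  by rewrite ej ei mulmxA -(mulmxA om) (mulmx1C eB) mulmx1.
have [N N0 hN] := W0ext_pow_fix (W0_W0ext MW).
exists (M * N)%N; first by rewrite muln_gt0 M0.
rewrite exprM; apply: W0_fix_roots hN.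
elim: N {N0} => [|N IH]; first by rewrite expr0; exists [::].
by rewrite exprS; apply: W0_mul.
Qed.

Lemma W0ext_inv A : inW0ext Phi cor Om A -> inW0ext Phi cor Om (invmx A).
Proof.
move=> hA; have [[|N] // _ e] := W0ext_order hA.
suff -> : invmx A = A ^+ N by apply: W0ext_pow.
have uA := W0ext_unit hA.
by apply: (can_inj (mulKmx uA)); rewrite mulmxV // -e exprS.
Qed.

Lemma inWt1 : inWt Phi cor Om aid.
Proof. exact: W0ext1. Qed.

Lemma inWtM g h : inWt Phi cor Om g -> inWt Phi cor Om h -> inWt Phi cor Om (amul g h).
Proof. by move=> gW hW; apply: W0ext_mul. Qed.

Lemma inWtV g : inWt Phi cor Om g -> inWt Phi cor Om (ainv g).
Proof. exact: W0ext_inv. Qed.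

Lemma inWt_unit g : inWt Phi cor Om g -> g.1 \in unitmx.
Proof. exact: W0ext_unit. Qed.

Lemma inW_inWt g : inW Phi cor g -> inWt Phi cor Om g.
Proof. by case=> /W0_W0ext. Qed.

(** The two pairings of proportional roots multiply to 4. If one of them is 1, one root is twice the
    other, against reducedness; if both are 2, the roots agree. *)
Lemma root_pos_proportional a b (p q : int) : a \in Phi -> b \in Phi ->
  0 < p -> 0 < q -> p *: a = q *: b -> a = b.
Proof.
move=> aP bP p0 q0 e.
have e1 : 2 * p = q * ipair b (cor a).
  by rewrite -ipairZl -e ipairZl root_cor // mulrC.
have e2 : 2 * q = p * ipair a (cor b).
  by rewrite -ipairZl e ipairZl root_cor // mulrC.
have [_ [_ _ _ _ red]] := hRD.
move: (ipair b (cor a)) (ipair a (cor b)) e1 e2 => m m' e1 e2.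
have mm : m * m' = 4.
  apply: (mulfI (lt0r_neq0 p0)); apply: (mulfI (lt0r_neq0 q0)).
  rewrite [LHS](_ : _ = (q * m) * (p * m')); last by ring.
  by rewrite -e1 -e2; ring.
have m0 : 0 < m by rewrite -(pmulr_rgt0 _ q0) -e1 mulr_gt0.
have m'0 : 0 < m' by rewrite -(pmulr_rgt0 _ m0) mm.
have m4 : m <= 4 by rewrite -mm ler_peMr // ltW.
have mN3 : m <> 3 by move=> m3; move: mm; rewrite m3; lia.
have [m1|[m2|m4']] : m = 1 \/ m = 2 \/ m = 4 by lia.
- move: (red b bP); have -> : b *+ 2 = a; last by rewrite aP.
  have qe : q = 2 * p by rewrite e1 m1 mulr1.
  apply/rowP => j; move/rowP: e => /(_ j); rewrite !mxE qe => e.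
  by apply: (mulfI (lt0r_neq0 p0)); rewrite e; ring.
- have pq : p = q by apply: (@mulfI _ 2) => //; rewrite e1 m2 mulrC.
  apply/rowP => j; move/rowP: e => /(_ j); rewrite !mxE pq => e.
  exact: (mulfI (lt0r_neq0 q0)).
- move: (red a aP); have -> : a *+ 2 = b; last by rewrite bP.
  have pe : p = 2 * q.
    by apply: (@mulfI _ 2) => //; rewrite e1 m4'; ring.
  apply/rowP => j; move/rowP: e => /(_ j); rewrite !mxE pe => e.
  by apply: (mulfI (lt0r_neq0 q0)); rewrite -e; ring.
Qed.

End RootDatum.

(** * Alcoves, walls and lengths *)

Section Small.
Variable R : realFieldType.

(** Validity for all sufficiently small positive [d]. Finite conjunctions preserve it, so one
    perturbation can meet many conditions. *)
Definition small (P : R -> Prop) := exists2 d0, 0 < d0 & forall d, 0 < d -> d <= d0 -> P d.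

Lemma small_ex P : small P -> exists2 d, 0 < d & P d.
Proof. by case=> d d0 h; exists d => //; apply: h. Qed.

Lemma small_and P Q : small P -> small Q -> small (fun d => P d /\ Q d).
Proof.
case=> d1 d10 h1 [d2 d20 h2]; exists (Order.min d1 d2); first by rewrite lt_min d10.
by move=> d d0; rewrite le_min => /andP[??]; split; [apply: h1 | apply: h2].
Qed.

Lemma small_imp (P Q : R -> Prop) : (forall d, 0 < d -> P d -> Q d) -> small P -> small Q.
Proof. by move=> PQ [d0 d00 h]; exists d0 => // d ? ?; apply: PQ => //; apply: h. Qed.

Lemma small_all (T : eqType) (s : seq T) (P : T -> R -> Prop) :
  {in s, forall x, small (P x)} -> small (fun d => {in s, forall x, P x d}).
Proof.
elim: s => [|x s IH] h; first by exists 1.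
have h1 := h x (mem_head _ _).
have h2 : small (fun d => {in s, forall x, P x d}).
  by apply: IH => y ys; apply: h; rewrite inE ys orbT.
apply: small_imp (small_and h1 h2) => d _ [p1 p2] y.
by rewrite inE => /predU1P[->|/p2].
Qed.

Lemma small_lt (r s c : R) : r < s -> small (fun d => r + d * c < s).
Proof.
move=> rs; exists ((s - r) / (1 + `|c|) / 2).
  by rewrite !divr_gt0 ?subr_gt0 // ltr_pwDl.
have c1 : 0 < 1 + `|c| by rewrite ltr_pwDl.
move=> d d0; rewrite ler_pdivlMr // ler_pdivlMr // => h.
have : d * c <= d * `|c| by rewrite ler_pM2l // ler_norm.
lra.
Qed.

Lemma small_gt (r s c : R) : s < r -> small (fun d => s < r + d * c).
Proof.
move=> rs; have : - r < - s by rewrite ltrN2.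
move=> /(small_lt (- c)); apply: small_imp => d _; lra.
Qed.

Lemma small_neq0 (r c : R) : c != 0 -> small (fun d => r + d * c != 0).
Proof.
move=> c0; case: (ltgtP r 0) => [r0|r0|->].
- by apply: small_imp (small_lt c r0) => d _; apply: ltr0_neq0.
- by apply: small_imp (small_gt c r0) => d _; apply: lt0r_neq0.
by exists 1 => // d d0 _; rewrite add0r mulf_neq0 // gt_eqF.
Qed.

(** A solution for the tail, moved slightly along a coordinate on which the new form is nonzero,
    keeps the old conditions and gains the new one. *)
Lemma generic_vector n (s : seq 'cV[R]_n) : {in s, forall c, c != 0} ->
  exists u : 'rV[R]_n, {in s, forall c, (u *m c) 0 0 != 0}.
Proof.
elim: s => [|c s IH] h; first by exists 0.
have [|u hu] := IH; first by move=> d ds; apply: h; rewrite inE ds orbT.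
have : c != 0 by apply: h; apply: mem_head.
case/cV0Pn => i ci.
pose e : 'rV[R]_n := delta_mx 0 i.
have h1 : small (fun d => ((u + d *: e) *m c) 0 0 != 0).
  apply: small_imp (small_neq0 ((u *m c) 0 0) ci) => d _.
  by rewrite mulmxDl -scalemxAl -rowE !mxE.
have h2 : small (fun d => {in s, forall x, ((u + d *: e) *m x) 0 0 != 0}).
  apply: small_all => x xs; have := hu x xs.
  set r := _ 0 0 => r0.
  case: (ltgtP r 0) r0 => [r0|r0|//] _.
    apply: small_imp (small_lt ((e *m x) 0 0) r0) => d _.
    rewrite mulmxDl -scalemxAl => /ltr0_neq0; congr (_ != _).
    by rewrite [RHS]mxE; congr (_ + _); rewrite [RHS]mxE.
  apply: small_imp (small_gt ((e *m x) 0 0) r0) => d _.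
  rewrite mulmxDl -scalemxAl => /lt0r_neq0; congr (_ != _).
  by rewrite [RHS]mxE; congr (_ + _); rewrite [RHS]mxE.
have [d _ [p1 p2]] := small_ex (small_and h1 h2).
exists (u + d *: e) => x; rewrite inE => /predU1P[->|/p2] //.
Qed.

End Small.

Lemma seq_argmax (R : realDomainType) (T : eqType) (s : seq T) (f : T -> R) t :
  t \in s -> exists2 a, a \in s & {in s, forall b, f b <= f a}.
Proof.
elim: s t => // b s IH t _; case: s IH => [_|c s IH].
  by exists b => [|d]; rewrite mem_seq1 // => /eqP ->.
have [a aL am] := IH c (mem_head _ _).
have [h|h] := leP (f b) (f a).
  by exists a => [|d]; rewrite inE ?aL ?orbT // => /predU1P[->|/am].
exists b => [|d]; rewrite inE ?eqxx // => /predU1P[->//|/am h'].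
exact: le_trans h' (ltW h).
Qed.

Section Geometry.
Variables (R : archiRealFieldType) (n : nat).
Implicit Types (a b t : 'rV[int]_n) (A : 'M[int]_n) (x y p : 'rV[R]_n) (g h : aff n).

Definition rp a x : R := \sum_(i < n) (a 0 i)%:~R * x 0 i.

Definition ract g x : 'rV[R]_n :=
  x *m map_mx (fun z : int => z%:~R) g.1 + map_mx (fun z : int => z%:~R) g.2.

Definition fl a x : int := Num.floor (rp a x).

Lemma rpE a x : rp a x = (x *m (map_mx intr a)^T) 0 0.
Proof. by rewrite mxE; apply: eq_bigr => i _; rewrite !mxE mulrC. Qed.

Lemma rpD a x y : rp a (x + y) = rp a x + rp a y.
Proof. by rewrite !rpE mulmxDl mxE. Qed.

Lemma rpZ a (c : R) x : rp a (c *: x) = c * rp a x.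
Proof. by rewrite !rpE -scalemxAl mxE. Qed.

Lemma rpN a x : rp a (- x) = - rp a x.
Proof. by rewrite -scaleN1r rpZ mulN1r. Qed.

Lemma rpB a x y : rp a (x - y) = rp a x - rp a y.
Proof. by rewrite rpD rpN. Qed.

Lemma rpNl a x : rp (- a) x = - rp a x.
Proof. by rewrite -sumrN; apply: eq_bigr => i _; rewrite mxE rmorphN mulNr. Qed.

Lemma rp_mulmx a x A : rp a (x *m map_mx intr A) = rp (a *m A^T) x.
Proof. by rewrite !rpE map_mxM trmx_mul -map_trmx trmxK mulmxA. Qed.

Lemma rp_int a t : rp a (map_mx intr t) = (ipair a t)%:~R.
Proof.
by rewrite /rp /ipair rmorph_sum; apply: eq_bigr => i _; rewrite mxE rmorphM.
Qed.

Lemma rp_ract a g x : rp a (ract g x) = rp (a *m g.1^T) x + (ipair a g.2)%:~R.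
Proof. by rewrite rpD rp_int rp_mulmx. Qed.

Lemma fl_ract a g x : fl a (ract g x) = fl (a *m g.1^T) x + ipair a g.2.
Proof. by rewrite /fl rp_ract floorDrz ?intr_int // intrKfloor. Qed.

Lemma ractM g h x : ract (amul g h) x = ract g (ract h x).
Proof.
by rewrite /ract /= !map_mxD !map_mxM mulmxDl !mulmxA addrA.
Qed.

Lemma ract1 x : ract aid x = x.
Proof. by rewrite /ract /= map_mx1 mulmx1 map_mx0 addr0. Qed.

Lemma ractVK g x : g.1 \in unitmx -> ract g (ract (ainv g) x) = x.
Proof. by move=> u; rewrite -ractM amulgV // ract1. Qed.

Lemma ractKV g x : g.1 \in unitmx -> ract (ainv g) (ract g x) = x.
Proof. by move=> u; rewrite -ractM amulVg // ract1. Qed.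

Lemma ract_sub g x y : ract g x - ract g y = (x - y) *m map_mx intr g.1.
Proof. by rewrite mulmxBl /ract opprD addrACA subrr addr0. Qed.

End Geometry.

Section Alcoves.
Variables (R : archiRealFieldType) (n : nat).
Variables (Phi : seq 'rV[int]_n) (cor : 'rV[int]_n -> 'rV[int]_n)
          (xi : 'rV[int]_n) (Om : seq 'M[int]_n) (x0 : 'rV[rat]_n).
Hypothesis hRD : root_datum Phi cor.
Hypothesis hOm : diagram_group Phi cor xi Om.
Hypothesis hxi : regular Phi xi.
Hypothesis hx0 : in_fund_alcove Phi xi x0.
Implicit Types (a b t : 'rV[int]_n) (x y p : 'rV[R]_n) (g h : aff n).

Notation Wt := (inWt Phi cor Om).
Notation len := (len Phi xi x0).

#[local] Hint Resolve inWt1 : core.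

Definition basept : 'rV[R]_n := map_mx ratr x0.
Definition pt g : 'rV[R]_n := ract g basept.
(* [flg g] determines the alcove of [g]; it is locked, like [lw] below, because
   unification would otherwise unfold matrix products when a match fails. *)
Definition flg : aff n -> 'rV[int]_n -> int := locked (fun g a => fl a (pt g)).

Lemma flgE g a : flg g a = fl a (pt g).
Proof. by rewrite /flg -lock. Qed.

(* [p] lies in the closed alcove of [g]: the upper bounds [rp a p <= flg g a + 1]
   are the lower bounds for the opposite roots. *)
Definition cl p g := {in Phi, forall a, (flg g a)%:~R <= rp a p}.
(** Both signs of each root occur, so every separating hyperplane is counted twice. This symmetric
    form is invariant under the group without tracking positivity. *)
Definition dist g h : nat := \sum_(a <- Phi) `|flg g a - flg h a|%N.

Lemma flgM g h a : flg (amul g h) a = flg h (a *m g.1^T) + ipair a g.2.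
Proof. by rewrite !flgE /pt ractM fl_ract. Qed.

Lemma ratr_qpair a (q : 'rV[rat]_n) : ratr (qpair a q) = rp a (map_mx ratr q) :> R.
Proof.
rewrite /qpair /rp rmorph_sum; apply: eq_bigr => i _.
by rewrite rmorphM /= ratr_int mxE.
Qed.

Lemma posrN a : a \in Phi -> posr xi (- a) = ~~ posr xi a.
Proof.
move=> /hxi; rewrite /posr ipairNl oppr_gt0.
by case: ltgtP.
Qed.

Lemma rp_base a : a \in Phi -> posr xi a -> 0 < rp a basept < 1.
Proof.
move=> aP pa; have /andP[h1 h2] := hx0 aP pa.
by rewrite /basept -ratr_qpair ltr0q h1 -[1](rmorph1 (@ratr R)) ltr_rat.
Qed.

Lemma flg1_pos a : a \in Phi -> posr xi a -> flg aid a = 0.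
Proof.
move=> aP /(rp_base aP)/andP[h1 h2]; rewrite flgE; apply: floor_def.
by rewrite /pt ract1 add0r ltW.
Qed.

Lemma flg1_neg a : a \in Phi -> ~~ posr xi a -> flg aid a = -1.
Proof.
move=> aP; rewrite -posrN // => /(rp_base (root_opp hRD aP)); rewrite rpNl => /andP[h1 h2].
rewrite flgE; apply: floor_def; rewrite /pt ract1 addNr; lra.
Qed.

Lemma flg_lt g a : Wt g -> a \in Phi -> (flg g a)%:~R < rp a (pt g).
Proof.
move=> gW aP; rewrite !flgE /pt fl_ract rp_ract rmorphD /= ltrD2r.
have := W0ext_root hRD hOm gW aP; set b := a *m _ => bP.
have -> : fl b basept = flg aid b by rewrite !flgE /pt ract1.
have [pb|nb] := boolP (posr xi b).
  by rewrite flg1_pos //; case/andP: (rp_base bP pb).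
rewrite flg1_neg //; move: nb; rewrite -posrN // => /(rp_base (root_opp hRD bP)).
by rewrite rpNl => /andP[_ h]; rewrite rmorphN rmorph1; lra.
Qed.

Lemma ltD1_flg g a : rp a (pt g) < (flg g a)%:~R + 1.
Proof. by rewrite flgE; have := floorD1_gt (rp a (pt g)); rewrite intrD. Qed.

Lemma flgN g a : Wt g -> a \in Phi -> flg g (- a) = - flg g a - 1.
Proof.
move=> gW aP; have h1 := flg_lt gW aP; have h2 := ltD1_flg g a.
rewrite flgE; apply: floor_def; rewrite rpNl subrK rmorphB rmorphN /=; apply/andP; split; lra.
Qed.

Lemma cl_le p g a : Wt g -> cl p g -> a \in Phi -> rp a p <= (flg g a)%:~R + 1.
Proof.
move=> gW hp aP; have := hp _ (root_opp hRD aP).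
by rewrite flgN // rpNl rmorphB rmorphN /=; lra.
Qed.

Lemma cl_pt g : cl (pt g) g.
Proof. by move=> a _; rewrite flgE; apply: floor_le. Qed.

Lemma cl_ract w p g : Wt w -> cl p g -> cl (ract w p) (amul w g).
Proof.
move=> wW hp a aP; rewrite flgM rp_ract rmorphD lerD2r.
by apply: hp; apply: (W0ext_root hRD hOm wW).
Qed.

Lemma distC g h : dist g h = dist h g.
Proof. by apply: eq_bigr => a _; rewrite distnC. Qed.

Lemma dist_mul k g h : Wt k -> dist (amul k g) (amul k h) = dist g h.
Proof.
move=> kW; pose f a := a *m k.1^T.
have fi : injective f.
  by apply: can_inj (mulmxK _); rewrite unitmx_tr (W0ext_unit hRD hOm kW).
have p : perm_eq (map f Phi) Phi.
  have sub : {subset map f Phi <= Phi}.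
    by move=> _ /mapP[a aP ->]; apply: (W0ext_root hRD hOm kW).
  have us : uniq (map f Phi) by rewrite map_inj_uniq ?(Phi_uniq hRD).
  apply: uniq_perm => //; first exact: (Phi_uniq hRD).
  by case: (uniq_min_size us sub (eq_leq (esym (size_map _ _)))) => _ e y; rewrite e.
rewrite [RHS]/dist -(perm_big _ p) big_map; apply: eq_bigr => a _.
by rewrite !flgM /f; congr (absz _); ring.
Qed.

Lemma perm_opp : perm_eq (map (@GRing.opp _) Phi) Phi.
Proof.
have us : uniq (map (@GRing.opp _) Phi).
  by rewrite map_inj_uniq ?(Phi_uniq hRD) //; apply: oppr_inj.
have sub : {subset map (@GRing.opp _) Phi <= Phi}.
  by move=> _ /mapP[a aP ->]; exact: (root_opp hRD).
apply: uniq_perm => //; first exact: (Phi_uniq hRD).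
by case: (uniq_min_size us sub (eq_leq (esym (size_map _ _)))) => _ e y; rewrite e.
Qed.

Lemma dist1_len g : Wt g -> dist aid g = (len g).*2.
Proof.
move=> gW; rewrite /Defs.len /dist.
have -> : \sum_(a <- Phi | posr xi a) `|Num.floor (qpair a (act g x0))|%N
        = \sum_(a <- Phi | posr xi a) `|flg aid a - flg g a|%N.
  rewrite big_seq_cond [RHS]big_seq_cond; apply: eq_bigr => a /andP[aP pa].
  rewrite flg1_pos // sub0r abszN !flgE /fl -(floor_rat R) ratr_qpair.
  congr (absz (Num.floor (rp a _))); rewrite /act /pt /ract /basept map_mxD map_mxM.
  by congr (_ *m _ + _); apply/matrixP => i j; rewrite !mxE /= ratr_int.
rewrite (bigID (posr xi)) /= -addnn; congr addn.
rewrite -(perm_big _ perm_opp) big_map big_seq_cond [RHS]big_seq_cond.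
apply: eq_big => [a|a /andP[aP pa]].
  by case aP: (a \in Phi) => //=; rewrite posrN // negbK.
by rewrite !flgN //; lia.
Qed.

Definition lw : aff n -> nat := locked (fun g => len g).

Lemma lwE g : lw g = len g.
Proof. by rewrite /lw -lock. Qed.

(** The number of hyperplanes that separate the alcoves of [g] and [h]. *)
Definition dl g h := lw (amul (ainv g) h).

Lemma dlE g h : dl g h = lw (amul (ainv g) h).
Proof. by []. Qed.

Lemma dl1g g : dl aid g = lw g.
Proof. by rewrite /dl /ainv /aid /= invmx1 mul0mx oppr0 -/aid amul1g. Qed.

Lemma dist_dl g h : Wt g -> Wt h -> dist g h = (dl g h).*2.
Proof.
move=> gW hW; have gV := inWtV hRD hOm gW.
rewrite /dl lwE -dist1_len; last exact: inWtM.
by rewrite -(dist_mul _ _ gV) amulVg ?(inWt_unit hRD hOm gW).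
Qed.

Lemma dlC g h : Wt g -> Wt h -> dl g h = dl h g.
Proof.
move=> gW hW; have := dist_dl gW hW; have := dist_dl hW gW; rewrite distC; lia.
Qed.

Lemma dl_mul k g h : Wt k -> Wt g -> Wt h -> dl (amul k g) (amul k h) = dl g h.
Proof.
move=> kW gW hW; have := dist_dl gW hW.
have := dist_dl (inWtM kW gW) (inWtM kW hW); rewrite (dist_mul _ _ kW); lia.
Qed.

(** When [g] lies between [f] and [h] for every root, no hyperplane is crossed twice on the way
    through [g]. *)
Lemma dl_add f g h : Wt f -> Wt g -> Wt h ->
  {in Phi, forall a, (flg f a <= flg g a <= flg h a) || (flg h a <= flg g a <= flg f a)} ->
  dl f h = (dl f g + dl g h)%N.
Proof.
move=> fW gW hW hb.
have := dist_dl fW hW; have := dist_dl fW gW; have := dist_dl gW hW.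
suff : dist f h = (dist f g + dist g h)%N by lia.
rewrite /dist -big_split /= big_seq [RHS]big_seq; apply: eq_bigr => a aP.
by have := hb a aP; lia.
Qed.

Lemma dl0_flg g h : Wt g -> Wt h -> dl g h = 0%N -> {in Phi, flg g =1 flg h}.
Proof.
move=> gW hW e; have := dist_dl gW hW; rewrite e => d0 a aP.
move: d0; rewrite /dist (big_rem a aP) /=; lia.
Qed.

Lemma flg_dl0 g h : Wt g -> Wt h -> {in Phi, flg g =1 flg h} -> dl g h = 0%N.
Proof.
move=> gW hW e; have := dist_dl gW hW; rewrite /dist big_seq big1; first by lia.
by move=> a aP; rewrite e // subrr.
Qed.

Lemma flg_diff g h : Wt g -> Wt h ->
  {in Phi, flg g =1 flg h} \/ exists2 a, a \in Phi & flg h a < flg g a.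
Proof.
move=> gW hW; have [/allP e|/allPn[a aP na]] := boolP (all (fun a => flg g a == flg h a) Phi).
  by left=> a /e/eqP.
right; have [lt|gt|e] := ltgtP (flg h a) (flg g a); first by exists a.
  by exists (- a); [apply: (root_opp hRD) | rewrite !flgN //; lia].
by rewrite e eqxx in na.
Qed.

(** The two alcoves share the wall on which [a] has value [flg g a], and [g] lies above it. The
    floor of [- a] is left out because [flgN] determines it. *)
Definition adj g a g' := flg g' a = flg g a - 1 /\
  {in Phi, forall b, b != a -> b != - a -> flg g' b = flg g b}.

Lemma adj_sym g a g' : Wt g -> Wt g' -> a \in Phi -> adj g a g' -> adj g' (- a) g.
Proof.
move=> gW g'W aP [h1 h2]; split; first by rewrite !flgN // h1; ring.
by move=> b bP; rewrite opprK => ??; rewrite h2.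
Qed.

Lemma dist_adj g a g' h : Wt g -> Wt g' -> Wt h -> a \in Phi -> adj g a g' ->
  if flg h a < flg g a then (dist g' h).+2 = dist g h else dist g' h = (dist g h).+2.
Proof.
move=> gW g'W hW aP [h1 h2]; rewrite /dist.
have ap : - a \in rem a Phi.
  by rewrite (rem_filter _ (Phi_uniq hRD)) mem_filter /= eq_sym (root_neq_opp hRD aP) (root_opp hRD aP).
rewrite !(big_rem a aP) !(big_rem (- a) ap) /=.
have -> : \sum_(b <- rem (- a) (rem a Phi)) `|flg g' b - flg h b|%N
        = \sum_(b <- rem (- a) (rem a Phi)) `|flg g b - flg h b|%N.
  rewrite big_seq [RHS]big_seq; apply: eq_bigr => b.
  rewrite (rem_filter _ (rem_uniq _ (Phi_uniq hRD))) (rem_filter _ (Phi_uniq hRD)).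
  by rewrite !mem_filter /= => /and3P[b1 b2 bP]; rewrite h2.
rewrite !flgN // h1; set S := \sum_(b <- _) _; case: ifP; lia.
Qed.

Lemma dl_adj g a g' h : Wt g -> Wt g' -> Wt h -> a \in Phi -> adj g a g' ->
  if flg h a < flg g a then (dl g' h).+1 = dl g h else dl g' h = (dl g h).+1.
Proof.
move=> gW g'W hW aP /(dist_adj gW g'W hW aP); rewrite !dist_dl //.
by case: ifP => _ h1; apply: double_inj; rewrite doubleS.
Qed.

Definition arefl a (k : int) : aff n := (refl cor a, k *: cor a).

Lemma areflK a k : a \in Phi -> amul (arefl a k) (arefl a k) = aid.
Proof.
move=> aP; rewrite /amul /arefl /aid /= (reflK hRD aP); congr (_, _).
rewrite mulmx_refl ipairZr (root_cor hRD aP).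
by apply/rowP => j; rewrite !mxE; ring.
Qed.

Lemma arefl_inW a k : a \in Phi -> inW Phi cor (arefl a k).
Proof.
move=> aP; split; first exact: (W0_refl cor aP).
by exists [:: (k, a)]; rewrite /= aP big_seq1.
Qed.

Lemma rp_arefl a k b x :
  rp b (ract (arefl a k) x) = rp b x - (rp a x - k%:~R) * (ipair b (cor a))%:~R.
Proof.
rewrite rp_ract /= mulmx_reflT ipairZr.
have -> : rp (b - ipair b (cor a) *: a) x = rp b x - (ipair b (cor a))%:~R * rp a x.
  rewrite /rp mulr_sumr -sumrB; apply: eq_bigr => i _.
  by rewrite !mxE rmorphB rmorphM; ring.
by rewrite rmorphM /=; ring.
Qed.

(* The first hyperplane met by the segment from a generic point of the alcove to [y]
   is a wall; genericity ensures that no other hyperplane is met at the same time. *)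
Lemma wall1 y a0 : a0 \in Phi -> rp a0 y < (flg aid a0)%:~R ->
  exists a s, [/\ a \in Phi, rp a y < (flg aid a)%:~R, inS Phi cor xi x0 s,
                  amul s s = aid & adj aid a s].
Proof.
move=> a0P ya0; pose k a : R := (flg aid a)%:~R.
(* Two hyperplanes are met simultaneously from [basept + d *: u] only if an affine function of [d]
   vanishes. Its slope is the form [c (a, b)] at [u]; this form is nonzero, since otherwise [a] and
   [b] would be positively proportional. *)
have [u hu] : exists u : 'rV[R]_n, {in Phi &, forall a b, a != b -> rp a y < k a -> rp b y < k b ->
    (k b - rp b y) * rp a u != (k a - rp a y) * rp b u}.
  pose c (q : 'rV[int]_n * 'rV[int]_n) : 'cV[R]_n :=
    (k q.2 - rp q.2 y) *: (map_mx intr q.1)^T - (k q.1 - rp q.1 y) *: (map_mx intr q.2)^T.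
  have [|u hu] := @generic_vector _ _ [seq c q | q <- allpairs pair Phi Phi &
     [&& q.1 != q.2, rp q.1 y < k q.1 & rp q.2 y < k q.2]].
    move=> z /mapP[[a b]]; rewrite mem_filter /= => /andP[/and3P[ab ya yb]].
    case/allpairsP=> [[a' b'] /= [aP bP [ea eb]]] ez; subst a' b'; rewrite {z}ez.
    apply: contra ab; rewrite subr_eq0 => /eqP e; apply/eqP.
    have e' z : (k b - rp b y) * rp a z = (k a - rp a y) * rp b z.
      have := congr1 (fun m => (z *m m) 0 0) e; rewrite /= -!scalemxAr !rpE.
      by rewrite [X in X = _ -> _]mxE [X in _ = X -> _]mxE.
    have := e' (map_mx intr (cor a)); rewrite !rp_int (root_cor hRD aP).
    set m := ipair b (cor a) => em.
    have m0 : 0 < m.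
      have : 0 < (k a - rp a y) * m%:~R by rewrite -em mulr_gt0 ?subr_gt0.
      by rewrite pmulr_rgt0 ?subr_gt0 // ltr0z.
    apply: (root_pos_proportional hRD aP bP m0 (isT : 0 < 2 :> int)).
    apply/rowP => j; rewrite !mxE; apply/eqP; rewrite -(eqr_int R) !rmorphM /=.
    have := e' (delta_mx 0 j).
    have rd d : rp d (delta_mx 0 j) = (d 0 j)%:~R.
      rewrite /rp (bigD1 j) //= big1 ?addr0 ?mxE ?eqxx ?mulr1 //.
      by move=> i /negPf ij; rewrite mxE eqxx ij mulr0.
    rewrite !rd => ej; apply/eqP; apply: (@mulfI _ (k a - rp a y)); first by rewrite gt_eqF ?subr_gt0.
    rewrite mulrA -em mulrAC ej; ring.
  exists u => a b aP bP ab ya yb; have := hu (c (a, b)).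
  rewrite map_f ?mem_filter /= ?ab ?ya ?yb ?allpairs_f //= => /(_ isT).
  suff -> : (u *m c (a, b)) 0 0 = (k b - rp b y) * rp a u - (k a - rp a y) * rp b u.
    by rewrite subr_eq0.
  rewrite /c mulmxBr -!scalemxAr !(rpE _ u) /=.
  by set M := u *m _; set N := u *m _; rewrite !mxE.
pose x d : 'rV[R]_n := basept + d *: u.
have s1 : small (fun d : R => {in Phi, forall a, k a < rp a (x d)}).
  apply: small_all => a aP; have := flg_lt (inWt1 _ _ _) aP; rewrite /pt ract1.
  by move=> /(small_gt (rp a u)); apply: small_imp => d _; rewrite rpD rpZ.
have s2 : small (fun d : R => {in Phi, forall a, {in Phi, forall b, a != b -> rp a y < k a ->
    rp b y < k b -> (k b - rp b y) * (rp a (x d) - k a) != (k a - rp a y) * (rp b (x d) - k b)}}).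
  apply: small_all => a aP; apply: small_all => b bP.
  have [->|ab] := eqVneq a b; first by exists 1.
  have [ya|ya] := boolP (rp a y < k a); last by exists 1.
  have [yb|yb] := boolP (rp b y < k b); last by exists 1.
  have := hu a b aP bP ab ya yb; rewrite -subr_eq0.
  move=> /(small_neq0 ((k b - rp b y) * (rp a basept - k a) - (k a - rp a y) * (rp b basept - k b))).
  apply: small_imp => d _ h _ _ _; apply: contra h => /eqP e.
  by rewrite !rpD !rpZ in e; apply/eqP; lra.
have [d d0 [xk xne]] := small_ex (small_and s1 s2); move: (x d) xk xne => {s1 s2 d d0 u hu}x xk xne.
(* The segment from [x] to [y] meets the hyperplane of [a] at time [1 / (1 + f a)], so the largest
   [f] belongs to the first one met; [c] below is the point where this happens. *)
pose f a := (k a - rp a y) / (rp a x - k a).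
pose L := [seq a <- Phi | rp a y < k a].
have a0L : a0 \in L by rewrite mem_filter ya0.
have [a aL amax] := seq_argmax f a0L.
move: aL; rewrite mem_filter => /andP[ya aP].
pose P := rp a x - k a; pose Q := k a - rp a y.
have P0 : 0 < P by rewrite subr_gt0 xk.
have Q0 : 0 < Q by rewrite subr_gt0.
have PQ0 : 0 < P + Q by rewrite addr_gt0.
pose c : 'rV[R]_n := (P + Q)^-1 *: (Q *: x + P *: y).
have rpc b : rp b c - k b = (Q * (rp b x - k b) + P * (rp b y - k b)) / (P + Q).
  by rewrite rpZ rpD !rpZ; field; lra.
have ca : rp a c = k a.
  by apply/eqP; rewrite -subr_eq0 rpc mulf_eq0; apply/orP; left; apply/eqP; rewrite /P /Q; ring.
have cb b : b \in Phi -> b != a -> k b < rp b c.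
  move=> bP ba; rewrite -subr_gt0 rpc divr_gt0 //.
  have xb := xk b bP.
  have [yb|yb] := ltP (rp b y) (k b); last first.
    apply: ltr_wpDr; last by rewrite mulr_gt0 ?subr_gt0.
    by apply: mulr_ge0; [exact: ltW | rewrite subr_ge0].
  have bL : b \in L by rewrite mem_filter yb.
  have := amax b bL; rewrite /f -/P -/Q ler_pdivrMr ?subr_gt0 // mulrAC ler_pdivlMr //.
  have := xne b bP a aP ba yb ya; rewrite -/P -/Q; nra.
have ccl b : b \in Phi -> k b <= rp b c.
  by move=> bP; have [->|/(cb _ bP)/ltW//] := eqVneq b a; rewrite ca.
have ccl1 b : b \in Phi -> rp b c <= k b + 1.
  move=> bP; have := ccl _ (root_opp hRD bP); rewrite /k flgN // rpNl rmorphB rmorphN /=; lra.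
(* The reflection fixes [c], which is therefore in both closed alcoves. For roots other than [a] and
   [- a], [c] is strictly between consecutive levels, so the floors agree. *)
have ad : adj aid a (arefl a (flg aid a)).
  split.
    rewrite flgE; apply: floor_def; rewrite /pt rp_arefl (root_cor hRD aP).
    have := flg_lt (inWt1 _ _ _) aP; have := ltD1_flg aid a; rewrite /pt ract1.
    by rewrite !rmorphD rmorphN /= => h1 h2; apply/andP; split; lra.
  move=> b bP ba bNa.
  have lt1 := cb b bP ba.
  have lt2 : rp b c < k b + 1.
    have := cb _ (root_opp hRD bP); rewrite eqr_oppLR => /(_ bNa).
    by rewrite /k flgN // rpNl rmorphB rmorphN /=; lra.
  have := rp_arefl a (flg aid a) b c; rewrite ca subrr mul0r subr0 rp_ract.
  set m := ipair b _; set b' := b *m _ => e.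
  have b'P : b' \in Phi by apply: (root_refl hRD).
  have -> : flg (arefl a (flg aid a)) b = flg aid b' + m by rewrite -[arefl _ _]amulg1 flgM.
  have h1 := ccl1 b' b'P; have h2 := ccl b' b'P.
  rewrite /k in lt1 lt2 h1 h2.
  have i1 : (flg aid b)%:~R < (flg aid b' + 1 + m)%:~R :> R by rewrite !rmorphD /=; lra.
  have i2 : (flg aid b' + m)%:~R < (flg aid b + 1)%:~R :> R by rewrite !rmorphD /=; lra.
  rewrite !ltr_int in i1 i2; clear -i1 i2.
  by move: (flg aid b) (flg aid b') m i1 i2 => z1 z2 z3; lia.
exists a, (arefl a (flg aid a)); split=> //; last exact: areflK.
split; first exact: arefl_inW.
have sW : Wt (arefl a (flg aid a)) by apply: inW_inWt; apply: arefl_inW.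
apply: double_inj; rewrite -dist1_len // distC.
have := dist_adj (inWt1 _ _ _) sW (inWt1 _ _ _) aP ad; rewrite ltxx => ->.
by rewrite dist1_len // -dist1_len // /dist big1 // => b _; rewrite subrr.
Qed.

(** The fundamental alcove case, carried over by [g]. Reflection in the wall becomes right
    multiplication by [s]. *)
Lemma wall g y a0 : Wt g -> a0 \in Phi -> rp a0 y < (flg g a0)%:~R ->
  exists a s, [/\ a \in Phi, rp a y < (flg g a)%:~R, inS Phi cor xi x0 s,
                  amul s s = aid & adj g a (amul g s)].
Proof.
move=> gW a0P ya0; have ug := inWt_unit hRD hOm gW.
pose b a := a *m g.1^T.
have bP a : a \in Phi -> b a \in Phi by apply: (W0ext_root hRD hOm gW).
have flgb a : flg g a = flg aid (b a) + ipair a g.2 by rewrite -{1}[g]amulg1 flgM.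
have rpb a : rp a y = rp (b a) (ract (ainv g) y) + (ipair a g.2)%:~R.
  by rewrite -{1}[y](ractVK _ ug) rp_ract.
have key a : (rp a y < (flg g a)%:~R) = (rp (b a) (ract (ainv g) y) < (flg aid (b a))%:~R).
  by rewrite rpb flgb rmorphD ltrD2r.
move: ya0; rewrite key => /(wall1 (bP _ a0P))[a' [s [aP' ya' sS ss [ad1 ad2]]]].
pose a := a' *m (invmx g.1)^T.
have ba : b a = a'.
  by rewrite /b /a -mulmxA -trmx_mul mulmxV // trmx1 mulmx1.
have aP : a \in Phi.
  exact: (W0ext_root hRD hOm (W0ext_inv hRD hOm gW)).
exists a, s; split=> //; first by rewrite key ba.
split; first by rewrite flgM flgb -/(b a) ba ad1; ring.
have bi : injective b.
  by apply: can_inj (mulmxK _); rewrite unitmx_tr.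
move=> c cP ca cNa; rewrite flgM flgb -/(b c) ad2 ?bP // -ba.
  by rewrite inj_eq.
by rewrite -[- b a]/(- (a *m g.1^T)) -mulNmx -/(b (- a)) inj_eq.
Qed.

Lemma adj_cl p g a g' : Wt g -> Wt g' -> a \in Phi -> adj g a g' -> cl p g ->
  rp a p = (flg g a)%:~R -> cl p g'.
Proof.
move=> gW g'W aP [ad1 ad2] hp ea b bP.
have [->|ba] := eqVneq b a; first by rewrite ad1 ea ler_int; lia.
have [->|bNa] := eqVneq b (- a); last by rewrite ad2 // hp.
by rewrite flgN // ad1 rpNl ea -rmorphN ler_int; lia.
Qed.

(** A sufficiently short move from [p] along [d] violates only bounds that are attained at [p], so a
    wall separating the alcove from its end point contains [p]. *)
Lemma wall_at p (d : 'rV[R]_n) g a0 : Wt g -> cl p g -> a0 \in Phi -> rp a0 p = (flg g a0)%:~R ->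
    rp a0 d < 0 ->
  exists a s, [/\ a \in Phi, rp a p = (flg g a)%:~R, rp a d < 0, inS Phi cor xi x0 s &
              [/\ amul s s = aid, adj g a (amul g s) & cl p (amul g s)]].
Proof.
move=> gW hp a0P e0 d0.
have [e e0' he] : exists2 e : R, 0 < e & {in Phi, forall a, (flg g a)%:~R < rp a p ->
    (flg g a)%:~R < rp a (p + e *: d)}.
  apply: small_ex; apply: small_all => a aP.
  have [h|h] := boolP ((flg g a)%:~R < rp a p); last by exists 1.
  by apply: small_imp (small_gt (rp a d) h) => e _; rewrite rpD rpZ.
have h0 : rp a0 (p + e *: d) < (flg g a0)%:~R.
  by rewrite rpD rpZ e0 gtrDl pmulr_rlt0.
have [a [s [aP ya sS ss ad]]] := wall gW a0P h0.
have ea : rp a p = (flg g a)%:~R.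
  have := hp a aP; rewrite le_eqVlt => /predU1P[//|/(he a aP)].
  by rewrite ltNge ltW.
exists a, s; split=> //.
  by move: ya; rewrite rpD rpZ ea gtrDl pmulr_rlt0.
have sW : Wt s by case: sS => /inW_inWt.
by split=> //; apply: (adj_cl gW (inWtM gW sW) aP ad).
Qed.

End Alcoves.

(** * The cocenter of the Hecke algebra *)

Section LaurentCoefficients.

Lemma v_neq0 : v != 0.
Proof. by rewrite tofrac_eq0 polyX_eq0. Qed.

Lemma isA_tofrac p : isA (FracField.tofrac p).
Proof. by exists p, 0; rewrite expr0 divr1. Qed.

Lemma isA1 : isA 1.
Proof. by rewrite -tofrac1; apply: isA_tofrac. Qed.

Lemma isA_v : isA v. Proof. exact: isA_tofrac. Qed.

Lemma isA_vV : isA v^-1.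
Proof. by exists 1, 1; rewrite tofrac1 expr1 div1r. Qed.

Lemma isAM a b : isA a -> isA b -> isA (a * b).
Proof.
case=> p [k ->] [q [l ->]]; exists (p * q), (k + l)%N.
by rewrite tofracM exprD mulf_div.
Qed.

Lemma isAD a b : isA a -> isA b -> isA (a + b).
Proof.
case=> p [k ->] [q [l ->]]; exists (p * 'X^l + q * 'X^k), (k + l)%N.
rewrite tofracD !tofracM !tofracXn -/v exprD.
by rewrite addf_div ?expf_neq0 ?v_neq0.
Qed.

Lemma isAN a : isA a -> isA (- a).
Proof. by case=> p [k ->]; exists (- p), k; rewrite tofracN mulNr. Qed.

Definition vv : K := v - v^-1.

Lemma isA_vv : isA vv.
Proof. by apply: isAD isA_v _; apply: isAN isA_vV. Qed.

End LaurentCoefficients.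

Section HeckeAlgebra.
Variables (R : archiRealFieldType) (n : nat).
Variables (Phi : seq 'rV[int]_n) (cor : 'rV[int]_n -> 'rV[int]_n)
          (xi : 'rV[int]_n) (Om : seq 'M[int]_n) (x0 : 'rV[rat]_n).
Hypothesis hRD : root_datum Phi cor.
Hypothesis hOm : diagram_group Phi cor xi Om.
Hypothesis hxi : regular Phi xi.
Hypothesis hx0 : in_fund_alcove Phi xi x0.
Variables (H : algType K) (T : aff n -> H).
Hypothesis hbasis : is_basis Phi cor Om T.
Hypothesis hrel : hecke_rel Phi cor xi Om x0 T.
Implicit Types (a b : 'rV[int]_n) (g h s w x u : aff n) (y z : H).

Notation Wt := (inWt Phi cor Om).
Notation len := (lw Phi xi x0).
Notation dl := (dl Phi xi x0).
Notation Ht := (inHt Phi cor Om T).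
Notation Cm := (inComm Phi cor Om T).
Notation adj := (adj R Phi x0).
Notation flg := (flg R x0).
Let WtM := @inWtM n Phi cor Om.
Let WtV g := @inWtV n Phi cor xi Om hRD hOm g.
Let unitW g := @inWt_unit n Phi cor xi Om hRD hOm g.
Let Wt1 : Wt aid := inWt1 Phi cor Om.

Lemma Ht0 : Ht 0.
Proof. by exists [::]; rewrite /lincomb big_nil. Qed.

Lemma HtD y z : Ht y -> Ht z -> Ht (y + z).
Proof.
case=> s [hs ->] [t [ht ->]]; exists (s ++ t); split; last by rewrite /lincomb big_cat.
by move=> p; rewrite mem_cat => /orP[/hs|/ht].
Qed.

Lemma HtZ c y : isA c -> Ht y -> Ht (c *: y).
Proof.
move=> cA [s [hs ->]]; exists [seq (c * p.1, p.2) | p <- s]; split.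
  by move=> _ /mapP[p /hs[pA pW] ->]; split=> //; apply: isAM.
by rewrite /lincomb big_map scaler_sumr; apply: eq_bigr => p _; rewrite scalerA.
Qed.

Lemma HtN y : Ht y -> Ht (- y).
Proof. by rewrite -scaleN1r; apply: HtZ; apply: isAN isA1. Qed.

Lemma HtT g : Wt g -> Ht (T g).
Proof.
move=> gW; exists [:: (1, g)]; rewrite /lincomb big_seq1 scale1r; split=> // p.
by rewrite mem_seq1 => /eqP ->; split=> //; apply: isA1.
Qed.

Lemma Ht_mulr y z : (forall g, Wt g -> Ht (T g * z)) -> Ht y -> Ht (y * z).
Proof.
move=> hz [s [hs ->]]; rewrite /lincomb mulr_suml.
elim: s hs => [|p s IH] hs; first by rewrite big_nil; apply: Ht0.
rewrite big_cons; apply: HtD; last by apply: IH => q qs; apply: hs; rewrite inE qs orbT.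
have [pA pW] := hs p (mem_head _ _).
by rewrite -scalerAl; apply: HtZ => //; apply: hz.
Qed.

Lemma Cm0 : Cm 0.
Proof. by exists [::]; rewrite big_nil. Qed.

Lemma CmD y z : Cm y -> Cm z -> Cm (y + z).
Proof.
case=> s [hs ->] [t [ht ->]]; exists (s ++ t); split; last by rewrite big_cat.
by move=> p; rewrite mem_cat => /orP[/hs|/ht].
Qed.

Lemma CmZ c y : isA c -> Cm y -> Cm (c *: y).
Proof.
move=> cA [s [hs ->]]; exists [seq (c * p.1.1, p.1.2, p.2) | p <- s]; split.
  by move=> _ /mapP[p /hs[pA p1 p2] ->]; split=> //; apply: isAM.
by rewrite big_map scaler_sumr; apply: eq_bigr => p _; rewrite scalerA.
Qed.

Lemma CmN y : Cm y -> Cm (- y).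
Proof. by rewrite -scaleN1r; apply: CmZ; apply: isAN isA1. Qed.

Lemma Cm_comm y z : Ht y -> Ht z -> Cm (y * z - z * y).
Proof.
move=> yH zH; exists [:: (1, y, z)]; rewrite big_seq1 scale1r; split=> // p.
by rewrite mem_seq1 => /eqP ->; split=> //; apply: isA1.
Qed.

Definition eqc y z := Cm (y - z).

Lemma eqc_refl y : eqc y y.
Proof. by rewrite /eqc subrr; apply: Cm0. Qed.

Lemma eqc_sym y z : eqc y z -> eqc z y.
Proof. by move/CmN; rewrite opprB. Qed.

Lemma eqc_trans y z t : eqc y z -> eqc z t -> eqc y t.
Proof. by move=> h1 h2; have := CmD h1 h2; rewrite addrA subrK. Qed.

Lemma TM g h : Wt g -> Wt h -> len (amul g h) = (len g + len h)%N -> T (amul g h) = T g * T h.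
Proof.
by rewrite !lwE => gW hW e; case: hrel => hr _; apply: (hr g h gW hW e).
Qed.

Lemma len1 : len aid = 0%N.
Proof.
apply: double_inj; rewrite lwE -(dist1_len R hRD hOm hxi hx0 Wt1) /dist big1 // => a _.
by rewrite subrr.
Qed.

(** Lengths add in products with [aid], so [T aid] is a left identity on the basis and hence
    everywhere. *)
Lemma T1 : T aid = 1.
Proof.
have h y : T aid * y = y.
  case: hbasis => + _ => /(_ y)[s [hs ->]]; rewrite /lincomb mulr_sumr big_seq [RHS]big_seq.
  apply: eq_bigr => p /hs pW; rewrite -scalerAr -TM ?amul1g // len1 //.
by rewrite -[LHS]mulr1 h.
Qed.

Lemma T_sq s : inS Phi cor xi x0 s -> T s * T s = vv *: T s + 1.
Proof.
case: hrel => _ + sS => /(_ s sS).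
rewrite mulrBl !mulrDr -scalerAr mulr1 -!scalerAl !mul1r scalerA divff ?v_neq0 // scale1r.
by move/eqP; rewrite subr_eq0 => /eqP e; rewrite /vv scalerBl addrAC -e addrK.
Qed.

(** [inS] is only a length condition. The other clauses record the geometry supplied by [wall]: an
    involution that carries every alcove across one of its walls. *)
Definition simple s := [/\ inS Phi cor xi x0 s, amul s s = aid &
  forall g, Wt g -> exists2 a, a \in Phi & adj g a (amul g s)].

(** Left multiplication by [k] carries the alcoves of [h] and [h s] to those of [g] and [g s], so
    adjacency at one alcove gives it at all. *)
Lemma simpleP g a s : Wt g -> a \in Phi -> inS Phi cor xi x0 s -> amul s s = aid ->
  adj g a (amul g s) -> simple s.
Proof.
move=> gW aP sS ss [ad1 ad2]; split=> // h hW.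
pose k := amul g (ainv h).
have kW : Wt k by apply: WtM => //; apply: WtV.
have kh : amul k h = g by rewrite -amulA amulVg ?amulg1 //; apply: unitW.
pose f b := b *m k.1^T.
have fi : injective f by apply: can_inj (mulmxK _); rewrite unitmx_tr; apply: unitW.
have fP b : b \in Phi -> b *m k.1^T \in Phi by apply: (W0ext_root hRD hOm kW).
pose a' := a *m k.1^T.
have fh c : flg h (f c) = flg g c - ipair c k.2 by rewrite -kh flgM addrK.
have fhs c : flg (amul h s) (f c) = flg (amul g s) c - ipair c k.2.
  by rewrite -kh -amulA [in RHS]flgM addrK.
exists a'; first exact: fP.
split; first by rewrite fh fhs ad1; ring.
move=> b bP.
have [c cP ->] : exists2 c, c \in Phi & b = f c.
  exists (b *m (invmx k.1)^T); first exact: (W0ext_root hRD hOm (W0ext_inv hRD hOm kW)).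
  by rewrite /f -mulmxA -trmx_mul mulmxV ?trmx1 ?mulmx1 //; apply: unitW.
rewrite -/(f a) (inj_eq fi) -mulNmx -/(f (- a)) (inj_eq fi) => ca cNa.
by rewrite fh fhs ad2.
Qed.

Lemma simple_Wt s : simple s -> Wt s.
Proof. by case=> [[/inW_inWt]]. Qed.

Lemma simple_len s : simple s -> len s = 1%N.
Proof. by case=> [[_ e] _ _]; rewrite lwE. Qed.

Lemma simpleK s g : simple s -> amul (amul g s) s = g.
Proof. by case=> _ ss _; rewrite -amulA ss amulg1. Qed.

Lemma simpleKl s g : simple s -> amul s (amul s g) = g.
Proof. by case=> _ ss _; rewrite amulA ss amul1g. Qed.

Lemma simpleV s : simple s -> ainv s = s.
Proof.
move=> sS; have us := unitW (simple_Wt sS); have [_ ss _] := sS.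
by rewrite -[LHS]amulg1 -ss amulA amulVg ?amul1g.
Qed.

Lemma dl_simple s g h : simple s -> Wt g -> Wt h ->
  (dl (amul g s) h).+1 = dl g h \/ dl (amul g s) h = (dl g h).+1.
Proof.
move=> ss gW hW; have [_ _ /(_ g gW)[a aP ad]] := ss.
have gsW := WtM gW (simple_Wt ss).
have := dl_adj hRD hOm hxi hx0 gW gsW hW aP ad.
by case: ifP => _; [left | right].
Qed.

Lemma len_mulr s g : simple s -> Wt g ->
  (len (amul g s)).+1 = len g \/ len (amul g s) = (len g).+1.
Proof.
move=> ss gW; have gsW := WtM gW (simple_Wt ss).
rewrite -!(dl1g Phi xi x0) !(dlC R hRD hOm hxi hx0 Wt1) //; exact: dl_simple.
Qed.

Lemma len_mull s g : simple s -> Wt g ->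
  (len (amul s g)).+1 = len g \/ len (amul s g) = (len g).+1.
Proof.
move=> ss gW; have := dl_simple ss Wt1 gW.
by rewrite amul1g (dl1g Phi xi x0) (dlE Phi xi x0 s g) (simpleV ss).
Qed.

Lemma T_mulr s g : simple s -> Wt g -> len (amul g s) = (len g).+1 ->
  T (amul g s) = T g * T s.
Proof.
by move=> ss gW e; rewrite TM ?(simple_len ss) ?addn1 //; apply: simple_Wt.
Qed.

Lemma T_mull s g : simple s -> Wt g -> len (amul s g) = (len g).+1 ->
  T (amul s g) = T s * T g.
Proof.
by move=> ss gW e; rewrite TM ?(simple_len ss) ?add1n //; apply: simple_Wt.
Qed.

Lemma T_down_r s g : simple s -> Wt g -> (len (amul g s)).+1 = len g ->
  T g = T (amul g s) * T s.
Proof.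
move=> ss gW e; have gsW := WtM gW (simple_Wt ss).
by rewrite -(T_mulr ss gsW) ?(simpleK g ss).
Qed.

Lemma T_down_l s g : simple s -> Wt g -> (len (amul s g)).+1 = len g ->
  T g = T s * T (amul s g).
Proof.
move=> ss gW e; have gsW := WtM (simple_Wt ss) gW.
by rewrite -(T_mull ss gsW) ?(simpleKl g ss).
Qed.

Lemma simple_T_sq s : simple s -> T s * T s = vv *: T s + 1.
Proof. by case=> sS _ _; apply: T_sq. Qed.

Lemma Ht_mul_simple s y : simple s -> Ht y -> Ht (y * T s).
Proof.
move=> ss; apply: Ht_mulr => g gW; have gsW := WtM gW (simple_Wt ss).
case: (len_mulr ss gW) => e; last by rewrite -T_mulr //; apply: HtT.
rewrite (T_down_r ss gW e) -mulrA simple_T_sq // mulrDr mulr1 -scalerAr.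
rewrite -(T_down_r ss gW e); apply: HtD; last exact: HtT.
by apply: HtZ isA_vv _; apply: HtT.
Qed.

(** Induction on the length with [T_s^-1 = T_s - (v - v^-1)]. The last clause is phrased as
    stability of the span under right multiplication by [y], so closure of the span under all
    products need not be proved. *)
Lemma T_unit x : Wt x ->
  exists y, [/\ T x * y = 1, y * T x = 1 & forall z, Ht z -> Ht (z * y)].
Proof.
have [m] := ubnP (len x); elim: m => // m IH in x *; rewrite ltnS => lm xW.
have [l0|lx] := eqVneq (len x) 0%N.
  have xV := WtV xW; have ux := unitW xW.
  have lV : len (ainv x) = 0%N.
    rewrite -l0 -[in RHS](dl1g Phi xi x0) (dlC R hRD hOm hxi hx0 Wt1 xW) dlE amulg1 //.
  exists (T (ainv x)); split.
  - by rewrite -TM // ?amulgV ?T1 // l0 lV len1.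
  - by rewrite -TM // ?amulVg ?T1 // l0 lV len1.
  move=> z; apply: Ht_mulr => g gW.
  have gxW := WtM gW xV.
  suff e : len (amul g (ainv x)) = len g by rewrite -TM ?e ?lV ?addn0 //; apply: HtT.
  have d0 : dl g (amul g (ainv x)) = 0%N.
    by rewrite dlE amulA amulVg ?amul1g //; apply: unitW.
  have f0 := dl0_flg R hRD hOm hxi hx0 gW gxW d0.
  have := dl_add (R := R) hRD hOm hxi hx0 Wt1 gW gxW; rewrite d0 addn0 !(dl1g Phi xi x0); apply => a aP.
  by rewrite -(f0 a aP) lexx andbT le_total.
have [f0|[a aP lt]] := flg_diff R hRD hOm hxi hx0 xW Wt1.
  by move/eqP: lx; rewrite -(dl1g Phi xi x0); case; apply: (flg_dl0 hRD hOm hxi hx0 (R := R)) => // a /f0.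
have y0 : rp a (pt R x0 aid) < (flg x a)%:~R.
  apply: lt_le_trans (ltD1_flg R x0 aid a) _.
  by rewrite -[1]/(1%:~R) -rmorphD ler_int; lia.
have [b [s [bP yb sS ss ad]]] := wall hRD hOm hxi hx0 xW aP y0.
have sSim := simpleP xW bP sS ss ad.
have xsW := WtM xW (simple_Wt sSim).
have e : (len (amul x s)).+1 = len x.
  have := dl_adj hRD hOm hxi hx0 xW xsW Wt1 bP ad.
  rewrite !(dlC R hRD hOm hxi hx0 _ Wt1) // !(dl1g Phi xi x0) ifT //.
  by rewrite -(ltr_int R); apply: le_lt_trans yb; exact: (@cl_pt R n Phi x0 aid b bP).
have [|y [e1 e2 hy]] := IH _ _ xsW; first by rewrite e; lia.
pose t := T s - vv%:A.
have ts1 : T s * t = 1.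
  by rewrite mulrBr simple_T_sq // -scalerAr mulr1 addrAC subrr add0r.
have ts2 : t * T s = 1.
  by rewrite mulrBl simple_T_sq // -scalerAl mul1r addrAC subrr add0r.
exists (t * y); rewrite (T_down_r sSim xW e); split.
- by rewrite mulrA -(mulrA _ (T s)) ts1 mulr1.
- by rewrite mulrA -(mulrA t) e2 mulr1.
move=> z zH; rewrite mulrA; apply: hy; rewrite mulrBr; apply: HtD.
  exact: Ht_mul_simple.
by apply: HtN; rewrite -scalerAr mulr1; apply: HtZ isA_vv _.
Qed.

Definition cj w g := amul (ainv g) (amul w g).

Lemma cj_def w g : cj w g = amul (ainv g) (amul w g). Proof. by []. Qed.

Lemma cjE w g : len (cj w g) = dl g (amul w g). Proof. by []. Qed.

Lemma cj_Wt w g : Wt w -> Wt g -> Wt (cj w g).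
Proof. by move=> wW gW; apply: WtM; [apply: WtV | apply: WtM]. Qed.

Definition eqv w g h := eqc (T (cj w g)) (T (cj w h)) /\ len (cj w g) = len (cj w h).

Lemma eqv_refl w g : eqv w g g.
Proof. by split; [exact: eqc_refl | exact: erefl]. Qed.

Lemma eqv_sym w g h : eqv w g h -> eqv w h g.
Proof. by case=> h1 h2; split; [exact: eqc_sym | exact: esym]. Qed.

Lemma eqv_trans w g h k : eqv w g h -> eqv w h k -> eqv w g k.
Proof. by case=> h1 h2 [h3 h4]; split; [exact (eqc_trans h1 h3) | exact (etrans h2 h4)]. Qed.

(** With [y] inverse to [T x], the elements [T u'] and [T u] are the products of [T x] and [T u * y]
    in the two orders. *)
Lemma eqc_conj x u u' : Wt x -> Wt u -> Wt u' -> T x * T u = T u' * T x -> eqc (T u') (T u).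
Proof.
move=> xW uW u'W e; have [y [e1 e2 hy]] := T_unit xW.
have eu' : T u' = T x * (T u * y) by rewrite mulrA e -mulrA e1 mulr1.
have eu : T u = (T u * y) * T x by rewrite -mulrA e2 mulr1.
rewrite /eqc eu' [X in _ - X]eu; apply: Cm_comm; first exact: HtT.
by apply: hy; apply: HtT.
Qed.

(* With [x = h^-1 g], both sides of [T_x T_{g^-1wg} = T_{h^-1wh} T_x] are [T_{h^-1wg}]. *)
Lemma strong_conj w g h : Wt w -> Wt g -> Wt h ->
  dl h (amul w g) = (dl h g + dl g (amul w g))%N ->
  dl h (amul w g) = (dl h (amul w h) + dl (amul w h) (amul w g))%N ->
  eqv w g h.
Proof.
move=> wW gW hW e1 e2; have e3 := dl_mul R hRD hOm hxi hx0 wW hW gW.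
have ug := unitW gW; have uh := unitW hW; have uw := unitW wW.
split; last by rewrite !cjE; lia.
pose x := amul (ainv h) g.
have xW : Wt x by apply: WtM => //; apply: WtV.
have cg := cj_Wt wW gW; have ch := cj_Wt wW hW.
have k1 : amul x (cj w g) = amul (ainv h) (amul w g).
  by rewrite /x !cj_def -amulA (amulA g) amulgV // amul1g.
have k2 : amul (cj w h) x = amul (ainv h) (amul w g).
  by rewrite /x !cj_def -!amulA (amulA h) amulgV // amul1g.
apply: eqc_sym; apply: (eqc_conj xW) => //.
rewrite -!TM // ?k1 ?k2 //.
  by rewrite -[LHS]/(dl h (amul w g)) e2 e3.
Qed.

(** Nonnegativity in the theorem comes from here: both coefficients, [1] and [vv], are nonnegative
    polynomials in [v - v^-1]. *)
Definition drops u := exists u1 u2, [/\ Wt u1, Wt u2, (len u1 < len u)%N, (len u2 < len u)%N &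
  eqc (T u) (T u1 + vv *: T u2)].

(** If the wall separates [g] from [w g], then [s u] is shorter than [u], and [T u = T s * T (s u)]
    is congruent to [T (s u) * T s]. If [s u s] is longer than [s u], this is its basis element;
    otherwise the quadratic relation splits it. Separation from [w^-1 g] is the mirror image, with
    [u s]. *)
Lemma step_conj w g a s : Wt w -> Wt g -> a \in Phi -> simple s -> adj g a (amul g s) ->
  (flg (amul w g) a < flg g a) || (flg (amul (ainv w) g) a < flg g a) ->
  eqv w g (amul g s) \/
  (len (cj w (amul g s)) < len (cj w g))%N /\ drops (cj w g).
Proof.
move=> wW gW aP ss ad hs; have sW := simple_Wt ss; have gsW := WtM gW sW.
have ug := unitW gW; have ugs := unitW gsW; have uw := unitW wW; have wgW := WtM wW gW.
have wV := WtV wW; have cg := cj_Wt wW gW; have cgs := cj_Wt wW gsW.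
set u := cj w g in cg *.
have su : amul s u = amul (ainv (amul g s)) (amul w g).
  have -> : ainv (amul g s) = amul s (ainv g).
    rewrite -[RHS]amulg1 -(amulgV ugs) !amulA -(amulA s) amulVg // amulg1.
    by have [_ -> _] := ss; rewrite amul1g.
  by rewrite /u !cj_def !amulA.
have sus : cj w (amul g s) = amul (amul s u) s by rewrite su !cj_def !amulA.
have us : amul u s = amul (ainv g) (amul w (amul g s)) by rewrite /u !cj_def !amulA.
have sus' : cj w (amul g s) = amul s (amul u s) by rewrite sus amulA.
have suW : Wt (amul s u) by apply: WtM.
have usW : Wt (amul u s) by apply: WtM.
case/orP: hs => hs.
  have l1 : (len (amul s u)).+1 = len u.
    by have := dl_adj hRD hOm hxi hx0 gW gsW wgW aP ad; rewrite hs su.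
  have c1 : eqc (T u) (T (amul s u) * T s).
    by rewrite (T_down_l ss cg l1); apply: Cm_comm; apply: HtT.
  case: (len_mulr ss suW) => l2; rewrite -sus in l2.
    right; split; first by lia.
    exists (cj w (amul g s)), (amul s u); split=> //; [lia | lia |].
    apply: eqc_trans c1 _.
    rewrite (T_down_r ss suW) -?sus // -mulrA simple_T_sq // mulrDr mulr1 -scalerAr addrC.
    by rewrite sus -(T_down_r ss suW) -?sus //; apply: eqc_refl.
  left; split; last by rewrite cjE -/u l2.
  by rewrite sus (T_mulr ss suW) // -sus.
have l1 : (len (amul u s)).+1 = len u.
  have := dl_adj hRD hOm hxi hx0 gW gsW (WtM wV gW) aP ad; rewrite hs.
  rewrite -(dl_mul R hRD hOm hxi hx0 wW gsW (WtM wV gW)) -(dl_mul R hRD hOm hxi hx0 wW gW (WtM wV gW)).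
  rewrite !(amulA w (ainv w)) amulgV // amul1g !(dlC R hRD hOm hxi hx0 _ gW) ?us //.
  exact: WtM.
have c1 : eqc (T u) (T s * T (amul u s)).
  by rewrite (T_down_r ss cg l1); apply: Cm_comm; apply: HtT.
case: (len_mull ss usW) => l2; rewrite -sus' in l2.
  right; split; first by lia.
  exists (cj w (amul g s)), (amul u s); split=> //; [lia | lia |].
  apply: eqc_trans c1 _.
  rewrite (T_down_l ss usW) -?sus' // mulrA simple_T_sq // mulrDl mul1r -scalerAl addrC.
  by rewrite sus' -(T_down_l ss usW) -?sus' //; apply: eqc_refl.
left; split; last by rewrite cjE -/u l2.
by rewrite sus' (T_mull ss usW) // -sus'.
Qed.

(** * Paths of allowed wall crossings *)

Implicit Types (B : 'rV[int]_n -> int -> Prop).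

(** [B] selects the hyperplanes, given by root and level, that may be crossed; it serves to confine
    paths to the residue at a point. *)
Definition step B w g g' := exists a s,
  [/\ a \in Phi, simple s, g' = amul g s, adj g a g' & B a (flg g a)] /\
  (flg (amul w g) a < flg g a) || (flg (amul (ainv w) g) a < flg g a).

Inductive reach B w : aff n -> aff n -> Prop :=
| reach_refl g : reach B w g g
| reach_step g g1 g2 : step B w g g1 -> reach B w g1 g2 -> reach B w g g2.

Lemma reach_trans B w g1 g2 g3 : reach B w g1 g2 -> reach B w g2 g3 -> reach B w g1 g3.
Proof. by elim=> // g h k st _ IH /IH; apply: reach_step. Qed.

Lemma reach1 B w g g' : step B w g g' -> reach B w g g'.
Proof. by move=> st; apply: reach_step st (reach_refl _ _ _). Qed.

Lemma reach_mono B B' w g g' : (forall a k, a \in Phi -> B a k -> B' a k) ->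
  reach B w g g' -> reach B' w g g'.
Proof.
move=> BB'; elim=> [h|h h1 h2 [a [s [[aP ss e ad Ba] hs]]] _]; first exact: reach_refl.
by apply: reach_step; exists a, s; split=> //; split=> //; apply: BB'.
Qed.

Lemma reach_Wt B w g g' : reach B w g g' -> Wt g -> Wt g'.
Proof.
elim=> // h h1 h2 [a [s [[aP ss -> ad Ba] hs]]] _ IH hW; apply: IH.
by apply: WtM => //; apply: simple_Wt.
Qed.

(** Class and length are constant up to the first decrease, so the drop found there is already a
    drop of the starting element. *)
Lemma reachP B w g g' : Wt w -> Wt g -> reach B w g g' ->
  eqv w g g' \/ (len (cj w g') < len (cj w g))%N /\ drops (cj w g).
Proof.
move=> wW + r; elim: r => [h _|h h1 h2 [a [s [[aP ss -> ad Ba] hs]]] r IH hW].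
  by left; apply: eqv_refl.
have h1W := WtM hW (simple_Wt ss).
case: (step_conj wW hW aP ss ad hs) => [e1|[l1 d1]]; last first.
  right; split=> //; case: (IH h1W) => [[_ <-]//|[l2 _]].
  exact: ltn_trans l2 l1.
case: (IH h1W) => [e2|[l2 d2]]; first by left; apply: eqv_trans e1 e2.
right; case: e1 => e1 el; rewrite el; split=> //.
have [u1 [u2 [u1W u2W lu1 lu2 e]]] := d2.
by exists u1, u2; rewrite el; split=> //; exact (eqc_trans e1 e).
Qed.

Definition terminal B w g := forall g', reach B w g g' -> len (cj w g') = len (cj w g).

Lemma terminal_reach B w g g' : terminal B w g -> reach B w g g' -> terminal B w g'.
Proof. by move=> tg r h /(reach_trans r)/tg ->; rewrite (tg _ r). Qed.

Lemma terminal_eqv B w g g' : Wt w -> Wt g -> terminal B w g -> reach B w g g' -> eqv w g g'.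
Proof.
move=> wW gW tg r; case: (reachP wW gW r) => // -[].
by rewrite (tg _ r) ltnn.
Qed.

Lemma terminal_mono B B' w g : (forall a k, a \in Phi -> B' a k -> B a k) ->
  terminal B w g -> terminal B' w g.
Proof. by move=> BB' tg g' /(reach_mono BB')/tg. Qed.

Lemma exists_terminal B w g : Wt w -> Wt g -> exists2 g', reach B w g g' & terminal B w g'.
Proof.
move=> wW; have [m] := ubnP (len (cj w g)); elim: m => // m IH in g *.
rewrite ltnS => lm gW.
have [tg|] := EM (terminal B w g); first by exists g => //; apply: reach_refl.
move=> nt; have [h r lh] : exists2 h, reach B w g h & (len (cj w h) < len (cj w g))%N.
  apply: contrapT => nh; apply: nt => h r.
  have le_h : (len (cj w h) <= len (cj w g))%N by case: (reachP wW gW r) => [[_ ->]|[/ltnW]].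
  by apply/eqP; rewrite eqn_leq le_h leqNgt; apply/negP => lt_h; apply: nh; exists h.
have [|h' r' th] := IH h _ (reach_Wt r gW); first exact: leq_trans lh lm.
by exists h' => //; apply: reach_trans r r'.
Qed.

End HeckeAlgebra.

(** * Invariant inner products and the top eigenspace *)

Section Minimum.
Variables (R : realType) (n : nat).

Lemma rV_min (K : set 'rV[R]_n) (M : R) (f : 'rV[R]_n -> R) x0 :
  closed K -> (forall x, K x -> forall i, `|x 0 i| <= M) -> continuous f -> K x0 ->
  exists2 x, K x & forall y, K y -> f x <= f y.
Proof.
move=> clK bK cf Kx0.
have cK : compact K.
  have Mco : compact [set v : 'rV[R]_n | forall i, `[- M, M]%classic (v ord0 i)].
    by apply: (@rV_compact _ _ (fun=> `[- M, M]%classic)) => i; apply: segment_compact.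
  apply: subclosed_compact clK Mco _ => v Kv i /=.
  by rewrite in_itv /= -ler_norml; apply: bK.
have [||x xK xm] := EVT_min_rV (f := f) _ cK; first by exists x0.
  exact: continuous_subspaceT.
by exists x; [rewrite inE in xK | move=> y Ky; apply: xm; rewrite inE].
Qed.

Lemma continuous_lin (c : 'cV[R]_n) : continuous (fun x : 'rV[R]_n => (x *m c) 0 0).
Proof.
have -> : (fun x : 'rV[R]_n => (x *m c) 0 0) = (fun x => \sum_i x 0 i * c i 0).
  by apply/funext => x; rewrite mxE.
move=> x; apply: (@cvg_big R _ +%R 0) => [||i _].
- exact: add_continuous.
- exact: nbhs_filter.
by apply: cvgM; [exact: nbhs_filter | exact: (@coord_continuous R 1 n 0 i x) | apply: cvg_cst; exact: nbhs_filter].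
Qed.

Lemma continuous_quad (G : 'M[R]_n) : continuous (fun x : 'rV[R]_n => (x *m G *m x^T) 0 0).
Proof.
have -> : (fun x : 'rV[R]_n => (x *m G *m x^T) 0 0)
        = (fun x => \sum_i (x *m col i G) 0 0 * x 0 i).
  apply/funext => x; rewrite mxE; apply: eq_bigr => i _.
  rewrite [X in _ * X]mxE; congr (_ * _).
  by rewrite !mxE; apply: eq_bigr => j _; rewrite mxE.
move=> x; apply: (@cvg_big R _ +%R 0) => [||i _].
- exact: add_continuous.
- exact: nbhs_filter.
by apply: cvgM; [exact: nbhs_filter | exact: continuous_lin | exact: (@coord_continuous R 1 n 0 i x)].
Qed.

End Minimum.

Lemma sum_cyclic (V : zmodType) (f : nat -> V) N : (0 < N)%N -> f N = f 0%N ->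
  \sum_(i < N) f i.+1 = \sum_(i < N) f i.
Proof.
case: N => // m _ e; rewrite big_ord_recr [RHS]big_ord_recl /= e addrC.
by congr (_ + _); apply: eq_bigr => i _.
Qed.

Section InvariantForm.
Variables (R : realFieldType) (n N : nat) (A : 'M[R]_n).
Hypothesis N_gt0 : (0 < N)%N.
Hypothesis A_order : A ^+ N = 1%:M.
Implicit Types (x y z : 'rV[R]_n) (X F : 'M[R]_n).

(* Averaging over the powers of [A] makes [A] orthogonal. *)
Definition gram : 'M[R]_n := \sum_(i < N) A ^+ i *m (A ^+ i)^T.
Definition dotG x y : R := (x *m gram *m y^T) 0 0.
Definition Ainv : 'M[R]_n := A ^+ N.-1.

Lemma mulAV : A *m Ainv = 1%:M.
Proof. by rewrite -A_order -[N in RHS]prednK // exprS. Qed.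

Lemma mulVA : Ainv *m A = 1%:M.
Proof. exact: mulmx1C mulAV. Qed.

Lemma gram_tr : gram^T = gram.
Proof.
by rewrite raddf_sum; apply: eq_bigr => i _; rewrite /= trmx_mul trmxK.
Qed.

Lemma gram_inv : A *m gram *m A^T = gram.
Proof.
rewrite /gram mulmx_sumr mulmx_suml.
transitivity (\sum_(i < N) A ^+ i.+1 *m (A ^+ i.+1)^T).
  apply: eq_bigr => i _; rewrite exprS -[A * A ^+ i]/(A *m A ^+ i).
  by rewrite trmx_mul !mulmxA.
apply: (sum_cyclic (f := fun i => A ^+ i *m (A ^+ i)^T)) => //.
by rewrite A_order expr0.
Qed.

Lemma dotG0 y : dotG 0 y = 0.
Proof. by rewrite /dotG !mul0mx mxE. Qed.

Lemma dotGDl x y z : dotG (x + y) z = dotG x z + dotG y z.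
Proof. by rewrite /dotG !mulmxDl mxE. Qed.

Lemma dotGZl c x z : dotG (c *: x) z = c * dotG x z.
Proof. by rewrite /dotG -!scalemxAl mxE. Qed.

Lemma dotGC x y : dotG x y = dotG y x.
Proof. by rewrite /dotG -[in RHS]gram_tr -[y in RHS]trmxK -!trmx_mul mulmxA [RHS]mxE. Qed.

Lemma dotGDr x y z : dotG x (y + z) = dotG x y + dotG x z.
Proof. by rewrite !(dotGC x) dotGDl. Qed.

Lemma dotGZr c x z : dotG x (c *: z) = c * dotG x z.
Proof. by rewrite !(dotGC x) dotGZl. Qed.

Lemma dotGNl x z : dotG (- x) z = - dotG x z.
Proof. by rewrite -scaleN1r dotGZl mulN1r. Qed.

Lemma dotGNr x z : dotG x (- z) = - dotG x z.
Proof. by rewrite -scaleN1r dotGZr mulN1r. Qed.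

Lemma dotG_mulA x y : dotG (x *m A) (y *m A) = dotG x y.
Proof. by rewrite /dotG trmx_mul -!mulmxA (mulmxA A) (mulmxA _ A^T) gram_inv !mulmxA. Qed.

Lemma dotG_adjoint x y : dotG (x *m A) y = dotG x (y *m Ainv).
Proof. by rewrite -[RHS]dotG_mulA -mulmxA mulVA mulmx1. Qed.

(** The summand of [gram] with exponent 0 is the standard form and the others are nonnegative. This
    yields definiteness and bounded coordinates. *)
Lemma sqnorm_le x : \sum_i x 0 i ^+ 2 <= dotG x x.
Proof.
have E M : (x *m (M *m M^T) *m x^T) 0 0 = \sum_i (x *m M) 0 i ^+ 2 :> R.
  by rewrite mulmxA -mulmxA -trmx_mul mxE; apply: eq_bigr => i _; rewrite [X in _ * X]mxE expr2.
rewrite /dotG /gram mulmx_sumr mulmx_suml summxE (bigD1 (Ordinal N_gt0)) //= expr0 E mulmx1.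
rewrite lerDl sumr_ge0 // => i _; rewrite E; apply: sumr_ge0 => j _; exact: sqr_ge0.
Qed.

Lemma dotG_ge0 x : 0 <= dotG x x.
Proof. by apply: le_trans (sqnorm_le x); apply: sumr_ge0 => i _; apply: sqr_ge0. Qed.

Lemma coord_le x i : x 0 i ^+ 2 <= dotG x x.
Proof.
apply: le_trans (sqnorm_le x); rewrite (bigD1 i) //= lerDl.
by apply: sumr_ge0 => j _; apply: sqr_ge0.
Qed.

Lemma dotG_eq0 x : dotG x x = 0 -> x = 0.
Proof.
move=> e; apply/rowP => i; rewrite mxE; apply/eqP; rewrite -sqrf_eq0.
by apply/eqP/le_anti; rewrite sqr_ge0 -e coord_le.
Qed.

Lemma dotG_gt0 x : x != 0 -> 0 < dotG x x.
Proof.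
move=> x0; rewrite lt_def dotG_ge0 andbT; apply: contra x0 => /eqP/dotG_eq0 ->.
by [].
Qed.

Definition perp X : 'M[R]_n := kermx (gram *m X^T).

Lemma perpE X x : (x <= perp X)%MS = (x *m gram *m X^T == 0).
Proof. by rewrite sub_kermx mulmxA. Qed.

Lemma perpP X x : (x <= perp X)%MS -> forall y, (y <= X)%MS -> dotG x y = 0.
Proof.
rewrite perpE => /eqP e y /submxP[D ->].
by rewrite /dotG trmx_mul mulmxA e mul0mx mxE.
Qed.

Lemma stable_inv X : (X *m A <= X)%MS -> (X *m Ainv <= X)%MS.
Proof.
rewrite /Ainv => hX; elim: N.-1 => [|k IH]; first by rewrite expr0 mulmx1.
rewrite exprSr -[A ^+ k * A]/(A ^+ k *m A) mulmxA.
by apply: submx_trans hX; apply: submxMr.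
Qed.

Lemma perp_stable X : (X *m A <= X)%MS -> (perp X *m A <= perp X)%MS.
Proof.
move=> /stable_inv/submxP[D e].
have gA : A *m gram = gram *m Ainv^T.
  rewrite -[gram in RHS]gram_inv -!mulmxA -trmx_mul mulVA trmx1 mulmx1 //.
rewrite /perp sub_kermx -mulmxA (mulmxA A) gA -!mulmxA -trmx_mul e trmx_mul.
by rewrite !mulmxA -(mulmxA _ gram) mulmx_ker mul0mx.
Qed.

Lemma cap_perp X : (X :&: perp X)%MS = 0.
Proof.
apply/eqP/rowV0P => v; rewrite sub_capmx => /andP[vX vP].
by apply: dotG_eq0; apply: perpP vX.
Qed.

Lemma add_perp X : (1%:M <= X + perp X)%MS.
Proof.
rewrite sub1mx -col_leq_rank (mxrank_disjoint_sum (cap_perp X)) mxrank_ker.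
by rewrite -leq_subLR leq_sub2l // (leq_trans (mxrankM_maxr _ _)) ?mxrank_tr.
Qed.

Definition pproj X : 'M[R]_n := proj_mx X (perp X).

Lemma pproj_sub X x : (x *m pproj X <= X)%MS.
Proof. exact: proj_mx_sub. Qed.

Lemma pproj_compl X x : (x - x *m pproj X <= perp X)%MS.
Proof.
by apply: proj_mx_compl_sub; apply: submx_trans (add_perp X); apply: submx1.
Qed.

Lemma pproj_id X x : (x <= X)%MS -> x *m pproj X = x.
Proof. by move=> xX; apply: proj_mx_id => //; apply: cap_perp. Qed.

Lemma pproj_perp X x : (x <= perp X)%MS -> x *m pproj X = 0.
Proof. by move=> xX; apply: proj_mx_0 => //; apply: cap_perp. Qed.

Lemma perpI X x : (forall y, (y <= X)%MS -> dotG x y = 0) -> (x <= perp X)%MS.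
Proof.
move=> h; rewrite perpE; apply/eqP/rowP => i; rewrite [RHS]mxE.
rewrite -[RHS](h (row i X) (row_sub _ _)) /dotG mxE [RHS]mxE.
by apply: eq_bigr => j _; rewrite !mxE.
Qed.

Lemma perp_anti X (Y : 'M[R]_n) x : (X <= Y)%MS -> (x <= perp Y)%MS -> (x <= perp X)%MS.
Proof. by move=> XY xY; apply: perpI => y yX; apply: (perpP xY); apply: submx_trans XY. Qed.

Lemma stableP X (Y B : 'M[R]_n) : (forall x : 'rV[R]_n, (x <= X)%MS -> (x *m B <= Y)%MS) -> (X *m B <= Y)%MS.
Proof. by move=> h; apply/row_subP => i; rewrite row_mul; apply/h/row_sub. Qed.

Lemma stable_row X x : (X *m A <= X)%MS -> (x <= X)%MS -> (x *m A <= X)%MS.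
Proof. by move=> h xX; apply: submx_trans h; apply: submxMr. Qed.

Definition symA : 'M[R]_n := A + Ainv.

Lemma dotG_adjointV x y : dotG (x *m Ainv) y = dotG x (y *m A).
Proof. by rewrite dotGC -dotG_adjoint dotGC. Qed.

Lemma dotG_symA x y : dotG (x *m symA) y = dotG x (y *m symA).
Proof. by rewrite !mulmxDr dotGDl dotGDr dotG_adjoint dotG_adjointV addrC. Qed.

Lemma dotG_symA_diag x : dotG (x *m symA) x = 2 * dotG (x *m A) x.
Proof. by rewrite mulmxDr dotGDl dotG_adjointV (dotGC x) mulr_natl. Qed.

Lemma symA_comm x : x *m A *m symA = x *m symA *m A.
Proof. by rewrite -!mulmxA mulmxDr mulmxDl mulAV mulVA. Qed.

(** Identifies the descent direction: up to a positive factor, the negative gradient of the left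
    side is [x *m (symA - 2%:M)]. *)
Lemma sqnorm_subA x : dotG (x *m A - x) (x *m A - x) = 2 * dotG x x - dotG (x *m symA) x.
Proof.
rewrite dotG_symA_diag dotGDl !dotGDr dotGNl !dotGNr dotGNl dotG_mulA (dotGC x (x *m A)).
ring.
Qed.

Lemma sqnorm_addA x : dotG (x *m A + x) (x *m A + x) = 2 * dotG x x + dotG (x *m symA) x.
Proof.
rewrite dotG_symA_diag dotGDl !dotGDr dotG_mulA (dotGC x (x *m A)).
ring.
Qed.

Section TopEigenspace.
Variables (F : 'M[R]_n) (lam : R).
Hypothesis F_stable : (F *m A <= F)%MS.
Hypothesis lam_max : forall x, (x <= perp F)%MS -> dotG (x *m symA) x <= lam * dotG x x.

Lemma symA_perp x : (x <= perp F)%MS -> (x *m symA <= perp F)%MS.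
Proof.
move=> xP; have PA := perp_stable F_stable.
by rewrite mulmxDr addmx_sub ?stable_row //; apply: submx_trans (stable_inv PA); apply: submxMr.
Qed.

(** A maximizer of the Rayleigh quotient is compared with [x + t *: y], where [y] is its defect as
    an eigenvector. The gain is of first order in [t] and the loss of second order, so [y = 0]. *)
Lemma rayleigh_eigen x : (x <= perp F)%MS -> dotG (x *m symA) x = lam * dotG x x ->
  x *m symA = lam *: x.
Proof.
move=> xP ex; have [y yE] : exists y, y = x *m symA - lam *: x by eexists.
have yP : (y <= perp F)%MS by rewrite yE addmx_sub ?symA_perp // eqmx_opp scalemx_sub.
pose c := lam * dotG y y - dotG (y *m symA) y.
have c0 : 0 <= c by rewrite subr_ge0 lam_max.
have key t : 2 * t * dotG y y <= t ^+ 2 * c.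
  have := lam_max (x := x + t *: y); rewrite addmx_sub ?scalemx_sub // => /(_ isT).
  have exy : dotG (x *m symA) y = dotG y y + lam * dotG x y.
    by rewrite {2}yE dotGDl dotGNl dotGZl subrK.
  have eyx : dotG (y *m symA) x = dotG y y + lam * dotG x y.
    by rewrite dotG_symA dotGC exy.
  rewrite mulmxDl -scalemxAl !dotGDl !dotGDr !dotGZl !dotGZr ex exy eyx (dotGC y x) /c.
  lra.
have y0 : dotG y y = 0.
  apply/le_anti; rewrite dotG_ge0 andbT leNgt; apply/negP => Y0.
  have c1 : 0 < 1 + c by rewrite ltr_pwDl.
  pose t := dotG y y / (1 + c).
  have t0 : 0 < t by rewrite divr_gt0.
  have et : t * (1 + c) = dotG y y by rewrite mulfVK // gt_eqF.
  have := key t; rewrite -et expr2.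
  have : 0 < t * t by rewrite mulr_gt0.
  nra.
by apply/eqP; rewrite -subr_eq0 -yE; apply/eqP/dotG_eq0.
Qed.

Definition topspace : 'M[R]_n := (perp F :&: kermx (symA - lam%:M))%MS.

Lemma topspaceE x : (x <= topspace)%MS = (x <= perp F)%MS && (x *m symA == lam *: x).
Proof. by rewrite sub_capmx sub_kermx mulmxBr mul_mx_scalar subr_eq0. Qed.

Lemma topspace_stable : (topspace *m A <= topspace)%MS.
Proof.
apply: stableP => x; rewrite !topspaceE => /andP[xP /eqP e].
by rewrite (stable_row (perp_stable F_stable)) //= symA_comm e scalemxAl.
Qed.

Lemma topspace_neg u : (u <= perp (F + topspace)%MS)%MS -> u != 0 ->
  dotG (u *m (symA - lam%:M)) u < 0.
Proof.
move=> uP u0; have uF := perp_anti (addsmxSl F topspace) uP.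
rewrite mulmxBr mul_mx_scalar dotGDl dotGNl dotGZl subr_lt0 lt_def lam_max // andbT.
apply: contra u0 => /eqP/esym/(rayleigh_eigen uF) e.
have uE : (u <= topspace)%MS by rewrite topspaceE uF e eqxx.
by apply/eqP/dotG_eq0; apply: (perpP uP); apply: submx_trans uE (addsmxSr _ _).
Qed.

Lemma topspace_rank x : (x <= topspace)%MS -> x != 0 -> (\rank F < \rank (F + topspace)%MS)%N.
Proof.
move=> xE x0; rewrite ltn_neqAle mxrankS ?addsmxSl // andbT.
apply: contra x0; rewrite (mxrank_leqif_eq (addsmxSl _ _)) => /andP[_ h].
have xF : (x <= F)%MS by apply: submx_trans h; apply: submx_trans xE (addsmxSr _ _).
move: xE; rewrite topspaceE => /andP[xP _].
by rewrite -submx0 -(cap_perp F) sub_capmx xF.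
Qed.

Lemma topspace_le2 x : (x <= topspace)%MS -> x != 0 -> -2 <= lam <= 2.
Proof.
rewrite topspaceE => /andP[_ /eqP e] x0; have d0 := dotG_gt0 x0.
have := dotG_ge0 (x *m A - x); have := dotG_ge0 (x *m A + x).
rewrite sqnorm_subA sqnorm_addA e dotGZl -mulrDl -mulrBl !pmulr_lge0 //; lra.
Qed.

Lemma topspace_eq2 x : (x <= topspace)%MS -> lam = 2 -> x *m A = x.
Proof.
rewrite topspaceE => /andP[_ /eqP e] l2; apply/eqP; rewrite -subr_eq0; apply/eqP/dotG_eq0.
by rewrite sqnorm_subA e dotGZl l2 subrr.
Qed.

(** As -2 is the least possible value of the quotient, a maximum of -2 forces [x *m A + x] to have
    norm zero on all of [perp F]. *)
Lemma topspace_eqN2 x : (x <= perp F)%MS -> lam = -2 -> x *m A = - x.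
Proof.
move=> xP l2; apply/eqP; rewrite -subr_eq0 opprK; apply/eqP/dotG_eq0.
apply/le_anti; rewrite dotG_ge0 andbT sqnorm_addA.
by have := lam_max xP; rewrite l2; lra.
Qed.

End TopEigenspace.

End InvariantForm.

Section TopEigenvalue.
Variables (R : realType) (n N : nat) (A : 'M[R]_n).
Hypothesis N_gt0 : (0 < N)%N.
Hypothesis A_order : A ^+ N = 1%:M.
Notation dotG := (dotG N A).
Notation perp := (perp N A).
Notation symA := (symA N A).

Lemma exists_top (F : 'M[R]_n) : (F *m A <= F)%MS -> ~~ row_full F ->
  exists lam, (forall x : 'rV[R]_n, (x <= perp F)%MS -> dotG (x *m symA) x <= lam * dotG x x) /\
    exists2 x : 'rV[R]_n, (x <= topspace N A F lam)%MS & x != 0.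
Proof.
move=> hF nF.
pose C := gram N A *m F^T.
(* Orthogonality to [F] is expressed as the vanishing of a quadratic form, so that continuity makes
   the unit sphere of [perp F] closed. *)
pose K : set 'rV[R]_n := [set x | (x *m (C *m C^T) *m x^T) 0 0 = 0 /\ dotG x x = 1]%classic.
have KE x : K x <-> (x <= perp F)%MS /\ dotG x x = 1.
  split=> [[h1 h2]|[h1 h2]]; split=> //.
    rewrite perpE -mulmxA -/C; move: h1; rewrite mulmxA -mulmxA -trmx_mul mxE.
    move/eqP; rewrite psumr_eq0 => [/allP h|j _]; last by rewrite [X in _ * X]mxE -expr2 sqr_ge0.
    apply/eqP/rowP => i; rewrite [RHS]mxE.
    have := h i (mem_index_enum i); rewrite /= [X in _ * X]mxE -expr2 sqrf_eq0.
    by move/eqP.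
  move: h1; rewrite perpE -mulmxA -/C => /eqP h1.
  by rewrite mulmxA h1 !mul0mx mxE.
have clK : closed K.
  apply: closedI.
    apply: (@closed_comp _ _ (fun x : 'rV[R]_n => (x *m (C *m C^T) *m x^T) 0 0) [set x | x = 0]%classic).
      by move=> x _; apply: continuous_quad.
    exact: closed_eq.
  apply: (@closed_comp _ _ (fun x : 'rV[R]_n => (x *m gram N A *m x^T) 0 0) [set x | x = 1]%classic).
    by move=> x _; apply: continuous_quad.
  exact: closed_eq.
have bK x : K x -> forall i, `|x 0 i| <= 1.
  move=> [_ h] i; rewrite -(@expr_le1 _ 2) // real_normK ?num_real // -h.
  exact: coord_le.
have scale x : x != 0 -> exists2 c : R, c != 0 & dotG (c *: x) (c *: x) = 1.
  move=> /(dotG_gt0 A N_gt0) d0; exists (Num.sqrt (dotG x x))^-1.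
    by rewrite invr_eq0 sqrtr_eq0 -ltNge.
  rewrite dotGZl dotGZr mulrA -expr2 exprVn sqr_sqrtr ?mulVf ?gt_eqF //; exact: ltW.
have [y yK] : exists y, K y.
  have : perp F != 0.
    apply: contra nF => /eqP p0; rewrite -sub1mx; have := add_perp A N_gt0 F.
    by rewrite p0 => h; apply: submx_trans h _; rewrite addsmx_sub submx_refl sub0mx.
  move=> /rowV0Pn[x xP /scale[c c0 e]]; exists (c *: x); apply/KE.
  by rewrite scalemx_sub.
have [x xK xm] := rV_min clK bK (@continuous_quad _ _ (- (symA *m gram N A))) yK.
have qE z : (z *m - (symA *m gram N A) *m z^T) 0 0 = - dotG (z *m symA) z.
  by rewrite mulmxN mulNmx mxE mulmxA.
pose lam := dotG (x *m symA) x.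
have lmax z : (z <= perp F)%MS -> dotG (z *m symA) z <= lam * dotG z z.
  move=> zP; have [->|/scale[c c0 e]] := eqVneq z 0.
    by rewrite mul0mx !dotG0 mulr0.
  have := xm (c *: z); rewrite !qE lerN2 => h.
  have {}h : dotG (c *: z *m symA) (c *: z) <= lam by apply: h; apply/KE; rewrite scalemx_sub.
  move: h e; rewrite -scalemxAl !dotGZl !dotGZr !mulrA => h e.
  have c2 : 0 < c * c by rewrite -expr2 exprn_even_gt0.
  by rewrite -(ler_pM2l c2) [X in _ <= X]mulrCA e mulr1.
have [xP d1] := (KE x).1 xK.
have ex := rayleigh_eigen N_gt0 A_order hF lmax xP (esym (etrans (congr1 _ d1) (mulr1 _))).
exists lam; split=> //; exists x; first by rewrite topspaceE xP ex eqxx.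
apply/eqP => x0; move: d1; rewrite x0 dotG0 => /eqP.
by rewrite eq_sym oner_eq0.
Qed.

End TopEigenvalue.

(** * Flows and residues of alcoves *)

Lemma count_lt (T : eqType) (s : seq T) (p q : pred T) a :
  {in s, forall b, q b -> p b} -> a \in s -> p a -> ~~ q a -> (count q s < count p s)%N.
Proof.
elim: s => // b s IH h; rewrite inE => /predU1P[<-|aS] pa qa /=.
  rewrite pa (negPf qa) add0n add1n ltnS.
  have -> : count q s = count (predI q p) s.
    apply: eq_in_count => x xs /=; case qx: (q x) => //=.
    by rewrite h // inE xs orbT.
  by apply: sub_count => x /andP[].
have hs : {in s, forall b, q b -> p b} by move=> x xs; apply: h; rewrite inE xs orbT.
rewrite -addnS leq_add //; last exact: IH.
by have := h b (mem_head _ _); case: (q b) => [->|].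
Qed.

Lemma sum_lt (I : eqType) (s : seq I) (f1 f2 : I -> nat) i :
  {in s, forall j, (f1 j <= f2 j)%N} -> i \in s -> (f1 i < f2 i)%N ->
  (\sum_(j <- s) f1 j < \sum_(j <- s) f2 j)%N.
Proof.
move=> le12 iS lt12; rewrite !(big_rem i iS) /= -addSn leq_add //.
rewrite big_seq [X in (_ <= X)%N]big_seq; apply: leq_sum => j jS.
by apply: le12; apply: mem_rem jS.
Qed.

Lemma eventually_all (I : eqType) (s : seq I) (P : I -> nat -> Prop) :
  {in s, forall i, exists m, forall k, (m <= k)%N -> P i k} ->
  exists m, {in s, forall i, P i m}.
Proof.
move=> h; suff [m hm] : exists m, {in s, forall i, forall k, (m <= k)%N -> P i k}.
  by exists m => i iS; apply: hm.
elim: s h => [|i s IH] h; first by exists 0%N.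
have [m1 h1] := h i (mem_head _ _).
have [|m2 h2] := IH; first by move=> j jS; apply: h; rewrite inE jS orbT.
exists (maxn m1 m2) => j; rewrite inE => /predU1P[->|jS] k; rewrite geq_max => /andP[k1 k2].
  exact: h1.
exact: h2.
Qed.

Lemma intP (R : realDomainType) (x : R) : (exists k : int, x = k%:~R) \/ (forall k : int, x != k%:~R).
Proof.
have [h|h] := EM (exists k : int, x = k%:~R); [by left | right => k].
by apply/eqP => e; apply: h; exists k.
Qed.

Section Flow.
Variables (R : realType) (n : nat).
Variables (Phi : seq 'rV[int]_n) (cor : 'rV[int]_n -> 'rV[int]_n)
          (xi : 'rV[int]_n) (Om : seq 'M[int]_n) (x0 : 'rV[rat]_n).
Hypothesis hRD : root_datum Phi cor.
Hypothesis hOm : diagram_group Phi cor xi Om.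
Hypothesis hxi : regular Phi xi.
Hypothesis hx0 : in_fund_alcove Phi xi x0.
Variables (H : algType K) (T : aff n -> H).
Hypothesis hbasis : is_basis Phi cor Om T.
Hypothesis hrel : hecke_rel Phi cor xi Om x0 T.
Variables (w : aff n) (N : nat).
Hypothesis wW : inWt Phi cor Om w.
Hypothesis N_gt0 : (0 < N)%N.
Hypothesis w_order : w.1 ^+ N = 1%:M.
Implicit Types (a b : 'rV[int]_n) (g h s : aff n) (x y z p P u : 'rV[R]_n) (X F : 'M[R]_n).
Implicit Types (B : 'rV[int]_n -> int -> Prop).

Notation Wt := (inWt Phi cor Om).
Notation flg := (flg R x0).
Notation cl := (cl Phi x0).
Notation adj := (adj R Phi x0).
Notation simple := (simple R Phi cor xi Om x0).
Notation reach := (reach R Phi cor xi Om x0).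
Notation A := (map_mx intr w.1 : 'M[R]_n).
Notation dotG := (dotG N A).
Notation Ainv := (Ainv N A).

Lemma A_order : A ^+ N = 1%:M.
Proof.
rewrite -[RHS](map_mx1 (intmul 1)) -w_order; elim: N => [|k IH].
  by rewrite !expr0 map_mx1.
by rewrite !exprS -[A * _]/(A *m _) IH -map_mxM.
Qed.
Let A_ord := A_order.

Lemma map_winv : map_mx intr (invmx w.1) = Ainv.
Proof.
have uw := inWt_unit hRD hOm wW.
rewrite -[LHS]mulmx1 -(mulAV N_gt0 A_ord) mulmxA -map_mxM mulVmx // map_mx1 mul1mx //.
Qed.

(** [P] is on the same side as [p] of each hyperplane that avoids [p]; those through [p] impose
    nothing. *)
Definition nearp p P := {in Phi, forall a, forall k : int,
  (k%:~R < rp a p -> k%:~R < rp a P) /\ (rp a p < k%:~R -> rp a P < k%:~R)}.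

(** Levels are integers, so each of the finitely many roots has a positive gap between its value at
    [p] and all other levels. *)
Lemma near_small p : small (fun d => forall u, dotG u u <= d ^+ 2 -> nearp p (p + u)).
Proof.
have gap (r : R) : exists2 d, 0 < d & forall k : int,
    (k%:~R < r -> k%:~R + d <= r) /\ (r < k%:~R -> r + d <= k%:~R).
  have /andP[f1 f2] := floor_itv r; rewrite intrD in f2; set f := Num.floor r in f1 f2.
  have [e|ne] := eqVneq (f%:~R) r.
    exists 1 => // k; rewrite -e !ltr_int; split=> h.
      have : k + 1 <= f by lia.
      by rewrite -(ler_int R) intrD.
    have : f + 1 <= k by lia.
    by rewrite -(ler_int R) intrD.
  have f1' : f%:~R < r by rewrite lt_def eq_sym ne.
  exists (Order.min (r - f%:~R) (f%:~R + 1 - r)); first by rewrite lt_min !subr_gt0 f1'.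
  move=> k; split=> h.
    have kf : k%:~R <= f%:~R :> R by rewrite ler_int /f floor_ge_int ltW.
    have : Order.min (r - f%:~R) (f%:~R + 1 - r) <= r - f%:~R by rewrite ge_min lexx.
    lra.
  have kf : f%:~R + 1 <= k%:~R :> R.
    rewrite -[1](rmorph1 (intmul 1)) -rmorphD ler_int.
    have : f%:~R < k%:~R :> R by apply: le_lt_trans h.
    by rewrite ltr_int; lia.
  have : Order.min (r - f%:~R) (f%:~R + 1 - r) <= f%:~R + 1 - r by rewrite ge_min lexx orbT.
  lra.
suff : small (fun d : R => {in Phi, forall a, forall u, dotG u u <= d ^+ 2 -> forall k : int,
  (k%:~R < rp a p -> k%:~R < rp a (p + u)) /\ (rp a p < k%:~R -> rp a (p + u) < k%:~R)}).
  by apply: small_imp => d _ h u hu a aP; apply: h.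
apply: small_all => a aP; have [e e0 he] := gap (rp a p).
apply: small_imp (small_lt (\sum_i `|(a 0 i)%:~R|) e0) => d d0; rewrite add0r => de u hu k.
have ru : `|rp a u| < e.
  apply: le_lt_trans de; rewrite mulr_sumr; apply: le_trans (ler_norm_sum _ _ _) _.
  apply: ler_sum => i _; rewrite normrM mulrC ler_wpM2r //.
  rewrite -ler_sqr ?nnegrE ?normr_ge0 ?(ltW d0) // real_normK ?num_real //.
  exact (le_trans (coord_le A N_gt0 u i) hu).
have := he k; rewrite rpD; move: ru; rewrite ltr_norml => /andP[r1 r2] [h1 h2].
split=> [/h1|/h2]; lra.
Qed.

Lemma near_cl p P g : nearp p P -> cl P g -> cl p g.
Proof.
move=> np cP a aP; rewrite leNgt; apply/negP => h.
have := (np a aP (flg g a)).2 h; rewrite ltNge => /negP; apply; exact: cP.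
Qed.

Lemma near_int p P a (k : int) : nearp p P -> a \in Phi -> rp a P = k%:~R -> rp a p = k%:~R.
Proof.
move=> np aP e; have [h1 h2] := np a aP k; move: h1 h2; rewrite e ltxx.
by case: ltgtP => // _ h1 h2; [move: (h1 isT) | move: (h2 isT)].
Qed.

(** Each crossing removes a root that blocks [d] and creates none, because the opposite root grows
    along [d]. [Rl] is abstract so as to cover both [reach] and [eqv]. *)
Lemma cross_all P (d : 'rV[R]_n) (Rl : aff n -> aff n -> Prop) :
  (forall g, Rl g g) -> (forall g1 g2 g3, Rl g1 g2 -> Rl g2 g3 -> Rl g1 g3) ->
  (forall g a s, Wt g -> a \in Phi -> simple s -> adj g a (amul g s) -> cl P g ->
     cl P (amul g s) -> rp a P = (flg g a)%:~R -> rp a d < 0 -> Rl g (amul g s)) ->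
  forall g, Wt g -> cl P g -> exists g2,
    [/\ Wt g2, Rl g g2, cl P g2 & {in Phi, forall a, rp a P = (flg g2 a)%:~R -> 0 <= rp a d}].
Proof.
move=> rR tR hR g; pose bad g a := (rp a P == (flg g a)%:~R) && (rp a d < 0).
have [m] := ubnP (count (bad g) Phi); elim: m => // m IH in g *.
rewrite ltnS => cm gW cg.
have [/hasP[a0 a0P /andP[/eqP e0 d0]]|/hasPn h] := boolP (has (bad g) Phi); last first.
  exists g; split=> // a aP e; rewrite leNgt; apply/negP => da.
  by have := h a aP; rewrite /bad e eqxx da.
have [a [s [aP ea da sS [ss ad cs]]]] := wall_at hRD hOm hxi hx0 gW cg a0P e0 d0.
have sSim := simpleP hRD hOm gW aP sS ss ad.
have gsW := inWtM gW (simple_Wt sSim).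
have st := hR g a s gW aP sSim ad cg cs ea da.
have [|g2 [g2W r2 c2 h2]] := IH (amul g s) _ gsW cs; last by exists g2; split=> //; apply: tR r2.
apply: leq_trans cm; apply: (count_lt (a := a)) => //.
- move=> b bP /andP[/eqP eb db]; rewrite /bad db andbT.
  case: ad => ad1 ad2; have [->|ba] := eqVneq b a; first by rewrite ea.
  have [bNa|bNa] := eqVneq b (- a); last by rewrite -(ad2 b bP ba bNa) eb.
  by move: db; rewrite bNa rpNl; lra.
- by rewrite /bad ea eqxx.
rewrite /bad negb_and; apply/orP; left; case: ad => -> _; rewrite ea.
by rewrite eqr_int; lia.
Qed.

Lemma step_lt p g a k : cl p g -> a \in Phi -> rp a (ract w p) < k%:~R ->
  flg (amul w g) a < k.
Proof.
move=> cg aP h; rewrite -(ltr_int R); apply: le_lt_trans h.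
exact: (cl_ract hRD hOm wW cg).
Qed.

Lemma step_ltV p g a k : cl p g -> a \in Phi -> rp a (ract (ainv w) p) < k%:~R ->
  flg (amul (ainv w) g) a < k.
Proof.
move=> cg aP h; rewrite -(ltr_int R); apply: le_lt_trans h.
exact: (cl_ract hRD hOm (inWtV hRD hOm wW) cg).
Qed.

(* A closed alcove containing a point near [q] contains [q] itself. *)
Lemma closed_reach B g P0 : closed [set u | exists2 g1, reach B w g g1 & cl (P0 + u) g1]%classic.
Proof.
rewrite -openC openE => u /= nu.
have [d d0 hd] := small_ex (near_small (P0 + u)).
have cf : continuous (fun v : 'rV[R]_n => dotG (v - u) (v - u)).
  move=> v; apply: (@cvg_comp _ _ _ (fun v => v - u) (fun v => dotG v v) (nbhs v) (nbhs (v - u)));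
    last exact: continuous_quad.
  by apply: cvgB; [exact: cvg_id | exact: cvg_cst].
have /cvgr_lt h := cf u.
have : \forall v \near u, dotG (v - u) (v - u) < d ^+ 2.
  by apply: h; rewrite subrr dotG0 exprn_gt0.
apply: filterS => v hv [g1 r1 c1]; apply: nu; exists g1 => //.
apply: near_cl c1; have -> : P0 + v = P0 + u + (v - u) by rewrite -addrA (addrC u) subrK.
by apply: hd; apply: ltW.
Qed.

(* [D] is the direction field of the flow: at a closest reachable point [P0 + u] with
   [u <> 0], cross all walls that block the direction [u D] and move a little further. *)
Lemma flow B (U D : 'M[R]_n) P0 r :
  (forall u, (u <= U)%MS -> (u *m D <= U)%MS) ->
  (forall u, (u <= U)%MS -> u != 0 -> dotG (u *m D) u < 0) ->
  (forall u, (u <= U)%MS -> dotG u u <= r -> {in Phi, forall a, forall k : int,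
     rp a (P0 + u) = k%:~R -> rp a (u *m D) < 0 ->
     B a k /\ (rp a (ract w (P0 + u)) < k%:~R \/ rp a (ract (ainv w) (P0 + u)) < k%:~R)}) ->
  forall g u0, Wt g -> (u0 <= U)%MS -> dotG u0 u0 <= r -> cl (P0 + u0) g ->
  exists2 g1, reach B w g g1 & cl P0 g1.
Proof.
move=> UD negD hB g u0 gW u0U u0r c0.
pose Y := [set u | exists2 g1, reach B w g g1 & cl (P0 + u) g1]%classic.
have [C CE] : exists C : 'M[R]_n, forall u, (u <= U)%MS = (u *m C == 0).
  by exists (cokermx U) => u; rewrite submxE.
pose K0 : set 'rV[R]_n := [set u | (u *m (C *m C^T) *m u^T) 0 0 = 0 /\ dotG u u <= r]%classic.
have UE (u : 'rV[R]_n) : (u <= U)%MS <-> (u *m (C *m C^T) *m u^T) 0 0 = 0.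
  rewrite CE mulmxA -(mulmxA (u *m C)) -trmx_mul mxE; split=> [/eqP e|].
    by rewrite big1 // => i _; rewrite e mxE mul0r.
  move/eqP; rewrite psumr_eq0 => [/allP h|j _]; last by rewrite [X in _ * X]mxE -expr2 sqr_ge0.
  apply/eqP/rowP => i; rewrite [RHS]mxE.
  by have := h i (mem_index_enum i); rewrite /= [X in _ * X]mxE -expr2 sqrf_eq0 => /eqP.
have clK : closed (K0 `&` Y)%classic.
  apply: closedI; last exact: closed_reach.
  apply: closedI.
    apply: (@closed_comp _ _ (fun x : 'rV[R]_n => (x *m (C *m C^T) *m x^T) 0 0) [set x | x = 0]%classic).
      by move=> x _; apply: continuous_quad.
    exact: closed_eq.
  apply: (@closed_comp _ _ (fun x : 'rV[R]_n => dotG x x) [set x | x <= r]%classic).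
    by move=> x _; apply: continuous_quad.
  exact: closed_le.
have bK x : (K0 `&` Y)%classic x -> forall i, `|x 0 i| <= 1 + r.
  move=> [[_ h] _] i; have hx := le_trans (coord_le A N_gt0 x i) h.
  have r0 : 0 <= r by apply: le_trans h; apply: dotG_ge0.
  rewrite -ler_sqr ?nnegrE ?normr_ge0 ?addr_ge0 // real_normK ?num_real //.
  by apply: le_trans hx _; nra.
have K0u : (K0 `&` Y)%classic u0.
  by split; [split=> //; apply/UE | exists g => //; apply: reach_refl].
have [u [[/UE uU ur] [g1 r1 c1]] um] := rV_min clK bK (@continuous_quad _ _ (gram N A)) K0u.
have [u_eq0|u_neq0] := eqVneq u 0; first by exists g1 => //; move: c1; rewrite u_eq0 addr0.
exfalso.
have g1W := reach_Wt r1 gW.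
have [|||g2 [g2W r2 c2 h2]] := cross_all (P := P0 + u) (d := u *m D) (Rl := reach B w) _ _ _ g1W c1.
- exact: reach_refl.
- exact: reach_trans.
- move=> h a s hW aP sS ad ch chs ea da.
  have [Ba hl] := hB u uU ur a aP _ ea da.
  apply: reach1; exists a, s; split; first by split.
  by apply/orP; case: hl => hl; [left; apply: step_lt hl | right; apply: step_ltV hl].
have s1 : small (fun d : R => cl (P0 + (u + d *: (u *m D))) g2).
  apply: small_all => a aP; have := c2 a aP; rewrite le_eqVlt => /predU1P[e|lt].
    exists 1 => // d d0 _; rewrite addrA rpD rpZ -e lerDl.
    by apply: mulr_ge0; [exact: ltW | exact: (h2 a aP (esym e))].
  by apply: small_imp (small_gt (rp a (u *m D)) lt) => d _ h; rewrite addrA rpD rpZ; apply: ltW h.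
(* This is the derivative of the squared norm at [u] in the direction [u *m D]; its sign yields a
   closer reachable point and contradicts [um]. *)
have n0 : 2 * dotG (u *m D) u < 0 by rewrite pmulr_rlt0 // negD.
have [d d0 [cd nd]] := small_ex (small_and s1 (small_lt (dotG (u *m D) (u *m D)) n0)).
have lt : dotG (u + d *: (u *m D)) (u + d *: (u *m D)) < dotG u u.
  rewrite dotGDl !dotGDr !dotGZl !dotGZr (dotGC _ _ u).
  set q := dotG (u *m D) (u *m D) in nd *; set m := dotG (u *m D) u in nd *.
  have : d * (2 * m + d * q) < 0 by rewrite pmulr_rlt0.
  lra.
suff KY : (K0 `&` Y)%classic (u + d *: (u *m D)).
  by have := um _ KY; rewrite leNgt => /negP; apply.
split; last by exists g2 => //; apply: reach_trans r1 r2.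
split; last by apply: le_trans (ltW lt) ur.
by apply/UE; rewrite addmx_sub // scalemx_sub // UD.
Qed.

Notation eqv := (eqv Phi cor xi Om x0 T).
Notation terminal := (terminal R Phi cor xi Om x0).
Notation len := (lw Phi xi x0).
Notation perp := (perp N A).
Notation symA := (symA N A).
Notation pproj := (pproj N A).

(** Neither crossing can increase the length and together they return to [g], so neither decreases
    it. *)
Lemma two_way g a s : Wt g -> a \in Phi -> simple s -> adj g a (amul g s) ->
  (flg (amul w g) a < flg g a) || (flg (amul (ainv w) g) a < flg g a) ->
  (flg (amul w (amul g s)) (- a) < flg (amul g s) (- a)) ||
    (flg (amul (ainv w) (amul g s)) (- a) < flg (amul g s) (- a)) ->
  eqv w g (amul g s).
Proof.
move=> gW aP sS ad h1 h2; have gsW := inWtM gW (simple_Wt sS).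
case: (step_conj hRD hOm hxi hx0 hrel wW gW aP sS ad h1) => // -[l1 _].
have aNP := root_opp hRD aP.
have ad' : adj (amul g s) (- a) (amul (amul g s) s).
  by rewrite (simpleK g sS); exact: (adj_sym hRD hOm hxi hx0 gW gsW aP ad).
case: (step_conj hRD hOm hxi hx0 hrel wW gsW aNP sS ad' h2).
  by rewrite (simpleK g sS) => /eqv_sym.
by rewrite (simpleK g sS) => -[l2 _]; move: (ltn_trans l1 l2); rewrite ltnn.
Qed.

(** Equal alcoves do not make the elements equal: they may differ by an element of length zero,
    which is a strong conjugation. *)
Lemma eqv_flg g h : Wt g -> Wt h -> {in Phi, flg g =1 flg h} -> eqv w g h.
Proof.
move=> gW hW e; have wgW := inWtM wW gW; have whW := inWtM wW hW.
apply: (strong_conj R hRD hOm hxi hx0 hbasis hrel wW gW hW).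
  by apply: (dl_add (R := R) hRD hOm hxi hx0 hW gW wgW) => a aP; rewrite (e a aP); lia.
apply: (dl_add (R := R) hRD hOm hxi hx0 hW whW wgW) => a aP.
have -> : flg (amul w g) a = flg (amul w h) a.
  by rewrite !flgM e //; apply: (W0ext_root hRD hOm wW).
by lia.
Qed.

Lemma cl_diff p g g' a : Wt g' -> cl p g -> cl p g' -> a \in Phi -> flg g' a < flg g a ->
  rp a p = (flg g a)%:~R.
Proof.
move=> g'W cg cg' aP h; apply/le_anti; rewrite (cg a aP) andbT.
apply: le_trans (cl_le hRD hOm hxi hx0 g'W cg' aP) _.
by rewrite -[1](rmorph1 (intmul 1)) -rmorphD ler_int; lia.
Qed.

(** * The residue of alcoves at a point *)

Definition hyp_at p a (k : int) := rp a p = k%:~R.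

(** Local uniqueness: both the alcoves and the paths that test terminality stay at [p]. *)
Definition residue_conj p := forall g g', Wt g -> Wt g' -> cl p g -> cl p g' ->
  terminal (hyp_at p) w g -> terminal (hyp_at p) w g' -> eqv w g g'.

Lemma reach_cl p g g' : reach (hyp_at p) w g g' -> Wt g -> cl p g -> cl p g'.
Proof.
elim=> // h h1 h2 [a [s [[aP sS -> ad ea] hs]]] _ IH hW ch.
have hsW := inWtM hW (simple_Wt sS).
by apply: IH => //; apply: (adj_cl hRD hOm hxi hx0 hW hsW aP ad).
Qed.

(* Terminality need not pass from [p] to [q]; the two inequalities between lengths do. *)
Lemma residue_transfer p q : residue_conj p -> residue_conj q ->
  (forall g, Wt g -> cl p g -> exists h, [/\ Wt h, cl q h & eqv w g h]) ->
  (forall h, Wt h -> cl q h -> exists g, [/\ Wt g, cl p g & eqv w h g]) ->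
  forall g h, Wt g -> Wt h -> cl p g -> cl q h ->
  terminal (hyp_at p) w g -> terminal (hyp_at q) w h -> eqv w g h.
Proof.
move=> Qp Qq pq qp.
have half p' q' : residue_conj q' ->
    (forall g, Wt g -> cl p' g -> exists h, [/\ Wt h, cl q' h & eqv w g h]) ->
    forall g h, Wt g -> Wt h -> cl p' g -> cl q' h -> terminal (hyp_at q') w h ->
    (len (cj w h) <= len (cj w g))%N /\ (len (cj w h) = len (cj w g) -> eqv w g h).
  move=> Q' pq' g h gW hW cg ch th.
  have [h2 [h2W ch2 [e1 e2]]] := pq' g gW cg.
  have [h3 r3 t3] := exists_terminal R hRD hOm hxi hx0 hrel (hyp_at q') wW h2W.
  have h3W := reach_Wt r3 h2W.
  have e3 := Q' _ _ h3W hW (reach_cl r3 h2W ch2) ch t3 th.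
  case: (reachP hRD hOm hxi hx0 hrel wW h2W r3) => [e4|[l4 _]].
    have e5 : eqv w g h by apply: eqv_trans (conj e1 e2) (eqv_trans e4 e3).
    by split=> [|//]; case: e5 => _ ->.
  case: e3 => _ e3; rewrite e2 -e3; split=> [|e]; first exact: ltnW.
  by move: l4; rewrite e ltnn.
move=> g h gW hW cg ch tg th.
have [l1 i1] := half p q Qq pq g h gW hW cg ch th.
have [l2 i2] := half q p Qp qp h g hW gW ch cg tg.
by apply: i1; apply/eqP; rewrite eqn_leq l1 l2.
Qed.

Definition kills a X := forall x, (x <= X)%MS -> rp a x = 0.

Lemma killsP a X : kills a X \/ exists2 x, (x <= X)%MS & rp a x != 0.
Proof.
have [k|nk] := EM (kills a X); [by left | right].
by apply: contrapT => h; apply: nk => x xX; apply/eqP; apply: contrapT => /negP nz; apply: h; exists x.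
Qed.

Lemma kills_add a X (Y : 'M[R]_n) : kills a X -> kills a Y -> kills a (X + Y)%MS.
Proof.
move=> kX kY x /sub_addsmxP[[D1 D2] /= ->].
by rewrite rpD kX ?kY ?submxMl // addr0.
Qed.

(** A root with a hyperplane through [p] would vanish on everything, even on its own coroot. So [p]
    lies in a single alcove. *)
Lemma residue_full p F : row_full F ->
  {in Phi, forall a, forall k : int, rp a p = k%:~R -> kills a F} -> residue_conj p.
Proof.
move=> fF kF g g' gW g'W cg cg' _ _; apply: eqv_flg => //.
have [//|[a aP lt]] := flg_diff R hRD hOm hxi hx0 gW g'W.
have := kF a aP _ (cl_diff g'W cg cg' aP lt) (map_mx intr (cor a)) (submx_full _ fF).
by rewrite rp_int (root_cor hRD aP) => /eqP; rewrite intr_eq0.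
Qed.

Lemma ract_wE P p : ract w P = ract w p + (P - p) *m A.
Proof. by rewrite -[LHS](subrK (ract w p)) ract_sub addrC. Qed.

Lemma ract_wVE P p : ract (ainv w) P = ract (ainv w) p + (P - p) *m Ainv.
Proof. by rewrite -[LHS](subrK (ract (ainv w) p)) ract_sub /= map_winv addrC. Qed.

(** * Residues modulo a [w]-stable subspace on which every root through [p] vanishes *)

Section Flag.
Variables (p : 'rV[R]_n) (F : 'M[R]_n).
Hypothesis F_stable : (F *m A <= F)%MS.
Hypothesis F_disp : (ract w p - p <= F)%MS.
Hypothesis F_kills : {in Phi, forall a, forall k : int, rp a p = k%:~R -> kills a F}.

Lemma disp_inv : (ract (ainv w) p - p <= F)%MS.
Proof.
have uw := inWt_unit hRD hOm wW.
have -> : ract (ainv w) p - p = - ((ract w p - p) *m Ainv).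
  have := ract_wVE (ract w p) p; rewrite (ractKV _ uw) => {2}->.
  by rewrite opprD addNKr.
rewrite eqmx_opp; apply: submx_trans (stable_inv N F_stable).
exact: submxMr.
Qed.

(** Roots through [p] do not see [F], hence not the displacement [w p - p]: for them [w] acts as if
    it fixed [p]. *)
Lemma rp_near_flag a (k : int) v : a \in Phi -> rp a p = k%:~R ->
  rp a (ract w (p + v)) = k%:~R + rp a (v *m A) /\
  rp a (ract (ainv w) (p + v)) = k%:~R + rp a (v *m Ainv).
Proof.
move=> aP e; have kF := F_kills aP e.
have ev : p + v - p = v by rewrite addrAC subrr add0r.
have D1 : rp a (ract w p) = k%:~R.
  by rewrite -[ract w p](subrK p) [LHS]rpD (kF _ F_disp) add0r.
have D2 : rp a (ract (ainv w) p) = k%:~R.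
  by rewrite -[ract (ainv w) p](subrK p) [LHS]rpD (kF _ disp_inv) add0r.
by rewrite (ract_wE _ p) (ract_wVE _ p) ev [X in X = _]rpD [X in _ /\ X = _]rpD D1 D2.
Qed.

(** For roots through [p], [w] negates the offset from [p], so each wall at [p] separates its alcove
    from the image under [w], before and after the crossing. Thus all crossings preserve the class,
    and those along [pt R x0 g' - p] end in the alcove of [g']. *)
Lemma residue_inversion : (forall x, (x <= perp F)%MS -> x *m A = - x) -> residue_conj p.
Proof.
move=> AN g g' gW g'W cg cg' _ _.
have key h a : Wt h -> a \in Phi -> rp a p = (flg h a)%:~R -> flg (amul w h) a < flg h a.
  move=> hW aP e; have kF := F_kills aP e.
  rewrite -(ltr_int R); apply: (@le_lt_trans _ _ (rp a (pt R x0 (amul w h)))).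
    exact: (@cl_pt R n Phi x0 (amul w h) a aP).
  rewrite /pt ractM -/(pt R x0 h) -[pt R x0 h](subrK p) [X in ract w X]addrC.
  have [-> _] := rp_near_flag (pt R x0 h - p) aP e.
  set z := _ - p; have zE : z *m A = (z *m pproj F) *m A - (z - z *m pproj F).
    rewrite -(AN (z - z *m pproj F)) ?(pproj_compl A N_gt0) //.
    by rewrite -mulmxDl [_ + (z - _)]addrC subrK.
  have k1 : rp a (z *m pproj F) = 0 by apply: kF; apply: pproj_sub.
  have k2 : rp a (z *m pproj F *m A) = 0.
    by apply: kF; apply: (stable_row F_stable); apply: pproj_sub.
  have kz : rp a (z *m A) = - rp a z.
    by rewrite zE [LHS]rpB k2 [X in _ - X]rpB k1 subr0 sub0r.
  have rz : rp a z = rp a (pt R x0 h) - (flg h a)%:~R by rewrite [LHS]rpB e.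
  rewrite kz rz gtrDl oppr_lt0 subr_gt0.
  exact: (flg_lt R hRD hOm hxi hx0 hW aP).
have [|||g2 [g2W r2 c2 h2]] := cross_all (P := p) (d := pt R x0 g' - p) (Rl := eqv w) _ _ _ gW cg.
- exact: eqv_refl.
- by move=> g1 g2 g3; apply: eqv_trans.
- move=> h a s hW aP sS ad ch chs ea da; have hsW := inWtM hW (simple_Wt sS).
  apply: (two_way hW aP sS ad); first by rewrite (key h a hW aP ea).
  rewrite (key (amul h s) (- a)) ?(root_opp hRD) //.
  have [h1 _] := adj_sym hRD hOm hxi hx0 hW hsW aP ad.
  by rewrite rpNl ea (_ : flg (amul h s) (- a) = - flg h a) ?rmorphN // (flgN R hRD hOm hxi hx0) //; case: ad => -> _; ring.
apply: eqv_trans r2 _; apply: eqv_flg => //.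
have [//|[a aP lt]] := flg_diff R hRD hOm hxi hx0 g2W g'W.
have e := cl_diff g'W c2 cg' aP lt.
have := h2 a aP e; rewrite rpB e subr_ge0 leNgt => /negP; case.
apply: lt_le_trans (ltD1_flg _ _ _ _) _.
by rewrite -[1](rmorph1 (intmul 1)) -rmorphD ler_int; lia.
Qed.

Definition rvec a : 'cV[R]_n := (map_mx intr a)^T.

Lemma rvecE a x : rp a x = (x *m rvec a) 0 0.
Proof. exact: rpE. Qed.

Lemma generic_alcove g q (L : seq 'cV[R]_n) : Wt g ->
  exists y, {in Phi, forall a, (flg g a)%:~R < rp a y} /\
    {in L, forall c, c != 0 -> ((y - q) *m c) 0 0 != 0}.
Proof.
move=> gW; have [|z hz] := @generic_vector _ _ [seq c <- L | c != 0].
  by move=> c; rewrite mem_filter => /andP[].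
have s1 : small (fun d : R => {in Phi, forall a, (flg g a)%:~R < rp a (pt R x0 g + d *: z)}).
  apply: small_all => a aP.
  apply: small_imp (small_gt (rp a z) (flg_lt R hRD hOm hxi hx0 gW aP)) => d _ h.
  by rewrite [X in _ < X]rpD rpZ.
have s2 : small (fun d : R => {in L, forall c, c != 0 -> ((pt R x0 g + d *: z - q) *m c) 0 0 != 0}).
  apply: small_all => c cL; have [->|c0] := eqVneq c 0; first by exists 1.
  have cL' : c \in [seq c <- L | c != 0] by rewrite mem_filter c0.
  apply: small_imp (small_neq0 (((pt R x0 g - q) *m c) 0 0) (hz c cL')) => d _ h _.
  by rewrite addrAC mulmxDl -scalemxAl mxE [X in _ + X]mxE.
have [d _ [h1 h2]] := small_ex (small_and s1 s2).
by exists (pt R x0 g + d *: z).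
Qed.

Section Spread.
Variable lam : R.
Hypothesis lam_max : forall x, (x <= perp F)%MS -> dotG (x *m symA) x <= lam * dotG x x.
Notation E := (topspace N A F lam).
Notation FE := (F + E)%MS.

(** The component in [E] for the orthogonal decomposition into [F], [E] and [perp FE]; [rest] is the
    component in [perp FE]. *)
Definition Pi : 'M[R]_n := pproj FE *m (1%:M - pproj F).
Definition rest x := x - x *m pproj FE.

Lemma PiE x : x *m Pi = x *m pproj FE - x *m pproj FE *m pproj F.
Proof. by rewrite /Pi mulmxA mulmxBr mulmx1. Qed.

Lemma top_perp x : (x <= E)%MS -> (x <= perp F)%MS.
Proof. by rewrite topspaceE => /andP[]. Qed.

Lemma top_symA x : (x <= E)%MS -> x *m symA = lam *: x.
Proof. by rewrite topspaceE => /andP[_ /eqP]. Qed.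

Lemma Pi_sub x : (x *m Pi <= E)%MS.
Proof.
rewrite PiE; have /sub_addsmxP[[D1 D2] /= ->] := pproj_sub N A FE x.
rewrite mulmxDl (pproj_id A N_gt0) ?submxMl // (pproj_perp N_gt0); last first.
  by apply: top_perp; apply: submxMl.
by rewrite addr0 addrAC subrr add0r submxMl.
Qed.

Lemma Pi_id x : (x <= E)%MS -> x *m Pi = x.
Proof.
move=> xE; rewrite PiE (pproj_id A N_gt0); last by apply: submx_trans xE (addsmxSr _ _).
by rewrite (pproj_perp N_gt0) ?subr0 //; apply: top_perp.
Qed.

Lemma rest_sub x : (rest x <= perp FE)%MS.
Proof. exact: (pproj_compl A N_gt0). Qed.

Lemma rp_split a x : kills a F -> rp a x = rp a (x *m Pi) + rp a (rest x).
Proof.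
move=> kF; rewrite PiE !rpB (kF (x *m pproj FE *m pproj F)) ?(pproj_sub N A) //.
by rewrite subr0 addrC subrK.
Qed.

Lemma FE_stable : (FE *m A <= FE)%MS.
Proof. by rewrite addsmxMr addsmxS // (topspace_stable N_gt0 A_ord). Qed.

Lemma rp_symA a (k : int) v : a \in Phi -> rp a p = k%:~R ->
  rp a (ract w (p + v)) + rp a (ract (ainv w) (p + v)) = 2 * k%:~R + rp a (v *m symA).
Proof.
move=> aP e; have [-> ->] := rp_near_flag v aP e.
by rewrite mulmxDr [X in _ = _ + X]rpD; ring.
Qed.

(** A flow from [p + eta *: (e + u)] to [p + eta *: e], with direction [symA - lam%:M], negative
    definite on [perp FE]. Nearness to [p] keeps all crossed hyperplanes through [p]. *)
Lemma local_flow g y eta (e := (y - p) *m Pi) (u := rest (y - p)) :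
  Wt g -> cl p g -> {in Phi, forall a, (flg g a)%:~R < rp a y} -> 0 < eta ->
  (forall v, dotG v v <= eta ^+ 2 * (dotG e e + dotG u u) -> nearp p (p + v)) ->
  exists2 g1, reach (hyp_at p) w g g1 & cl (p + eta *: e) g1.
Proof.
move=> gW cg hy eta0 near.
have eE : (e <= E)%MS by apply: Pi_sub.
have eFE : (e <= FE)%MS by apply: submx_trans eE (addsmxSr _ _).
have uU : (u <= perp FE)%MS by apply: rest_sub.
have e2 : 0 < eta ^+ 2 by rewrite exprn_gt0.
have norm v : (v <= perp FE)%MS -> dotG (eta *: e + v) (eta *: e + v) = eta ^+ 2 * dotG e e + dotG v v.
  move=> vU; rewrite dotGDl !dotGDr !dotGZl !dotGZr (dotGC _ _ e v) (perpP vU eFE).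
  by ring.
apply: (flow (U := perp FE) (D := symA - lam%:M) (r := eta ^+ 2 * dotG u u) _ _ _ (u0 := eta *: u)) => //.
- move=> v vU; rewrite mulmxBr mul_mx_scalar addmx_sub ?(symA_perp N_gt0 A_ord FE_stable) //.
  by rewrite eqmx_opp scalemx_sub.
- by move=> v vU v0; apply: (topspace_neg N_gt0 A_ord F_stable lam_max vU v0).
- move=> v vU vr a aP k ea va.
  rewrite -addrA in ea *; set z := eta *: e + v in ea *.
  have np : nearp p (p + z).
    by apply: near; rewrite /z norm // mulrDr lerD2l.
  have ep := near_int np aP ea.
  split=> //; have := rp_symA z aP ep.
  have z0 : rp a z = 0 by move: ea; rewrite [LHS]rpD ep -[RHS]addr0 => /addrI.
  (* Since [a] vanishes at [z], only the flow direction is left in the sum of the values at the two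
     images, and [a] is negative on it. *)
  have -> : z *m symA = lam *: z + v *m (symA - lam%:M).
    rewrite /z mulmxDl -scalemxAl (top_symA eE) mulmxBr mul_mx_scalar scalerDr.
    by rewrite -addrA [lam *: v + _]addrC subrK !scalerA mulrC.
  rewrite [X in _ = _ + X]rpD rpZ z0 mulr0 add0r => h.
  by have [?|?] := ltP (rp a (ract w (p + z))) k%:~R; [left | right; lra].
- by rewrite scalemx_sub.
- by rewrite dotGZl dotGZr mulrA -expr2.
move=> a aP; have := cg a aP; rewrite le_eqVlt => /predU1P[e0|lt]; last first.
  rewrite -addrA; have np : nearp p (p + (eta *: e + eta *: u)).
    by apply: near; rewrite norm ?scalemx_sub // dotGZl dotGZr mulrA -expr2 mulrDr.
  by apply: ltW; apply: (np a aP _).1.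
have kF := F_kills aP (esym e0).
rewrite -addrA -scalerDr [X in _ <= X]rpD rpZ [X in _ * X]rpD -rp_split // e0 lerDl.
by rewrite mulr_ge0 ?(ltW eta0) // rpB subr_ge0 -e0 ltW // hy.
Qed.

(* The determinant condition says that the segment from [e1] to [e2] meets no
   codimension two subspace where both [a] and [a o w] vanish; at each crossing the
   values of [a] at [w P] and [w^-1 P] therefore have opposite signs. *)
Lemma path_connect e1 e2 eta g : (e1 <= E)%MS -> (e2 <= E)%MS -> 0 < eta ->
  (forall t, 0 <= t -> t <= 1 -> nearp p (p + eta *: ((1 - t) *: e1 + t *: e2))) ->
  {in Phi, forall a, forall k : int, rp a p = k%:~R -> kills a E \/
     rp a e1 * rp a (e2 *m A) - rp a e2 * rp a (e1 *m A) != 0} ->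
  Wt g -> cl (p + eta *: e1) g -> exists h, [/\ Wt h, cl (p + eta *: e2) h & eqv w g h].
Proof.
move=> e1E e2E eta0 near det gW cg.
pose et t := (1 - t) *: e1 + t *: e2.
pose P t := p + eta *: et t.
have P1 : P 1 = p + eta *: e2 by rewrite /P /et subrr scale0r add0r scale1r.
have rpP a t : rp a (P t) = rp a p + eta * ((1 - t) * rp a e1 + t * rp a e2).
  by rewrite /P /et !rpD !rpZ !rpD !rpZ.
have etE t : (et t <= E)%MS by rewrite addmx_sub ?scalemx_sub.
suff main t : 0 <= t -> t <= 1 -> cl (P t) g -> exists h, [/\ Wt h, cl (P 1) h & eqv w g h].
  rewrite -P1; apply: (main 0) => //.
  by rewrite /P /et subr0 scale1r scale0r addr0.
pose bad g a := rp a (P 1) < (flg g a)%:~R.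
move: t; have [m] := ubnP (count (bad g) Phi); elim: m => // m IH in g gW {cg} *.
rewrite ltnS => cm t t0 t1 cg.
have [/hasP[a0 a0P b0]|/hasPn nb] := boolP (has (bad g) Phi); last first.
  exists g; split=> //; last exact: eqv_refl.
  by move=> a aP; rewrite leNgt; apply: nb.
pose L := [seq a <- Phi | bad g a].
(* The fraction of the remaining segment after which the lower bound for [a] is attained; its least
   value over the bad roots marks the exit from the alcove. *)
pose rho a := (rp a (P t) - (flg g a)%:~R) / (rp a (P t) - rp a (P 1)).
have a0L : a0 \in L by rewrite mem_filter b0.
have [a aL amin] := seq_argmax (fun a => - rho a) a0L.
move: aL; rewrite mem_filter => /andP[ba aP].
have badlt b : b \in Phi -> bad g b -> 0 < rp b (P t) - rp b (P 1).
  by move=> bP bb; rewrite subr_gt0; apply: lt_le_trans (cg b bP).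
have r0 : 0 <= rho a.
  by apply: divr_ge0; [rewrite subr_ge0 cg | exact: ltW (badlt a aP ba)].
have r1 : rho a < 1 by rewrite /rho ltr_pdivrMr ?badlt // mul1r ltrD2l ltrN2.
pose t' := t + rho a * (1 - t).
have t'0 : 0 <= t' by rewrite addr_ge0 // mulr_ge0 // subr_ge0.
have t'1 : t' <= 1 by rewrite /t'; nra.
have rpt' b : rp b (P t') = rp b (P t) - rho a * (rp b (P t) - rp b (P 1)).
  by rewrite !rpP /t'; ring.
have cg' : cl (P t') g.
  move=> b bP; rewrite rpt'; have cb := cg b bP.
  have [bb|nb] := boolP (bad g b); last first.
    by move: nb; rewrite /bad -leNgt => nb; nra.
  have := amin b; rewrite mem_filter bb => /(_ bP); rewrite lerN2 => h.
  have db := badlt b bP bb.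
  have : rho b * (rp b (P t) - rp b (P 1)) = rp b (P t) - (flg g b)%:~R.
    by rewrite mulfVK // gt_eqF.
  have : rho a * (rp b (P t) - rp b (P 1)) <= rho b * (rp b (P t) - rp b (P 1)) by rewrite ler_pM2r.
  lra.
have ea' : rp a (P t') = (flg g a)%:~R.
  by rewrite rpt' mulfVK ?gt_eqF ?badlt // subKr.
have da : rp a (P 1 - P t') < 0 by rewrite rpB ea' subr_lt0.
have [a1 [s [a1P e1' d1 sS [ss ad cs]]]] := wall_at hRD hOm hxi hx0 gW cg' aP ea' da.
have sSim := simpleP hRD hOm gW a1P sS ss ad.
have gsW := inWtM gW (simple_Wt sSim).
have np := near t' t'0 t'1.
have ep := near_int np a1P e1'.
have bad1 : rp a1 (P 1) < (flg g a1)%:~R by move: d1; rewrite rpB e1' subr_lt0.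
have z0 : rp a1 (et t') = 0.
  move: e1'; rewrite /P rpD rpZ ep -[RHS]addr0 => /addrI/eqP.
  by rewrite mulf_eq0 gt_eqF //= => /eqP.
have zA : rp a1 (et t' *m A) != 0.
  have [kE|] := det a1 a1P _ ep.
    by move: bad1; rewrite P1 rpD rpZ (kE _ e2E) mulr0 addr0 ep ltxx.
  apply: contra => /eqP; move: z0; rewrite /et mulmxDl -!scalemxAl !rpD !rpZ.
  move=> h1 h2; apply/eqP.
  set x1 := rp a1 e1 in h1 *; set x2 := rp a1 e2 in h1 *.
  set y1 := rp a1 (e1 *m A) in h2 *; set y2 := rp a1 (e2 *m A) in h2 *.
  (* The weights [1 - t'] in [k1] and [t'] in [k2] add up to 1, so the determinant itself
     vanishes. *)
  have k1 : (1 - t') * (x1 * y2 - x2 * y1) = 0.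
    rewrite [LHS](_ : _ = ((1 - t') * x1 + t' * x2) * y2 - x2 * ((1 - t') * y1 + t' * y2)); last by ring.
    by rewrite h1 h2; ring.
  have k2 : t' * (x1 * y2 - x2 * y1) = 0.
    rewrite [LHS](_ : _ = x1 * ((1 - t') * y1 + t' * y2) - y1 * ((1 - t') * x1 + t' * x2)); last by ring.
    by rewrite h1 h2; ring.
  lra.
have [w1 w2] := rp_near_flag (eta *: et t') a1P ep; rewrite -/(P t') in w1 w2.
have zS : rp a1 (et t' *m Ainv) = - rp a1 (et t' *m A).
  apply/eqP; rewrite -addr_eq0 addrC; apply/eqP.
  have := top_symA (etE t') => /(congr1 (rp a1)).
  by rewrite mulmxDr [LHS]rpD [RHS]rpZ z0 mulr0.
rewrite -!scalemxAl !rpZ zS in w1 w2.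
have h1 : eqv w g (amul g s).
  apply: (two_way gW a1P sSim ad).
    have [lt|gt] := ltP (rp a1 (et t' *m A)) 0.
      apply/orP; left; apply: (step_lt (p := P t')) => //.
      by rewrite w1 gtrDl pmulr_rlt0.
    have {}gt : 0 < rp a1 (et t' *m A) by rewrite lt_def zA.
    apply/orP; right; apply: (step_ltV (p := P t')) => //.
    by rewrite w2 gtrDl pmulr_rlt0 // oppr_lt0.
  have a1N := root_opp hRD a1P.
  have eN : flg (amul g s) (- a1) = - flg g a1.
    by case: ad => ad1 _; rewrite (flgN R hRD hOm hxi hx0) // ad1; ring.
  rewrite eN; have [lt|gt] := ltP (rp a1 (et t' *m A)) 0.
    apply/orP; right; apply: (step_ltV (p := P t')) => //.
    by rewrite rpNl w2 rmorphN ltrN2 ltrDl pmulr_rgt0 // oppr_gt0.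
  have {}gt : 0 < rp a1 (et t' *m A) by rewrite lt_def zA.
  apply/orP; left; apply: (step_lt (p := P t')) => //.
  by rewrite rpNl w1 rmorphN ltrN2 ltrDl pmulr_rgt0.
have [|h [hW ch eh]] := IH _ gsW _ t' t'0 t'1 cs.
  apply: leq_trans cm; apply: (count_lt (a := a1)) => //.
    move=> b bP; rewrite /bad; case: ad => ad1 ad2.
    have [->|b1] := eqVneq b a1; first by rewrite bad1.
    have [->|bN] := eqVneq b (- a1); last by rewrite ad2.
    rewrite (flgN R hRD hOm hxi hx0) // ad1 rpNl.
    have := bad1; move=> h2 h3; exfalso.
    have : (- (flg g a1 - 1) - 1)%:~R = - (flg g a1)%:~R :> R by rewrite -rmorphN; congr _%:~R; ring.
    by move=> h4; rewrite h4 in h3; lra.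
  (* [P 1] is near [p], where [a1] equals [flg g a1], so [a1] stays above the next lower level and
     is no longer bad. *)
  rewrite /bad; case: ad => -> _; rewrite -leNgt.
  have np1 := near 1 ler01 (lexx 1).
  have := (np1 a1 a1P (flg g a1 - 1)).1; rewrite -/(P 1) ep ltr_int => /(_ _)/ltW; apply.
  by rewrite ltrBlDr ltrDl.
by exists h; split=> //; apply: eqv_trans h1 eh.
Qed.

(** Each alcove flows to a point [p + eta *: z] with [z] generic in [E]. Hyperplanes through that
    point belong to roots that vanish on [E] as well, so the hypothesis applies there with [FE], and
    [path_connect] compares the two points. *)
Lemma residue_spread :
  -2 < lam < 2 ->
  (forall P, (ract w P - P <= FE)%MS ->
     {in Phi, forall a, forall k : int, rp a P = k%:~R -> kills a FE} -> residue_conj P) ->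
  residue_conj p.
Proof.
move=> /andP[lam1 lam2] IH g g' gW g'W cg cg' tg tg'.
pose L1 := [seq Pi *m rvec a | a <- Phi].
have L1P a : a \in Phi -> kills a E \/ (Pi *m rvec a \in L1 /\ Pi *m rvec a != 0).
  move=> aP; have [k|[x xE nz]] := killsP a E; [by left | right].
  split; first by apply: map_f.
  apply: contra nz => /eqP c0.
  by rewrite -(Pi_id xE) rvecE -mulmxA c0 mulmx0 mxE.
have [y [hy gy]] := generic_alcove p L1 gW.
have [e eE] : exists e, e = (y - p) *m Pi by eexists.
have [u uE] : exists u, u = rest (y - p) by eexists.
have eS : (e <= E)%MS by rewrite eE Pi_sub.
have ereg a : a \in Phi -> kills a E \/ rp a e != 0.
  move=> /L1P[k|[cL c0]]; [by left | right].
  by rewrite eE rvecE -mulmxA; apply: gy.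
(* The determinant required by [path_connect], as a linear form in its second vector; hence [e] is
   chosen before [e']. *)
pose c2 a := rp a e *: (Pi *m A *m rvec a) - rp a (e *m A) *: (Pi *m rvec a).
pose L2 := L1 ++ [seq c2 a | a <- Phi].
have [y' [hy' gy']] := generic_alcove p L2 g'W.
have [e' e'E] : exists e', e' = (y' - p) *m Pi by eexists.
have [u' u'E] : exists u', u' = rest (y' - p) by eexists.
have e'S : (e' <= E)%MS by rewrite e'E Pi_sub.
have e'reg a : a \in Phi -> kills a E \/ rp a e' != 0.
  move=> /L1P[k|[cL c0]]; [by left | right].
  by rewrite e'E rvecE -mulmxA; apply: gy'; rewrite // mem_cat cL.
have c2E a x : (x *m c2 a) 0 0 = rp a e * rp a (x *m Pi *m A) - rp a (e *m A) * rp a (x *m Pi).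
  rewrite /c2 mulmxBr -!scalemxAr !(rvecE a (x *m _)) !(rvecE a (x *m _ *m _)) !mulmxA.
  by set M := _ *m rvec a; set M' := _ *m rvec a; rewrite !mxE.
have det a : a \in Phi -> kills a E \/ rp a e * rp a (e' *m A) - rp a e' * rp a (e *m A) != 0.
  move=> aP; have [k|re] := ereg a aP; [by left | right].
  rewrite [rp a e' * _]mulrC e'E -c2E; apply: gy'.
    by rewrite mem_cat; apply/orP; right; apply: map_f.
  apply: contra re => /eqP c0; apply/eqP; apply: contrapT => /eqP re.
  (* If the form were zero, [a] would be an eigenform of [A] on [E] with a real eigenvalue. *)
  have lin x : (x <= E)%MS -> rp a e * rp a (x *m A) = rp a (e *m A) * rp a x.
    move=> xE; apply/eqP; rewrite -subr_eq0; apply/eqP.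
    by rewrite -{1 2}(Pi_id xE) -c2E c0 mulmx0 mxE.
  have eAE : (e *m A <= E)%MS by apply: (stable_row (topspace_stable N_gt0 A_ord lam F_stable)).
  have q1 := lin _ eAE.
  have q2 : rp a (e *m A *m A) + rp a e = lam * rp a (e *m A).
    have := top_symA eAE; rewrite mulmxDr -(mulmxA e A (Ainv)) (mulAV N_gt0 A_ord) mulmx1.
    by move/(congr1 (rp a)); rewrite [LHS]rpD [RHS]rpZ.
  set r := rp a e in re q1 q2; set r1 := rp a (e *m A) in q1 q2.
  set r2 := rp a (e *m A *m A) in q1 q2.
  have r0 : 0 < r * r by rewrite -expr2 exprn_even_gt0.
  (* [c = r1 / r] would be a real root of [c^2 - lam c + 1], although [|lam| < 2]. *)
  have q3 : r1 * r1 + r * r = lam * (r * r1).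
    by rewrite -q1 -mulrDr q2; ring.
  have q4 : (r1 - lam / 2 * r) * (r1 - lam / 2 * r) = (lam ^+ 2 / 4 - 1) * (r * r).
    rewrite [LHS](_ : _ = r1 * r1 + r * r - lam * (r * r1) + (lam ^+ 2 / 4 - 1) * (r * r)); last by field.
    by rewrite q3 subrr add0r.
  have q5 : 0 <= (r1 - lam / 2 * r) * (r1 - lam / 2 * r) by rewrite -expr2 sqr_ge0.
  have q6 : lam ^+ 2 / 4 - 1 < 0 by nra.
  have : (lam ^+ 2 / 4 - 1) * (r * r) < 0 by rewrite nmulr_rlt0.
  by rewrite -q4 ltNge q5.
have [d d0 hd] := small_ex (near_small p).
have pos x : 0 <= dotG x x by apply: dotG_ge0.
(* [M] bounds the squared norms of all unscaled offsets. As [1 <= M], scaling by [eta = d / M]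
   brings them within [d], where [nearp] holds. *)
pose M := 1 + 2 * (dotG e e + dotG u u + dotG e' e' + dotG u' u').
have M1 : 1 <= M by rewrite lerDl; do !apply: addr_ge0 || apply: mulr_ge0.
have M0 : 0 < M by apply: lt_le_trans M1.
pose eta := d / M; have eta0 : 0 < eta by rewrite divr_gt0.
have near v S : S <= M -> dotG v v <= eta ^+ 2 * S -> nearp p (p + v).
  move=> SM hv; apply: hd; apply: le_trans hv _.
  have e2 : 0 < eta ^+ 2 by rewrite exprn_gt0.
  apply: (@le_trans _ _ (eta ^+ 2 * M)); first by rewrite ler_pM2l.
  apply: (@le_trans _ _ (eta ^+ 2 * (M * M))); first by rewrite ler_pM2l // ler_peMl // ltW.
  by rewrite /eta expr2 mulrACA -expr2 mulfVK ?gt_eqF // [d * (_ * M)]mulrA mulfVK ?gt_eqF // expr2.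
have [g1 r1 c1] : exists2 g1, reach (hyp_at p) w g g1 & cl (p + eta *: e) g1.
  have := local_flow gW cg hy eta0; rewrite -eE -uE; apply => v; apply: near.
  by rewrite /M; have := pos e; have := pos u; have := pos e'; have := pos u'; lra.
have [g1' r1' c1'] : exists2 g1, reach (hyp_at p) w g' g1 & cl (p + eta *: e') g1.
  have := local_flow g'W cg' hy' eta0; rewrite -e'E -u'E; apply => v; apply: near.
  by rewrite /M; have := pos e; have := pos u; have := pos e'; have := pos u'; lra.
have g1W := reach_Wt r1 gW; have g1'W := reach_Wt r1' g'W.
have seg z z' t : M = 1 + 2 * (dotG z z + dotG u u + dotG z' z' + dotG u' u') ->
    0 <= t -> t <= 1 -> nearp p (p + eta *: ((1 - t) *: z + t *: z')).
  move=> Mz t0 t1; apply: (near _ (dotG z z + dotG z' z')).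
    by rewrite Mz; have := pos z; have := pos u; have := pos z'; have := pos u'; lra.
  rewrite dotGZl dotGZr mulrA -expr2 ler_pM2l ?exprn_gt0 //.
  rewrite dotGDl !dotGDr !dotGZl !dotGZr (dotGC _ _ z' z).
  have := pos (z - z'); rewrite dotGDl !dotGDr dotGNl !dotGNr dotGNl (dotGC _ _ z' z).
  have := pos z; have := pos z'; move: (dotG z z) (dotG z' z') (dotG z z') => q1 q2 q3 ? ? h.
  have : t * (1 - t) * (2 * q3) <= t * (1 - t) * (q1 + q2).
    by rewrite ler_wpM2l ?mulr_ge0 ?subr_ge0 //; lra.
  have : 0 <= t * q1 by rewrite mulr_ge0.
  have : 0 <= (1 - t) * q2 by rewrite mulr_ge0 ?subr_ge0.
  lra.
have QP z : (z <= E)%MS -> {in Phi, forall a, kills a E \/ rp a z != 0} ->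
    nearp p (p + eta *: z) -> residue_conj (p + eta *: z).
  move=> zE zreg np; apply: IH.
    have -> : ract w (p + eta *: z) - (p + eta *: z)
            = (ract w p - p) + eta *: (z *m A - z).
      rewrite (ract_wE _ p) [p + _ - p]addrAC subrr add0r -scalemxAl scalerBr.
      move: (ract w p) (eta *: z) (eta *: (z *m A)) => x1 x2 x3.
      by apply/rowP => i; rewrite !mxE; ring.
    apply: addmx_sub; first by apply: submx_trans F_disp (addsmxSl _ _).
    apply: scalemx_sub; apply: submx_trans (addsmxSr F E).
    rewrite addmx_sub ?eqmx_opp //.
    exact: (stable_row (topspace_stable N_gt0 A_ord lam F_stable)).
  move=> a aP k ea; have ep := near_int np aP ea.
  apply: kills_add; first exact: F_kills ep.
  have [//|nz] := zreg a aP; exfalso; move/negP: nz; apply.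
  move: ea; rewrite [LHS]rpD ep -[RHS]addr0 rpZ => /addrI/eqP.
  by rewrite mulf_eq0 gt_eqF.
have M' : M = 1 + 2 * (dotG e' e' + dotG u u + dotG e e + dotG u' u') by rewrite /M; ring.
have np0 : nearp p (p + eta *: e).
  by have := seg e e' 0 erefl (lexx 0) ler01; rewrite subr0 scale1r scale0r addr0.
have np1 : nearp p (p + eta *: e').
  by have := seg e' e 0 M' (lexx 0) ler01; rewrite subr0 scale1r scale0r addr0.
have t1 : terminal (hyp_at (p + eta *: e)) w g1.
  apply: terminal_mono (terminal_reach tg r1) => a k aP; exact: near_int np0 aP.
have t1' : terminal (hyp_at (p + eta *: e')) w g1'.
  apply: terminal_mono (terminal_reach tg' r1') => a k aP; exact: near_int np1 aP.
have e1 := terminal_eqv hRD hOm hxi hx0 hrel wW gW tg r1.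
have e1' := terminal_eqv hRD hOm hxi hx0 hrel wW g'W tg' r1'.
apply: eqv_trans e1 (eqv_trans _ (eqv_sym e1')).
apply: (residue_transfer (QP e eS ereg np0) (QP e' e'S e'reg np1)) => //.
  move=> h hW; apply: (path_connect eS e'S eta0 _ _ hW) => [t|a aP k _].
    exact: seg.
  exact: det.
move=> h hW; apply: (path_connect e'S eS eta0 _ _ hW) => [t|a aP k _].
  exact: seg.
have [kl|nz] := det a aP; [by left | right].
by rewrite -oppr_eq0 opprB.
Qed.

End Spread.
End Flag.

(** Induction on the codimension of [F]. That [F] contains the fixed vectors excludes [lam = 2],
    whose eigenvectors would be fixed, hence in [F], and also orthogonal to [F]. *)
Lemma residue_all p F : (F *m A <= F)%MS -> (forall x, x *m A = x -> (x <= F)%MS) ->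
  (ract w p - p <= F)%MS ->
  {in Phi, forall a, forall k : int, rp a p = k%:~R -> kills a F} -> residue_conj p.
Proof.
have [m] := ubnP (n - \rank F); elim: m => // m IH in p F *.
rewrite ltnS => rF sF fF dF kF.
have [fullF|nF] := boolP (row_full F); first exact: residue_full fullF kF.
have [lam [lmax [x xE x_neq0]]] := exists_top N_gt0 A_ord sF nF.
have /andP[l1 l2] := topspace_le2 N_gt0 A_ord xE x_neq0.
have l2' : lam < 2.
  rewrite lt_neqAle l2 andbT; apply/eqP => lam2.
  have xA := topspace_eq2 N_gt0 A_ord xE lam2.
  have xF := fF _ xA; move: xE; rewrite topspaceE => /andP[xP _].
  by move/eqP: x_neq0; apply; apply: (dotG_eq0 (A := A) N_gt0); apply: (perpP xP).
have [lamN2|lamN2] := eqVneq lam (-2).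
  apply: (residue_inversion sF dF kF) => z zP.
  exact: (topspace_eqN2 N_gt0 A_ord lmax zP lamN2).
apply: (residue_spread sF dF kF lmax).
  by rewrite l2' andbT lt_neqAle l1 andbT eq_sym.
move=> P dP kP; apply: IH dP kP.
- have h1 := topspace_rank N_gt0 xE x_neq0.
  have h2 := rank_leq_col (F + topspace N A F lam)%MS.
  exact: leq_trans (ltn_sub2l (leq_trans h1 h2) h1) rF.
- exact: FE_stable.
by move=> z /fF zF; apply: submx_trans zF (addsmxSl _ _).
Qed.

(** * The affine subspace on which [w] is a translation *)

Notation E0 := (kermx (1%:M - A)).

Lemma fixE x : (x <= E0)%MS = (x *m A == x).
Proof. by rewrite sub_kermx mulmxBr mulmx1 subr_eq0 eq_sym. Qed.

Lemma fix_stable : (E0 *m A <= E0)%MS.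
Proof. by apply: stableP => x; rewrite !fixE => /eqP e; rewrite !e. Qed.

Lemma fix_inv x : (x <= E0)%MS -> x *m Ainv = x.
Proof. by rewrite fixE => /eqP e; rewrite -{1}e -mulmxA (mulAV N_gt0 A_ord) mulmx1. Qed.

(** Orthogonality of [A] gives the opposite inclusion, and a rank count turns it into equality. *)
Lemma perp_fix_image : (perp E0 <= 1%:M - A)%MS.
Proof.
have sub : (1%:M - A <= perp E0)%MS.
  rewrite -[X in (X <= _)%MS]mul1mx; apply: stableP => x _.
  apply: (perpI (N := N)) => y; rewrite fixE => /eqP yA.
  by rewrite mulmxBr mulmx1 dotGDl dotGNl -{2}yA (dotG_mulA N_gt0 A_ord) subrr.
rewrite -(mxrank_leqif_sup sub).2 eqn_leq (mxrank_leqif_sup sub).1 /=.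
have h1 := mxrank_disjoint_sum (cap_perp A N_gt0 E0).
have h2 := rank_leq_col (E0 + perp E0)%MS; have h3 := mxrank_ker (1%:M - A).
have h4 := rank_leq_col (1%:M - A).
rewrite h1 h3 in h2; move: h2 h4; clear.
by move: (\rank (perp E0)) (\rank (1%:M - A)) => r1 r2; lia.
Qed.

(** The part of the translation orthogonal to [E0] lies in the image of [1 - A] and is absorbed by
    moving the origin to [c]; [nu] is what remains. *)
Lemma affine_center : exists c nu, (nu <= E0)%MS /\ ract w c = c + nu.
Proof.
pose t := ract w (0 : 'rV[R]_n).
have /submxP[c ec] : (t - t *m pproj E0 <= 1%:M - A)%MS.
  by apply: submx_trans perp_fix_image; apply: (pproj_compl A N_gt0).
exists c, (t *m pproj E0); split; first exact: pproj_sub.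
rewrite (ract_wE c 0) subr0 -/t -{1}[t](subrK (t *m pproj E0)) ec mulmxBr mulmx1.
by rewrite addrAC subrK.
Qed.

Lemma small_nonint (r c : R) : c != 0 ->
  small (fun d => forall k : int, r + d * c != k%:~R).
Proof.
move=> c0; have /andP[f1 f2] := floor_itv r; set f := Num.floor r in f1 f2.
have n2 (k : int) (x : R) : f%:~R < x -> x < (f + 1)%:~R -> x != k%:~R :> R.
  by move=> h1 h2; apply/eqP => e; move: h1 h2; rewrite e !ltr_int; lia.
have [e|ne] := eqVneq (f%:~R) r; last first.
  have f1' : f%:~R < r by rewrite lt_def eq_sym ne.
  apply: small_imp (small_and (small_gt c f1') (small_lt c f2)) => d _ [h1 h2] k.
  exact: n2.
rewrite -e; have [cn|cp|//] := ltgtP c 0; last by move=> ce; rewrite ce eqxx in c0.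
  have h : (f - 1)%:~R < f%:~R :> R by rewrite ltr_int; lia.
  apply: small_imp (small_gt c h) => d d0 h1 k; apply/eqP => e1.
  have h2 : f%:~R + d * c < f%:~R by rewrite gtrDl pmulr_rlt0.
  by move: h1 h2; rewrite e1 !ltr_int; lia.
have h : f%:~R < (f + 1)%:~R :> R by rewrite ltr_int; lia.
apply: small_imp (small_lt c h) => d d0 h1 k; apply: n2 h1.
by rewrite ltrDl mulr_gt0.
Qed.

Section Affine.
Variables (c nu : 'rV[R]_n).
Hypothesis nu_fix : (nu <= E0)%MS.
Hypothesis c_nu : ract w c = c + nu.

(** The only hyperplanes through a regular point are those that contain all of [c + E0]. *)
Definition regular_pt p := (p - c <= E0)%MS /\
  {in Phi, forall a, forall k : int, rp a p = k%:~R -> kills a E0}.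

Lemma regular_w p : (p - c <= E0)%MS -> ract w p = p + nu.
Proof.
rewrite fixE => /eqP e; rewrite (ract_wE p c) c_nu e.
by rewrite addrC addrA subrK.
Qed.

Lemma regular_wV p : (p - c <= E0)%MS -> ract (ainv w) p = p - nu.
Proof.
move=> pc; have uw := inWt_unit hRD hOm wW.
have := ract_wVE (ract w p) p; rewrite (ractKV _ uw) regular_w // [p + nu - p]addrAC subrr add0r.
by rewrite (fix_inv nu_fix) => {2}->; rewrite addrK.
Qed.

(** The start is a point of the open alcove whose projection [q] to [c + E0] is regular, and the
    direction is [symA - 2%:M] on [perp E0]. In the sum of root values at the images under [w] and
    [w^-1], the shifts by [nu] and [- nu] cancel. *)
Lemma affine_flow g : Wt g -> exists q g1,
  [/\ reach (fun _ _ => True) w g g1, cl q g1 & regular_pt q].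
Proof.
move=> gW; pose P0 := pproj E0.
have [|z hz] := @generic_vector _ _ [seq v <- [seq P0 *m rvec a | a <- Phi] | v != 0].
  by move=> v; rewrite mem_filter => /andP[].
have zreg a : a \in Phi -> kills a E0 \/ rp a (z *m P0) != 0.
  move=> aP; have [k|[x xE nz]] := killsP a E0; [by left | right].
  have mL : P0 *m rvec a \in [seq P0 *m rvec b | b <- Phi].
    by apply: (map_f (fun b => P0 *m rvec b)).
  rewrite rvecE -mulmxA; apply: hz; rewrite mem_filter mL andbT.
  apply: contra nz => /eqP e0.
  by rewrite -(pproj_id A N_gt0 xE) rvecE -mulmxA e0 mulmx0 mxE.
pose y0 := pt R x0 g.
have s1 : small (fun d : R => {in Phi, forall a, (flg g a)%:~R < rp a (y0 + d *: z)}).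
  apply: small_all => a aP.
  apply: small_imp (small_gt (rp a z) (flg_lt R hRD hOm hxi hx0 gW aP)) => d _ h.
  by rewrite [X in _ < X]rpD rpZ.
pose q0 := c + (y0 - c) *m P0.
have s2 : small (fun d : R => {in Phi, forall a, kills a E0 \/
    forall k : int, rp a (q0 + d *: (z *m P0)) != k%:~R}).
  apply: small_all => a aP; have [k|nz] := zreg a aP; first by exists 1 => // d _ _; left.
  apply: small_imp (small_nonint (rp a q0) nz) => d _ h; right => k.
  by rewrite [rp a _]rpD rpZ.
have [d _ [h1 h2]] := small_ex (small_and s1 s2).
pose y := y0 + d *: z; pose q := q0 + d *: (z *m P0).
have qE : q = c + (y - c) *m P0.
  by rewrite /q /q0 /y -addrA; congr (_ + _); rewrite [in RHS]addrAC [RHS]mulmxDl scalemxAl.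
pose u0 := (y - c) - (y - c) *m P0.
have yE : y = q + u0 by rewrite qE /u0 -addrA [_ *m P0 + _]addrC subrK addrC subrK.
have qc : (q - c <= E0)%MS by rewrite qE addrAC subrr add0r; apply: pproj_sub.
have u0U : (u0 <= perp E0)%MS by apply: (pproj_compl A N_gt0).
have cy : cl (q + u0) g by rewrite -yE => a aP; apply: ltW; apply: h1.
have h3 : {in Phi, forall a, kills a E0 \/ forall k : int, rp a q != k%:~R} by exact: h2.
clearbody u0 q.
have [|||g1 r1 c1] := flow (B := fun _ _ => True) (U := perp E0) (D := symA - 2%:M)
    (P0 := q) (r := dotG u0 u0) _ _ _ gW u0U (lexx _) cy.
- move=> v vU; rewrite mulmxBr mul_mx_scalar addmx_sub ?(symA_perp N_gt0 A_ord fix_stable) //.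
  by rewrite eqmx_opp scalemx_sub.
- move=> v vU v_neq0; rewrite mulmxBr mul_mx_scalar dotGDl dotGNl dotGZl -oppr_gt0 opprB.
  rewrite -(sqnorm_subA N_gt0 A_ord); apply: (dotG_gt0 A N_gt0); rewrite subr_eq0 -fixE.
  apply: contra v_neq0 => vE; rewrite -submx0 -(cap_perp A N_gt0 E0) sub_capmx vE.
  exact: vU.
- move=> v vU _ a aP k ea va; split=> //.
  have w1 : ract w (q + v) = q + nu + v *m A.
    by rewrite (ract_wE _ q) regular_w // (addrC q v) addrK.
  have w2 : ract (ainv w) (q + v) = q - nu + v *m Ainv.
    by rewrite (ract_wVE _ q) regular_wV // (addrC q v) addrK.
  have sum : rp a (ract w (q + v)) + rp a (ract (ainv w) (q + v)) = 2 * k%:~R + rp a (v *m (symA - 2%:M)).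
    rewrite w1 w2 -ea mulmxBr mul_mx_scalar mulmxDr.
    by rewrite !rpD !rpN rpZ; ring.
  by have [?|?] := ltP (rp a (ract w (q + v))) k%:~R; [left | right; lra].
exists q, g1; split=> //; split=> // a aP k e.
by have [//|nz] := h3 a aP; have := nz k; rewrite e eqxx.
Qed.

Lemma regular_diff p q a (k : int) : regular_pt p -> regular_pt q -> a \in Phi ->
  rp a p = k%:~R -> rp a q = k%:~R.
Proof.
move=> [pc rp_] [qc _] aP e; have kE := rp_ a aP k e.
have d0 : rp a (q - c - (p - c)) = 0 by apply: kE; rewrite addmx_sub // eqmx_opp.
by move: d0; rewrite opprB addrA subrK rpB e => /eqP; rewrite subr_eq0 => /eqP.
Qed.

Lemma flg_mono (x y : aff n) P (Q : 'rV[R]_n) a : Wt y -> cl P x -> cl Q y -> a \in Phi -> rp a P < rp a Q ->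
  flg x a <= flg y a.
Proof.
move=> yW cx cy aP h.
have : (flg x a)%:~R < (flg y a + 1)%:~R :> R.
  rewrite intrD; apply: le_lt_trans (cx a aP) (lt_le_trans h _).
  exact: (cl_le hRD hOm hxi hx0 yW cy aP).
by rewrite ltr_int ltzD1.
Qed.

Lemma flg_same (x y : aff n) P (Q : 'rV[R]_n) a : Wt x -> Wt y -> cl P x -> cl Q y -> a \in Phi -> rp a P = rp a Q ->
  (forall k : int, rp a P != k%:~R) -> flg x a = flg y a.
Proof.
have half (x' y' : aff n) (P' Q' : 'rV[R]_n) : Wt y' -> cl P' x' -> cl Q' y' -> a \in Phi -> rp a P' = rp a Q' ->
    (forall k : int, rp a P' != k%:~R) -> flg x' a <= flg y' a.
  move=> yW cx cy aP e nk.
  have : (flg x' a)%:~R < (flg y' a + 1)%:~R :> R.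
    rewrite intrD; apply: (@lt_le_trans _ _ (rp a P')).
      by rewrite lt_def nk (cx a aP).
    by rewrite e; apply: (cl_le hRD hOm hxi hx0 yW cy aP).
  by rewrite ltr_int ltzD1.
move=> xW yW cx cy aP e nk; apply/le_anti/andP; split; first exact: (half x y P Q).
by apply: (half y x Q P) => // k; rewrite -e.
Qed.

(* Pushing [q] far enough back along [nu] makes the distances from [h] through [g] to
   [w g], and from [h] through [w h] to [w g], add up. *)
Lemma conj_along_axis p q g h : regular_pt p -> regular_pt q -> Wt g -> Wt h -> cl p g -> cl q h ->
  {in Phi, forall a, forall k : int, rp a p = k%:~R -> flg g a = flg h a} ->
  {in Phi, forall a, 0 < rp a nu -> rp a q < rp a p} -> eqv w g h.
Proof.
move=> rp_ rq gW hW cg ch same behind.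
have wgW := inWtM wW gW; have whW := inWtM wW hW.
have cwg : cl (p + nu) (amul w g) by rewrite -regular_w ?rp_.1 //; apply: (cl_ract hRD hOm wW cg).
have cwh : cl (q + nu) (amul w h) by rewrite -regular_w ?rq.1 //; apply: (cl_ract hRD hOm wW ch).
have samew a : a \in Phi -> rp a nu = 0 -> forall k : int, rp a p = k%:~R -> flg (amul w g) a = flg (amul w h) a.
  move=> aP n0 k e; rewrite !flgM; congr (_ + _).
  apply: (same _ (W0ext_root hRD hOm wW aP) (k - ipair a w.2)).
  by rewrite rmorphB /= -e -[rp a p]addr0 -n0 -rpD -regular_w ?rp_.1 // rp_ract addrK.
have pos a : a \in Phi -> 0 < rp a nu ->
    [/\ flg h a <= flg g a, flg g a <= flg (amul w g) a, flg h a <= flg (amul w h) a &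
        flg (amul w h) a <= flg (amul w g) a].
  move=> aP n0; have b0 := behind a aP n0; split.
  - exact: (flg_mono gW ch cg aP b0).
  - by apply: (flg_mono wgW cg cwg aP); rewrite rpD ltrDl.
  - by apply: (flg_mono whW ch cwh aP); rewrite rpD ltrDl.
  by apply: (flg_mono wgW cwh cwg aP); rewrite !rpD ltrD2r.
have neg a : a \in Phi -> rp a nu < 0 ->
    [/\ flg g a <= flg h a, flg (amul w g) a <= flg g a, flg (amul w h) a <= flg h a &
        flg (amul w g) a <= flg (amul w h) a].
  move=> aP n0; have [] := pos _ (root_opp hRD aP); first by rewrite rpNl oppr_gt0.
  rewrite !(flgN R hRD hOm hxi hx0) // => h1 h2 h3 h4.
  by split; [move: h1 | move: h2 | move: h3 | move: h4]; rewrite lerD2r lerN2.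
have zero a : a \in Phi -> rp a nu = 0 ->
    (flg h a = flg g a /\ flg (amul w h) a = flg (amul w g) a) \/
    (flg g a = flg (amul w g) a /\ flg h a = flg (amul w h) a).
  move=> aP n0; have [[k e]|nk] := intP (rp a p); [left | right].
    by rewrite (same a aP k e) (samew a aP n0 k e).
  split; first by apply: (flg_same gW wgW cg cwg aP) => //; rewrite rpD n0 addr0.
  apply: (flg_same hW whW ch cwh aP); first by rewrite rpD n0 addr0.
  by move=> k; apply: contra (nk k) => /eqP e; apply/eqP/(regular_diff rq rp_ aP e).
apply: (strong_conj R hRD hOm hxi hx0 hbasis hrel wW gW hW).
  apply: (dl_add (R := R) hRD hOm hxi hx0 hW gW wgW) => a aP.
  have [n0|n0|n0] := ltgtP (rp a nu) 0.
  - by have [-> -> _ _] := neg a aP n0; rewrite orbT.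
  - by have [-> -> _ _] := pos a aP n0.
  by have [[-> _]|[<- _]] := zero a aP n0; rewrite !lexx ?andbT le_total.
apply: (dl_add (R := R) hRD hOm hxi hx0 hW whW wgW) => a aP.
have [n0|n0|n0] := ltgtP (rp a nu) 0.
- by have [_ _ -> ->] := neg a aP n0; rewrite orbT.
- by have [_ _ -> ->] := pos a aP n0.
by have [[_ ->]|[_ <-]] := zero a aP n0; rewrite !lexx ?andbT le_total.
Qed.

(** Crossing a wall beyond which [y] lies lowers the total excess [f]. No other root gains: the new
    bound for [- a] already holds at [y]. *)
Lemma alcove_exists y : exists2 h, Wt h & cl y h.
Proof.
pose f h a : nat := if rp a y < (flg h a)%:~R then `|flg h a - fl a y|%N else 0%N.
suff main m g : Wt g -> (\sum_(a <- Phi) f g a < m)%N -> exists2 h, Wt h & cl y h.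
  exact: (main _ aid (inWt1 _ _ _) (ltnSn _)).
elim: m g => // m IH g gW; rewrite ltnS => gm.
have [/hasP[a0 a0P b0]|/hasPn nb] := boolP (has (fun a => rp a y < (flg g a)%:~R) Phi); last first.
  by exists g => // a aP; rewrite leNgt; apply: nb.
have [a [s [aP ya sS ss ad]]] := wall hRD hOm hxi hx0 gW a0P b0.
have gsW := inWtM gW (simple_Wt (simpleP hRD hOm gW aP sS ss ad)).
apply: (IH (amul g s) gsW); apply: leq_trans gm.
have fy : fl a y < flg g a by rewrite /fl floor_lt_int.
have ya' : (fl a y)%:~R <= rp a y by apply: floor_le.
case: ad => ad1 ad2.
have fa : (f (amul g s) a < f g a)%N.
  rewrite /f ya ad1; case: ifP => _; move: fy; clear.
    by move: (flg g a) (fl a y) => x1 x2; lia.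
  by move: (flg g a) (fl a y) => x1 x2; lia.
apply: (sum_lt (i := a)) => // b bP.
have [->|ba] := eqVneq b a; first exact: ltnW.
have [->|bN] := eqVneq b (- a); last by rewrite /f ad2.
rewrite /f (flgN R hRD hOm hxi hx0) // ad1 rpNl ifF //.
apply/negP; rewrite (_ : - (flg g a - 1) - 1 = - flg g a); last by ring.
by rewrite rmorphN ltrN2 ltNge (ltW ya).
Qed.

(** A small multiple of the offset of [g] from [p] is attached to [q]; an alcove there is on the
    same side of every hyperplane containing [c + E0]. *)
Lemma same_side p q g : regular_pt p -> regular_pt q -> Wt g -> cl p g ->
  exists h, [/\ Wt h, cl q h &
    {in Phi, forall a, forall k : int, rp a p = k%:~R -> flg g a = flg h a}].
Proof.
move=> rp_ rq gW cg; have [d d0 hd] := small_ex (near_small q).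
have [z zE] : exists z, z = pt R x0 g - p by eexists.
have Z0 : 0 <= dotG z z by apply: dotG_ge0.
have Z1 : 0 < 1 + dotG z z by rewrite ltr_pwDl.
pose e := d / (1 + dotG z z); have e0 : 0 < e by rewrite divr_gt0.
have ez : e * (1 + dotG z z) = d by rewrite mulfVK // gt_eqF.
clearbody e.
have nq : nearp q (q + e *: z).
  apply: hd; rewrite dotGZl dotGZr mulrA -expr2 -ez exprMn.
  rewrite ler_pM2l ?exprn_gt0 //.
  by rewrite expr2; nra.
have [h hW ch] := alcove_exists (q + e *: z).
have chq := near_cl nq ch.
exists h; split=> // a aP k ea.
have eq := regular_diff rp_ rq aP ea.
have rz : rp a z = rp a (pt R x0 g) - k%:~R by rewrite zE rpB ea.
have ry : rp a (q + e *: z) = k%:~R + e * rp a z by rewrite rpD rpZ eq.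
have g1 : flg g a <= k by rewrite -(ler_int R) -ea cg.
have g2 : k <= flg g a + 1.
  by rewrite -(ler_int R) -ea intrD; apply: (cl_le hRD hOm hxi hx0 gW cg aP).
have h1 : flg h a <= k by rewrite -(ler_int R) -eq chq.
have h2 : k <= flg h a + 1.
  by rewrite -(ler_int R) -eq intrD; apply: (cl_le hRD hOm hxi hx0 hW chq aP).
have [eg|ng] := eqVneq (flg g a) k.
  have zpos : 0 < rp a z by rewrite rz subr_gt0 -eg; apply: (flg_lt R hRD hOm hxi hx0 gW aP).
  have [//|nh] := eqVneq (flg h a) k; first by move=> ->.
  have hk : flg h a + 1 = k by move: nh h1 h2; clear; move: (flg h a) => x; lia.
  have := cl_le hRD hOm hxi hx0 hW ch aP; rewrite -[_ + 1](intrD R _ 1) hk ry.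
  by rewrite gerDl pmulr_rle0 // leNgt zpos.
have gk : flg g a + 1 = k by move: ng g1 g2; clear; move: (flg g a) => x; lia.
have zneg : rp a z < 0.
  by rewrite rz subr_lt0 -gk intrD; apply: ltD1_flg.
have [eh|nh] := eqVneq (flg h a) k; last first.
  by move: ng nh g1 g2 h1 h2; clear; move: (flg g a) (flg h a) => x1 x2; lia.
have := ch a aP; rewrite eh ry lerDl pmulr_rge0 //.
by rewrite leNgt zneg.
Qed.

Lemma regular_shift p : regular_pt p -> regular_pt (ract (ainv w) p).
Proof.
move=> [pc rp_]; split; first by rewrite regular_wV // addrAC addmx_sub // eqmx_opp.
move=> a aP k e x xE; rewrite -(fix_inv xE) -map_winv rp_mulmx.
have aP' : a *m (invmx w.1)^T \in Phi by apply: (W0ext_root hRD hOm (W0ext_inv hRD hOm wW)).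
apply: (rp_ _ aP' (k - ipair a (ainv w).2)) => //.
by rewrite rmorphB /= -e rp_ract addrK.
Qed.

(** Take [h = w^-k g]: it conjugates [w] to the same element as [g] does, while its alcove has moved
    back along [nu]. *)
Lemma shift_back k p g : regular_pt p -> Wt g -> cl p g -> exists h,
  [/\ Wt h, regular_pt (p - nu *+ k), cl (p - nu *+ k) h & cj w h = cj w g].
Proof.
move=> rp_ gW cg; elim: k => [|k [h [hW rk ck e]]]; first by exists g; rewrite mulr0n subr0.
have wVW := inWtV hRD hOm wW; have uw := inWt_unit hRD hOm wW.
have E : p - nu *+ k.+1 = ract (ainv w) (p - nu *+ k).
  by rewrite regular_wV ?rk.1 // mulrSr opprD addrA.
exists (amul (ainv w) h); split.
- exact: inWtM.
- by rewrite E; apply: regular_shift.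
- by rewrite E; apply: (cl_ract hRD hOm wVW ck).
rewrite -e !cj_def !(amulA w) amulgV // amul1g.
have uh := inWt_unit hRD hOm hW; have uwh := inWt_unit hRD hOm (inWtM wVW hW).
have -> : ainv (amul (ainv w) h) = amul (ainv h) w.
  rewrite -[RHS]amulg1 -(amulgV uwh) !amulA -(amulA (ainv h) w) amulgV // amulg1.
  by rewrite amulVg // amul1g.
by rewrite -amulA.
Qed.

End Affine.

Theorem terminal_minimal_conj g g' : Wt g -> Wt g' ->
  terminal (fun _ _ => True) w g ->
  (forall h, Wt h -> (len (cj w g') <= len (cj w h))%N) -> eqv w g g'.
Proof.
move=> gW g'W tg ming'.
(* Minimality depends only on the conjugate, so it survives the shift along [nu] made below. *)
have term_min B h : Wt h -> cj w h = cj w g' -> terminal B w h.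
  move=> hW e h2 r; have m2 := ming' h2 (reach_Wt r hW).
  rewrite e; apply/eqP; rewrite eqn_leq m2 andbT -e.
  by case: (reachP hRD hOm hxi hx0 hrel wW hW r) => [[_ ->]|[/ltnW]].
have [c [nu [nu_fix c_nu]]] := affine_center.
have [p [g1 [r1 c1 rp_]]] := affine_flow nu_fix c_nu gW.
have [q [g2 [r2 c2 rq]]] := affine_flow nu_fix c_nu g'W.
have g1W := reach_Wt r1 gW; have g2W := reach_Wt r2 g'W.
have e1 := terminal_eqv hRD hOm hxi hx0 hrel wW gW tg r1.
have e2 := terminal_eqv hRD hOm hxi hx0 hrel wW g'W (term_min _ _ g'W erefl) r2.
(* Finitely many Archimedean bounds push [q] behind [p] for every root that is positive on [nu], as
   [conj_along_axis] requires. *)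
have [k hk] : exists k, {in Phi, forall a, 0 < rp a nu -> rp a (q - nu *+ k) < rp a p}.
  apply: eventually_all => a aP; have [n0|n0] := ltP 0 (rp a nu); last first.
    by exists 0%N.
  pose x := `|rp a (q - p)| / rp a nu; have x0' : 0 <= x by rewrite divr_ge0 // ltW.
  exists (Num.bound x) => k xk _.
  have kx : x < k%:R by apply: lt_le_trans (archi_boundP x0') _; rewrite ler_nat.
  move: kx; rewrite /x ltr_pdivrMr // => kx.
  have := ler_norm (rp a (q - p)).
  rewrite !rpB in kx *; rewrite -scaler_nat rpZ; lra.
have [h [hW rh ch eh]] := shift_back nu_fix c_nu k rq g2W c2.
set q' := q - nu *+ k in hk rh ch.
have RC z : regular_pt c z -> residue_conj z.
  move=> rz; apply: (residue_all fix_stable _ _ rz.2) => [x /eqP xA|].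
    by rewrite fixE.
  by rewrite (regular_w c_nu) ?rz.1 // addrAC subrr add0r.
have e3 : eqv w g1 h.
  apply: (residue_transfer (RC p rp_) (RC q' rh)) => //.
  - move=> f fW cf; have [f' [f'W cf' sd]] := same_side rp_ rh fW cf.
    exists f'; split=> //.
    exact: (conj_along_axis c_nu rp_ rh fW f'W cf cf' sd hk).
  - move=> f fW cf; have [f' [f'W cf' sd]] := same_side rh rp_ fW cf.
    exists f'; split=> //; apply: eqv_sym.
    apply: (conj_along_axis c_nu rp_ rh f'W fW cf' cf _ hk) => a aP j ej.
    by rewrite (sd a aP j) //; apply: (regular_diff rp_ rh aP ej).
  - exact: terminal_mono (terminal_reach tg r1).
  move=> f r; have l2 : len (cj w h) = len (cj w g') by rewrite eh; case: e2 => _ ->.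
  have fW := reach_Wt r hW.
  have m2 := ming' f fW; apply/eqP; rewrite eqn_leq l2 m2 andbT -l2.
  by case: (reachP hRD hOm hxi hx0 hrel wW hW r) => [[_ ->]|[/ltnW]].
apply: eqv_trans e1 (eqv_trans e3 _).
apply: eqv_trans (eqv_sym e2); split; last by rewrite eh.
by rewrite eh; apply: eqc_refl.
Qed.

End Flow.

(** * Descent on the length and collection of coefficients *)

Lemma evvvE q : evvv q = (map_poly intr q).[vv].
Proof. by []. Qed.

Lemma evvv0 : evvv 0 = 0.
Proof. by rewrite evvvE rmorph0 horner0. Qed.

Lemma evvv1 : evvv 1 = 1.
Proof. by rewrite evvvE rmorph1 hornerC. Qed.

Lemma evvvD p q : evvv (p + q) = evvv p + evvv q.
Proof. by rewrite !evvvE rmorphD hornerD. Qed.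

Lemma evvvXM p : evvv ('X * p) = vv * evvv p.
Proof. by rewrite !evvvE rmorphM /= map_polyX hornerM hornerX. Qed.

Lemma sum_evvv_collect n (H : lmodType K) (T : aff n -> H) (s : seq ({poly int} * aff n)) :
  \sum_(g <- undup (map snd s)) evvv (\sum_(q <- s | q.2 == g) q.1) *: T g
  = \sum_(q <- s) evvv q.1 *: T q.2.
Proof.
have evvv_sum (I : Type) (r : seq I) (P : pred I) F :
    evvv (\sum_(i <- r | P i) F i) = \sum_(i <- r | P i) evvv (F i).
  by apply: (big_morph evvv evvvD evvv0).
under eq_bigr do rewrite evvv_sum scaler_suml big_mkcond /=.
rewrite exchange_big /= big_seq [RHS]big_seq; apply: eq_bigr => q qs.
have qu : q.2 \in undup (map snd s) by rewrite mem_undup map_f.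
rewrite (bigD1_seq q.2) ?undup_uniq //= eqxx big1 ?addr0 // => g gq.
by rewrite eq_sym (negPf gq).
Qed.

Section Reduction.
Variables (n : nat) (Phi : seq 'rV[int]_n) (cor : 'rV[int]_n -> 'rV[int]_n)
  (xi : 'rV[int]_n) (Om : seq 'M[int]_n) (x0 : 'rV[rat]_n).
Hypothesis hRD : root_datum Phi cor.
Hypothesis hxi : regular Phi xi.
Hypothesis hOm : diagram_group Phi cor xi Om.
Hypothesis hx0 : in_fund_alcove Phi xi x0.
Variables (H : algType K) (T : aff n -> H).
Hypothesis hbasis : is_basis Phi cor Om T.
Hypothesis hrel : hecke_rel Phi cor xi Om x0 T.

Notation R := (Rdefinitions.R : realType).
Notation Wt := (inWt Phi cor Om).
Notation len := (lw Phi xi x0).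

(** Here the fixed element is [u] itself, which is its own conjugate at [aid], while [u'] is the
    conjugate at [ainv k]. Either a path from [aid] changes the length, which gives a drop, or [aid]
    is terminal. *)
Lemma drops_or_conj_minimal u u' : Wt u -> Wt u' -> conjW Phi cor Om u u' ->
  (forall h, Wt h -> conjW Phi cor Om u h -> (len u' <= len h)%N) ->
  drops Phi cor xi Om x0 T u \/ eqc Phi cor Om T (T u) (T u').
Proof.
move=> uW u'W [k kW ek] minu'.
have unitW g : Wt g -> g.1 \in unitmx by apply: (inWt_unit hRD hOm).
have cj1 : cj u aid = u.
  by rewrite cj_def amulg1 -(amulg1 (ainv aid)) amulVg ?amul1g //; apply: unitmx1.
have cjk : cj u (ainv k) = u'.
  have kV := inWtV hRD hOm kW.
  have kk : ainv (ainv k) = k.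
    rewrite -[LHS]amulg1 -(amulVg (unitW _ kW)) amulA amulVg ?amul1g //.
    exact: unitW.
  by rewrite cj_def kk amulA ek -amulA amulgV ?amulg1 //; apply: unitW.
have [N N0 uN] := W0ext_order hRD hOm uW.
have [tu|nt] := EM (terminal R Phi cor xi Om x0 (fun _ _ => True) u aid).
  right; have [|e _] := terminal_minimal_conj hRD hOm hxi hx0 hbasis hrel uW N0 uN
      (inWt1 _ _ _) (inWtV hRD hOm kW) tu; last by rewrite cj1 cjk in e.
  move=> h hW; rewrite cjk; apply: minu'; first exact: (cj_Wt hRD hOm).
  exists (ainv h); first exact: (inWtV hRD hOm hW).
  by rewrite cj_def -!amulA amulgV ?amulg1 //; apply: unitW.
left; have [g r ne] : exists2 g, reach R Phi cor xi Om x0 (fun _ _ => True) u aid g & len (cj u g) <> len (cj u aid).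
  apply: contrapT => h; apply: nt => g r; apply: contrapT => ne; apply: h; by exists g.
case: (reachP hRD hOm hxi hx0 hrel uW (inWt1 _ _ _) r) => [[_ e]|[_]].
  by case: ne; rewrite e.
by rewrite cj1.
Qed.

End Reduction.

Theorem theorem5p2
  (n : nat) (Phi : seq 'rV[int]_n) (cor : 'rV[int]_n -> 'rV[int]_n)
  (xi : 'rV[int]_n) (Om : seq 'M[int]_n) (x0 : 'rV[rat]_n)
  (hRD : root_datum Phi cor) (hxi : regular Phi xi)
  (hOm : diagram_group Phi cor xi Om)
  (hx0 : in_fund_alcove Phi xi x0)
  (H : algType K) (T : aff n -> H)
  (hbasis : is_basis Phi cor Om T)
  (hrel : hecke_rel Phi cor xi Om x0 T)
  (rep : aff n -> aff n)
  (hrep : forall g, inWt Phi cor Om g ->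
     [/\ inWt Phi cor Om (rep g), conjW Phi cor Om g (rep g) &
         forall h, inWt Phi cor Om h -> conjW Phi cor Om g h ->
           rep h = rep g /\ (len Phi xi x0 (rep g) <= len Phi xi x0 h)%N])
  (w : aff n) (hw : inWt Phi cor Om w) :
  exists s : seq ({poly int} * aff n),
    [/\ uniq (map snd s),
        forall p, p \in s ->
          [/\ inWt Phi cor Om p.2, rep p.2 = p.2 & forall i, 0 <= p.1`_i]
      & inComm Phi cor Om T
          (T w - \sum_(p <- s) evvv p.1 *: T p.2)].
Proof.
pose good (p : {poly int} * aff n) :=
  [/\ inWt Phi cor Om p.2, rep p.2 = p.2 & forall i, 0 <= p.1`_i].
(* Representatives may repeat in the recursion; adding up their coefficients afterwards preserves
   nonnegativity. *)
suff [s [gs cs]] : exists s, (forall p, p \in s -> good p) /\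
    inComm Phi cor Om T (T w - \sum_(p <- s) evvv p.1 *: T p.2).
  exists [seq (\sum_(q <- s | q.2 == g) q.1, g) | g <- undup (map snd s)]; split.
  - by rewrite -map_comp map_id undup_uniq.
  - move=> _ /mapP[g gs' ->] /=; move: (gs'); rewrite mem_undup => /mapP[q qs ->].
    have [qW qr _] := gs q qs; split=> // i.
    rewrite coef_sum big_seq_cond; apply: sumr_ge0 => q' /andP[q's _].
    by have [_ _ h] := gs q' q's.
  by rewrite big_map sum_evvv_collect.
have [m] := ubnP (lw Phi xi x0 w); elim: m => // m IH in w hw *; rewrite ltnS => lm.
have [rW cwr hmin] := hrep w hw.
have minw h : inWt Phi cor Om h -> conjW Phi cor Om w h ->
    (lw Phi xi x0 (rep w) <= lw Phi xi x0 h)%N.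
  by move=> hW c; rewrite !lwE; case: (hmin h hW c).
have [[u1 [u2 [u1W u2W l1 l2 e]]]|e] :=
  drops_or_conj_minimal hRD hxi hOm hx0 hbasis hrel hw rW cwr minw.
- have [s1 [g1 c1]] := IH u1 u1W (leq_trans l1 lm).
  have [s2 [g2 c2]] := IH u2 u2W (leq_trans l2 lm).
  (* Under [evvv] the factor ['X] becomes the coefficient [vv] of [T u2]. *)
  exists (s1 ++ [seq ('X * p.1, p.2) | p <- s2]); split.
    move=> p; rewrite mem_cat => /orP[/g1//|/mapP[q /g2[qW qr qc] ->]]; split=> //= i.
    by rewrite coefXM; case: ifP.
  rewrite big_cat big_map /=.
  under [X in _ - (_ + X)]eq_bigr do rewrite evvvXM -scalerA.
  rewrite -scaler_sumr.
  have := CmD e (CmD c1 (CmZ isA_vv c2)); congr (inComm _ _ _ _ _).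
  rewrite scalerBr; move: (T w) (T u1) (vv *: T u2) (\sum_(p <- s1) _) (vv *: \sum_(p <- s2) _).
  move=> a b c d f; have -> : b - d + (c - f) = (b + c) - (d + f) by rewrite opprD addrACA.
  by rewrite addrA subrK.
exists [:: (1, rep w)]; split; last by rewrite big_seq1 evvv1 scale1r.
move=> p; rewrite mem_seq1 => /eqP ->; split=> //=.
  by case: (hmin (rep w) rW cwr).
by move=> i; rewrite coefC; case: ifP.
Qed.
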